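(* Let $d\ge1$, $\beta>2$, $1\le p,q\le\infty$, $s\in\mathbb{R}$. If $$\|S_\beta(t)u\|_{L^p(I\times\mathbb{R}^d)}\le C\|u\|_{M^{s}_{p,q}}\quad\text{for all }u\in M^{s}_{p,q},$$ then $$s\ge\max\Big\{d\Big(1-\frac1p-\frac1q\Big)-\frac\beta p,\ d(\beta-2)\Big(\frac1p-\frac12\Big)+d\Big(\frac1p-\frac1q\Big)\Big\}.$$ Moreover, if in addition $p\le2$ and $p\ge q$, then $s\ge d(\beta-2)\left(\frac1p-\frac12\right)$.
   Context: $I=[0,1]$. For $\beta>0$, $S_\beta(t)=\mathcal{F}^{-1}e^{it|\xi|^\beta}\mathcal{F}$ on $\mathbb{R}^d$. $\langle x\rangle=(1+|x|^2)^{1/2}$. Modulation spaces: let $\{\eta_k\}_{k\in\mathbb{Z}^d}$ be Schwartz functions with $|\eta_k(\xi)|\gtrsim1$ if $|\xi-k|<c$, $\operatorname{supp}\eta_k\subseteq\{|\xi-k|<C\}$, $\sum_k\eta_k\equiv1$, uniformly bounded derivatives; $\Box_k=\mathcal{F}^{-1}\eta_k\mathcal{F}$. $\|f\|_{M^s_{p,q}}=\big(\sum_{k\in\mathbb{Z}^d}\langle k\rangle^{sq}\|\Box_k f\|_{L^p}^q\big)^{1/q}$ (usual modification for $q=\infty$). *)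

(* Defs.v *)
From HB Require Import structures.
From mathcomp Require Import all_boot all_order all_algebra.
From mathcomp Require Import all_classical all_reals all_analysis.
From mathcomp Require Import complex.

Set Implicit Arguments.
Unset Strict Implicit.
Unset Printing Implicit Defensive.

Import Order.TTheory GRing.Theory Num.Theory.
Import numFieldNormedType.Exports.
Local Open Scope classical_set_scope.
Local Open Scope ring_scope.

Section Defs.
Variable R : realType.
Local Notation C := R[i].

Definition vec (d : nat) := 'rV[R]_d.
Definition dotv d (x y : vec d) : R := \sum_(i < d) x ord0 i * y ord0 i.
Definition normv d (x : vec d) : R := Num.sqrt (dotv x x).
Definition jbr d (x : vec d) : R := Num.sqrt (1 + dotv x x).
Definition cabs (z : C) : R := Num.sqrt (complex.Re z ^+ 2 + complex.Im z ^+ 2).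
Definition cexpi (th : R) : C := Complex (cos th) (sin th).

(* Lebesgue integral on R^d, written as the iterated integral over the
   coordinates (Tonelli/Fubini) *)
Fixpoint iint (n : nat) (g : seq R -> \bar R) : \bar R :=
  match n with
  | 0 => g [::]
  | n'.+1 => (\int[@lebesgue_measure R]_x iint n' (fun s => g (x :: s)))%E
  end.
Definition seq_to_vec d (s : seq R) : vec d := \row_(i < d) nth 0 s i.
Definition intRd d (g : vec d -> \bar R) : \bar R :=
  iint d (fun s => g (seq_to_vec d s)).
Definition cint d (h : vec d -> C) : C :=
  Complex (fine (intRd (fun x => (complex.Re (h x))%:E)))
          (fine (intRd (fun x => (complex.Im (h x))%:E))).

Definition fourier d (f : vec d -> C) : vec d -> C :=
  fun xi => cint (fun x => f x * cexpi (- dotv x xi)).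
Definition ifourier d (g : vec d -> C) : vec d -> C :=
  fun x => Complex ((2 * pi) ^- d) 0 * cint (fun xi => g xi * cexpi (dotv x xi)).

Definition dir d (i : 'I_d) : vec d := \row_(j < d) (i == j)%:R.
Fixpoint pder d (l : seq 'I_d) (f : vec d -> R) : vec d -> R :=
  match l with
  | [::] => f
  | i :: l' => fun x => derive1 (fun t : R => pder l' f (x + t *: dir i)) 0
  end.
Definition all_partials_exist d (f : vec d -> R) :=
  forall (l : seq 'I_d) (i : 'I_d) (x : vec d),
    derivable (fun t : R => pder l f (x + t *: dir i)) 0 1.

Definition schwartz d (f : vec d -> C) :=
  all_partials_exist (fun x => complex.Re (f x)) /\ all_partials_exist (fun x => complex.Im (f x)) /\
  forall (l : seq 'I_d) (m : nat), exists M : R, forall x : vec d,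
    jbr x ^+ m * (`|pder l (fun y => complex.Re (f y)) x| + `|pder l (fun y => complex.Im (f y)) x|) <= M.

Definition Lp_of (T : Type) (I : (T -> \bar R) -> \bar R) (p : \bar R) (f : T -> R)
  : \bar R :=
  match p with
  | r%:E => poweR (I (fun x => (powR `|f x| r)%:E)) r^-1
  | +oo%E => ereal_inf [set M : \bar R |
                 I (fun x => (if (M < (`|f x|)%:E)%E then 1 else 0)%:E) = 0%E]
  | -oo%E => 0%E
  end.

Definition LpRd d (p : \bar R) (f : vec d -> C) : \bar R :=
  Lp_of (@intRd d) p (fun x => cabs (f x)).
Definition LpIRd d (p : \bar R) (F : R -> vec d -> C) : \bar R :=
  Lp_of (fun g : R * vec d -> \bar R =>
           (\int[@lebesgue_measure R]_(t in [set t : R | (0 <= t <= 1)%R])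
               intRd (fun x => g (t, x)))%E)
        p (fun tx => cabs (F tx.1 tx.2)).

Definition Sbeta d (beta t : R) (u : vec d -> C) : vec d -> C :=
  ifourier (fun xi => cexpi (t * powR (normv xi) beta) * fourier u xi).

Definition intv d (k : 'rV[int]_d) : vec d := map_mx (fun z : int => z%:~R) k.

Definition bapu d (eta : 'rV[int]_d -> vec d -> C) :=
  (forall k, schwartz (eta k)) /\
  (exists c c0 : R, 0 < c /\ 0 < c0 /\
     forall k xi, normv (xi - intv k) < c -> c0 <= cabs (eta k xi)) /\
  (exists C0 : R, forall k,
     closure [set xi | eta k xi != 0] `<=` [set xi | normv (xi - intv k) < C0]) /\
  (forall xi : vec d, exists F : seq 'rV[int]_d, uniq F /\
     (forall k, k \notin F -> eta k xi = 0) /\ \sum_(k <- F) eta k xi = 1) /\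
  (forall l : seq 'I_d, exists M : R, forall k xi,
     `|pder l (fun y => complex.Re (eta k y)) xi| + `|pder l (fun y => complex.Im (eta k y)) xi| <= M).

Definition box d (eta : 'rV[int]_d -> vec d -> C) (k : 'rV[int]_d) (f : vec d -> C)
  : vec d -> C := ifourier (fun xi => eta k xi * fourier f xi).

Definition modnorm d (eta : 'rV[int]_d -> vec d -> C) (s : R) (p q : \bar R)
  (f : vec d -> C) : \bar R :=
  match q with
  | r%:E => poweR (\esum_(k in [set: 'rV[int]_d])
                     poweR ((powR (jbr (intv k)) s)%:E * LpRd p (box eta k f))%E r) r^-1
  | +oo%E => ereal_sup [set ((powR (jbr (intv k)) s)%:E * LpRd p (box eta k f))%E
                       | k in [set: 'rV[int]_d]]
  | -oo%E => 0%E
  end.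

Definition einv (p : \bar R) : R := if p is r%:E then r^-1 else 0.

End Defs.

(* Main.v *)
Require Import Defs.
From HB Require Import structures.
From mathcomp Require Import all_boot all_order all_algebra.
From mathcomp Require Import all_classical all_reals all_analysis.
From mathcomp Require Import measurable_realfun complex.
From mathcomp Require Import ring lra zify.

Set Implicit Arguments.
Unset Strict Implicit.
Unset Printing Implicit Defensive.

Import Order.TTheory GRing.Theory Num.Theory.
Import numFieldNormedType.Exports.
Local Open Scope classical_set_scope.
Local Open Scope ring_scope.

(* All test functions are sums of modulated Gaussians u(x) = sum_k e^(i k.x)
   e^(-|x|^2/2), where k runs over the n^d integer points with coordinates in
   [N, N+n). The Fourier transform of u is a sum of unit Gaussians centred at
   these points, so only O(n^d) boxes near them matter and
   |u|_(M^s_(p,q)) <= C N^s n^(d/q). Below, beta = b + 2 with b > 0.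

   Focusing (n = N): for |t| <= c N^(-beta) and |x| <= c/N the phases
   x.xi + t|xi|^beta are O(c) on the relevant frequencies, so |S(t)u| is at
   least c N^d there, whence |S u|_(L^p) >= c N^(d - (d+beta)/p).

   Dispersion (t in [1/2, 1], 1 <= n <= N): take rho of size N^(b/2), large
   enough, and the (n rho)^d frequencies xi_j of the lattice of mesh 1/rho.
   Near xi_j at scale 1/rho, t|xi|^beta is affine up to a small error because
   its Hessian is O(N^b); hence |S(t)u| has integral at least c against the
   Gaussian chi_j of width rho around x_j = - t grad(|.|^beta)(xi_j). The
   gradient map expands distances by N^b, so the chi_j have bounded overlap.
   Thus |S(t)u| is of size rho^(-d) on a set of measure (n rho)^d rho^d, and
   |S u|_(L^p) >= c n^(d/p) N^(d b (1/p - 1/2)).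

   Letting N tend to infinity, focusing with n = N gives the first lower bound
   on s, dispersion with n = N the second, and dispersion with n = 1 the last. *)

(** * Iterated integrals on R^d *)

(** Gaussians are used because their Fourier transforms are explicit and because a smaller rate pays
    for every polynomial factor: each error term is a growing factor times a Gaussian, hence a small
    multiple of a wider Gaussian, and no frequency cut-off is needed. The functions eta_k, by
    contrast, are arbitrary, with only supports and derivatives under control; 2d integrations by
    parts in each coordinate separately bound every box by a multiple of prod_i (1 + x_i^2)^(-1),
    whose L^p norms are bounded uniformly in p in [1, oo]. S(t)u is known only on average against
    each of the overlapping packets chi_j. A linear minorant of y^p turns these averages into a
    lower bound for the L^p norm, so neither disjoint supports nor pointwise control of S(t)u are
    required. Integrals on R^d are iterated integrals by definition. Identities between them are
    proved for measurable functions dominated by a Gaussian, where Fubini's theorem applies; norms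
    are then compared with such integrals by monotonicity. *)

(* The integral of a nonnegative function, measurable or not, is by definition a
   supremum over the simple functions below it. *)
Lemma ge0_le_integral_nomeas d (T : measurableType d) (R : realType)
    (mu : {measure set T -> \bar R}) (D : set T) (f g : T -> \bar R) :
  (forall x, D x -> 0 <= f x)%E -> (forall x, D x -> f x <= g x)%E ->
  (\int[mu]_(x in D) f x <= \int[mu]_(x in D) g x)%E.
Proof.
move=> f0 fg.
rewrite !ge0_integralE//; last by move=> x Dx; exact: le_trans (f0 _ Dx) (fg _ Dx).
apply: le_ereal_sup => _ [h hf <-]; exists h => // x.
apply: le_trans (hf x) _; rewrite /patch; case: ifPn => //.
by rewrite inE => /fg.
Qed.

Section ProductSpace.
Variable R : realType.
Local Notation leb := (@lebesgue_measure R).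

(* [iint] integrates functions of lists; [space n] supplies the iterated product
   measure space carrying such functions. *)
Record mspace := MSpace {
  mdisp : measure_display;
  msort : measurableType mdisp;
  mmeas : {sigma_finite_measure set msort -> \bar R};
  mseq : msort -> seq R }.

Section extend.
Variables (d : measure_display) (T : measurableType d).
Variable m : {sigma_finite_measure set T -> \bar R}.

(** A named copy of the product measure: the sigma-finite structure attached to it below lets
    [space] iterate the construction. *)
Definition prodR_measure (A : set (measurableTypeR R * T)) : \bar R := (leb \x m)%E A.

HB.instance Definition _ := Measure.copy prodR_measure
  (leb \x m : {measure set (measurableTypeR R * T)%type -> \bar R})%E.

Lemma prodR_measure_sigma_finite : sigma_finite setT prodR_measure.
Proof.
have /sigma_finiteP[F [TF ndF Foo]] := @sigma_finiteT _ _ _ leb.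
have /sigma_finiteP[G [TG ndG Goo]] := sigma_finiteT m.
exists (fun n => F n `*` G n).
  apply/seteqP; split => // -[x y] _.
  have [i _ Fix] : (\bigcup_i F i) x by rewrite -TF.
  have [j _ Gjy] : (\bigcup_i G i) y by rewrite -TG.
  exists (maxn i j) => //; split => /=.
    by move: Fix; exact/subsetPset/ndF/leq_maxl.
  by move: Gjy; exact/subsetPset/ndG/leq_maxr.
move=> k; have [? ?] := Foo k; have [? ?] := Goo k; split; first exact: measurableX.
rewrite /prodR_measure product_measure1E//.
by rewrite lte_mul_pinfty// ge0_fin_numE.
Qed.

HB.instance Definition _ := Measure_isSigmaFinite.Build _ _ _ prodR_measure
  prodR_measure_sigma_finite.

End extend.

Fixpoint space (n : nat) : mspace :=
  match n with
  | 0 => @MSpace _ unit (@dirac _ unit tt R) (fun _ => [::])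
  | n'.+1 => 
      @MSpace _ (measurableTypeR R * msort (space n'))%type
        (prodR_measure (mmeas (space n'))) (fun z => z.1 :: mseq z.2)
  end.

Definition E n := msort (space n).
Definition mu n : {sigma_finite_measure set E n -> \bar R} := mmeas (space n).
Definition coords n (z : E n) : seq R := mseq z.

Lemma size_coords n (z : E n) : size (coords z) = n.
Proof. by elim: n z => //= n IH [x y] /=; rewrite /coords /= -/(coords y) IH. Qed.

Lemma iint_ge0 n (g : seq R -> \bar R) : (forall s, 0 <= g s)%E -> (0 <= iint n g)%E.
Proof. by elim: n g => //= n IH g g0; apply: integral_ge0 => x _; exact: IH. Qed.

Lemma iint_eq n (g h : seq R -> \bar R) :
  (forall s, size s = n -> g s = h s) -> iint n g = iint n h.
Proof.
elim: n g h => /= [g h gh|n IH g h gh]; first exact: gh.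
by apply: eq_integral => x _; apply: IH => s sn; apply: gh; rewrite /= sn.
Qed.

Lemma iint_le n (g h : seq R -> \bar R) : (forall s, 0 <= g s)%E ->
  (forall s, size s = n -> g s <= h s)%E -> (iint n g <= iint n h)%E.
Proof.
elim: n g h => /= [g h _|n IH g h g0 gh]; first exact.
apply: ge0_le_integral_nomeas => x _; first exact: iint_ge0.
by apply: IH => // s sn; apply: gh; rewrite /= sn.
Qed.

Lemma iint_tonelli n (g : seq R -> \bar R) : (forall s, 0 <= g s)%E ->
  measurable_fun setT (fun z : E n => g (coords z)) ->
  iint n g = (\int[mu n]_z g (coords z))%E.
Proof.
elim: n g => [g g0 mg|n IH g g0 mg] /=.
  rewrite (@integral_dirac _ unit tt R setT) // diracT mul1e //.
have fg := fubini_tonelli1 (m1 := leb) (m2 := mu n) (g \o @coords n.+1) mg (fun=> g0 _).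
rewrite [RHS]fg; apply: eq_integral => x _.
rewrite IH //.
exact: (measurable_fun_pair2 (T1 := measurableTypeR R) (T2 := E n)
  (f := fun z : measurableTypeR R * E n => g (@coords n.+1 z)) x mg).
Qed.

End ProductSpace.

Section Derive0.
Variable R : realType.
Local Notation leb := (@lebesgue_measure R).

(** The fundamental theorem of calculus on [-(n+1), n+1] leaves boundary terms that tend to 0, and
    dominated convergence with majorant |h'| passes to the whole line. Hence decay of h along the
    integers is enough. *)
Lemma integral_derive0 (h h' : R -> R) :
  (forall x : R, is_derive x (1 : R) h (h' x)) -> continuous h' ->
  leb.-integrable setT (EFin \o h') ->
  h n%:R @[n --> \oo] --> 0 -> h (- n%:R) @[n --> \oo] --> 0 ->
  (\int[leb]_x (h' x)%:E = 0)%E.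
Proof.
move=> dh ch' ih hp hm.
pose f_ n := (EFin \o h') \_ `[- n.+1%:R, n.+1%:R].
have mh' : measurable_fun setT (EFin \o h').
  by apply/measurable_EFinP; exact: continuous_measurable_fun.
have := @dominated_convergence _ _ R leb setT measurableT f_ (EFin \o h') (abse \o (EFin \o h')).
case.
- by move=> n; apply/measurable_restrict => //; rewrite setTI; exact: measurable_funTS.
- exact: mh'.
- apply: aeW => x _; apply: cvg_near_cst.
  near=> n; rewrite /f_ /patch mem_setE ifT// in_itv /= -ler_norml.
  near: n; exists (Num.bound `|x|) => // n /= Nn.
  apply: le_trans (ltW (archi_boundP (normr_ge0 x))) _.
  by rewrite ler_nat (leq_trans Nn).
- exact: integrable_abse.
- apply: aeW => x n _; rewrite /f_ /patch; case: ifP => //=.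
  by rewrite normr0 lee_fin.
move=> _ _ cv.
have e n : (\int[leb]_x f_ n x = (h n.+1%:R)%:E - (h (- n.+1%:R))%:E)%E.
  rewrite -integral_mkcond /=.
  apply: (@continuous_FTC2 _ h') => //.
  - by have := ltr0Sn R n; lra.
  - exact: continuous_subspaceT.
  - have cn x : h y @[y --> x] --> h x.
      by have [/derivable1_diffP/differentiable_continuous] := dh x.
    split.
    + by move=> x _; have [] := dh x.
    + by apply: cvg_at_right_filter; exact: cn.
    + by apply: cvg_at_left_filter; exact: cn.
  - by move=> x _; rewrite derive1E; have [] := dh x.
have c0 : (\int[leb]_x f_ n x)%E @[n --> \oo] --> 0%E.
  under eq_fun do rewrite e -EFinB.
  apply: cvg_EFin; first exact: nearW.
  have -> : 0 = 0 - 0 :> R by rewrite subr0.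
  apply: cvgB.
    by rewrite (cvg_shiftS (fun n => h n%:R)).
  by rewrite (cvg_shiftS (fun n => h (- n%:R))).
exact: (cvg_unique _ cv c0).
Unshelve. all: by end_near. Qed.

End Derive0.

(** * Gaussian integrals *)

Section Gauss1.
Variable R : realType.
Local Notation leb := (@lebesgue_measure R).

Definition g1 (r a x : R) : R := expR (- (r * (x - a) ^+ 2)).

Lemma g1_ge0 r a x : 0 <= g1 r a x. Proof. exact: expR_ge0. Qed.

Lemma is_derive_g1 r a (x : R) : is_derive x (1 : R) (g1 r a) (- (2 * r * (x - a)) * g1 r a x).
Proof.
rewrite /g1; apply: is_derive_eq; rewrite /GRing.scale /=.
by move=> *; ring.
Qed.

Lemma continuous_g1 r a : continuous (g1 r a).
Proof.
move=> x; by have [/derivable1_diffP/differentiable_continuous] := is_derive_g1 r a x.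
Qed.

Lemma measurable_g1 r a : measurable_fun setT (g1 r a).
Proof. by apply: continuous_measurable_fun; exact: continuous_g1. Qed.

(** A Gaussian of rate r is a multiple of the normal density of variance 1/(2r), whose total mass 1
    fixes the constant and excludes infinite values. *)
Lemma integral_g1 r a : 0 < r -> (\int[leb]_x (g1 r a x)%:E = (Num.sqrt (pi / r))%:E)%E.
Proof.
move=> r0; pose s := Num.sqrt ((2 * r)^-1).
have s0 : 0 < s by rewrite sqrtr_gt0 invr_gt0 mulr_gt0.
have s2 : s ^+ 2 = (2 * r)^-1 by rewrite sqr_sqrtr// invr_ge0 mulr_ge0// ltW.
have := @integral_normal_pdf R a s.
rewrite (_ : (fun x => (normal_pdf a s x)%:E) = (fun x => (normal_peak s)%:E * (g1 r a x)%:E)%E); last first.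
  apply/funext => x; rewrite normal_pdfE ?gt_eqF// -EFinM; congr (_ * _)%:E.
  rewrite /normal_fun /g1 s2; congr expR; field; exact: lt0r_neq0.
rewrite ge0_integralZl//; last 3 first.
- by apply/measurable_EFinP; exact: measurable_g1.
- by move=> x _; rewrite lee_fin g1_ge0.
- by rewrite lee_fin normal_peak_ge0.
have p0 : normal_peak s != 0 by rewrite gt_eqF// normal_peak_gt0// gt_eqF.
have pe : (normal_peak s)^-1 = Num.sqrt (pi / r).
  rewrite /normal_peak invrK; congr Num.sqrt; rewrite s2.
  by field; exact: lt0r_neq0.
case: (\int[leb]_x (g1 r a x)%:E)%E => [y| |].
- by rewrite -EFinM => -[] e; congr EFin; rewrite -pe -[LHS](mulKf p0) e mulr1.
- by rewrite gt0_muley// lte_fin lt0r p0 normal_peak_ge0.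
- by rewrite gt0_muleNy// lte_fin lt0r p0 normal_peak_ge0.
Qed.

Lemma integrable_g1 r a : 0 < r -> leb.-integrable setT (EFin \o g1 r a).
Proof.
move=> r0; apply/integrableP; split.
  by apply/measurable_EFinP; exact: measurable_g1.
under eq_integral do rewrite /= ger0_norm ?g1_ge0//.
by rewrite integral_g1// ltry.
Qed.

End Gauss1.

Section Gauss1FT.
Variable R : realType.
Local Notation leb := (@lebesgue_measure R).

Lemma norm_le_1Dsqr (y : R) : `|y| <= 1 + y ^+ 2.
Proof.
have y2 : y ^+ 2 = `|y| ^+ 2 by rewrite real_normK ?num_real.
by rewrite y2; have := normr_ge0 y; nra.
Qed.

Lemma le_norm_expR (r y : R) : 0 < r -> `|y| <= (1 + r^-1) * expR (r * y ^+ 2).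
Proof.
move=> r0; have ir : 0 < r^-1 by rewrite invr_gt0.
apply: (@le_trans _ _ ((1 + r^-1) * (1 + r * y ^+ 2))); last first.
  by rewrite ler_wpM2l ?expR_ge1Dx// addr_ge0// ltW.
apply: (le_trans (norm_le_1Dsqr y)).
have re : (1 + r^-1) * (1 + r * y ^+ 2) = 1 + y ^+ 2 + (r^-1 + r * y ^+ 2).
  by field; exact: lt0r_neq0.
have ry : 0 <= r * y ^+ 2 by rewrite mulr_ge0 ?sqr_ge0// ltW.
by rewrite re; lra.
Qed.

(** Half of the rate of the Gaussian pays for the factor |x - a|. *)
Lemma le_norm_gauss (r a x : R) : 0 < r ->
  `|x - a| * g1 r a x <= (1 + 2 / r) * g1 (r / 2) a x.
Proof.
move=> r0; have e2 : expR (r / 2 * (x - a) ^+ 2) * g1 r a x = g1 (r / 2) a x.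
  by rewrite /g1 -expRD; congr expR; field.
rewrite -e2 mulrA ler_wpM2r ?g1_ge0//.
have -> : 2 / r = (r / 2)^-1 by rewrite invf_div.
by apply: le_norm_expR; rewrite divr_gt0.
Qed.

Lemma integrable_g1M (r a : R) (f : R -> R) (A : R) : 0 < r ->
  measurable_fun setT f -> (forall x, `|f x| <= A * g1 r a x) ->
  leb.-integrable setT (EFin \o f).
Proof.
move=> r0 mf fA.
apply: (@le_integrable _ _ _ leb _ measurableT _ (fun x => A%:E * (g1 r a x)%:E)%E).
- exact/measurable_EFinP.
- by move=> x _ /=; rewrite lee_fin; apply: le_trans (fA x) (ler_norm _).
- by apply: integrableZl => //; exact: integrable_g1.
Qed.

Lemma cvg_g1_nat (r a A : R) (f : R -> R) (u : nat -> R) : 0 < r -> 0 <= A ->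
  (forall n, n%:R - `|a| <= `|u n - a|) ->
  (forall x, `|f x| <= A * g1 r a x) -> f (u n) @[n --> \oo] --> 0.
Proof.
move=> r0 A0 ua fg; pose C := 2 + `|a| + r^-1.
have ir : 0 < r^-1 by rewrite invr_gt0.
apply/norm_cvg0P.
apply: (@squeeze_cvgr _ _ _ _ (cst 0) (fun n : nat => A * C * n.+1%:R^-1)); last 2 first.
- exact: cvg_cst.
- by rewrite -(mulr0 (A * C)); apply: cvgMr; exact: cvg_harmonic.
apply: nearW => n; rewrite normr_ge0 /=.
apply: le_trans (fg _) _; rewrite -mulrA ler_wpM2l//; set y := u n - a.
rewrite ler_pdivlMr ?ltr0n// /g1 -/y expRN mulrC ler_pdivrMr ?expR_gt0//.
apply: (@le_trans _ _ (1 + `|a| + `|y|)).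
  by have := ua n; rewrite -/y -natr1; lra.
have := le_norm_expR y r0.
have : 1 <= expR (r * y ^+ 2).
  by rewrite -expR0 ler_expR mulr_ge0 ?sqr_ge0// ltW.
set e := expR _ => e1; have a0 := normr_ge0 a.
by rewrite /C; nra.
Qed.

(** As a function F of the frequency v, the integral solves F' = - v F / (2r): differentiation under
    the integral sign gives F', and an integration by parts relates it to F. Hence F(v) e^(v^2/(4r))
    is constant, and its value at 0 is the plain Gaussian integral. *)
Lemma integral_g1_cos (r a v th : R) : 0 < r ->
  (\int[leb]_x (cos ((x - a) * v + th) * g1 r a x)%:E =
   (cos th * Num.sqrt (pi / r) * expR (- (v ^+ 2 / (4 * r))))%:E)%E.
Proof.
move=> r0; have r20 : 0 < r / 2 by rewrite divr_gt0.
pose f (v x : R) := cos ((x - a) * v + th) * g1 r a x.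
pose f' (v x : R) := - (x - a) * sin ((x - a) * v + th) * g1 r a x.
have df w x : is_derive (w : R) (1 : R) (f^~ x) (f' w x).
  by rewrite /f /f'; apply: is_derive_eq; rewrite /GRing.scale /=; ring.
have mf w : measurable_fun setT (f w).
  apply: measurable_funM; last exact: measurable_g1.
  apply: continuous_measurable_fun => x; apply: continuous_comp; last exact: continuous_cos.
  by apply: cvgD; [apply: cvgMl; apply: cvgB; [exact: cvg_id|exact: cvg_cst]|exact: cvg_cst].
have mf' w : measurable_fun setT (f' w).
  apply: measurable_funM; last exact: measurable_g1.
  apply: measurable_funM; first by apply: measurable_funN; apply: measurable_funB.
  apply: continuous_measurable_fun => x; apply: continuous_comp; last exact: continuous_sin.
  by apply: cvgD; [apply: cvgMl; apply: cvgB; [exact: cvg_id|exact: cvg_cst]|exact: cvg_cst].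
have fb w x : `|f w x| <= 1 * g1 r a x.
  rewrite /f normrM (ger0_norm (g1_ge0 _ _ _)) ler_wpM2r ?g1_ge0//.
  by rewrite ler_norml cos_geN1 cos_le1.
have fb' w x : `|f' w x| <= (1 + 2 / r) * g1 (r / 2) a x.
  apply: le_trans (le_norm_gauss a x r0).
  rewrite /f' !normrM normrN (ger0_norm (g1_ge0 _ _ _)) ler_wpM2r ?g1_ge0//.
  by rewrite ler_piMr// ler_norml sin_geN1 sin_le1.
have if_ w : leb.-integrable setT (EFin \o f w) by exact: integrable_g1M (mf w) (fb w).
have if'_ w : leb.-integrable setT (EFin \o f' w) by exact: integrable_g1M r20 (mf' w) (fb' w).
pose F w := (\int[leb]_x f w x)%R.
pose F' w := (\int[leb]_x f' w x)%R.
have dF w : is_derive (w : R) (1 : R) F (F' w).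
  have Iw : `]w - 1, w + 1[%classic w by rewrite /= in_itv /=; lra.
  have H1 := @derivable_under_integral R _ _ leb f setT measurableT w _ _ Iw
    (fun w' _ => if_ w') (fun w' x _ _ => let: DeriveDef d _ := df w' x in d)
    (fun x => (1 + 2 / r) * g1 (r / 2) a x).
  have H2 := @differentiation_under_integral R _ _ leb f setT measurableT w _ _ Iw
    (fun w' _ => if_ w') (fun w' x _ _ => let: DeriveDef d _ := df w' x in d)
    (fun x => (1 + 2 / r) * g1 (r / 2) a x).
  have G0 x : 0 <= (1 + 2 / r) * g1 (r / 2) a x.
    by rewrite mulr_ge0 ?g1_ge0// addr_ge0// divr_ge0// ltW.
  have iG : leb.-integrable setT (EFin \o (fun x => (1 + 2 / r) * g1 (r / 2) a x)).
    apply: (@integrable_g1M (r / 2) a _ (1 + 2 / r)) => //.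
      by apply: measurable_funM => //; exact: measurable_g1.
    by move=> x; rewrite ger0_norm.
  have pE w' x : partial1of2 f w' x = f' w' x.
    by rewrite partial1of2E; have [] := df w' x.
  have Gb w' x : `]w - 1, w + 1[%classic w' -> setT x -> `|partial1of2 f w' x| <= (1 + 2 / r) * g1 (r / 2) a x.
    by move=> _ _; rewrite pE; exact: fb'.
  apply: DeriveDef; first exact: H1.
  rewrite -derive1E H2//; apply: eq_Rintegral => x _; exact: pE.
(* The integral of the derivative of sin((x - a) w + th) e^(-r (x - a)^2) vanishes, which reads w F
   + 2 r F' = 0. *)
have ibp w : F' w = - (w / (2 * r)) * F w.
  pose h x := sin ((x - a) * w + th) * g1 r a x.
  pose h' x := w * f w x + 2 * r * f' w x.
  have dh x : is_derive (x : R) (1 : R) h (h' x).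
    have dg := is_derive_g1 r a x.
    rewrite /h /h' /f /f'; apply: is_derive_eq; rewrite /GRing.scale /=; ring.
  have ch' : continuous h'.
    move=> x; rewrite /h' /f /f'; apply: cvgD; apply: cvgMr; apply: cvgM; try exact: continuous_g1.
      apply: continuous_comp; last exact: continuous_cos.
      by apply: cvgD; [apply: cvgMl; apply: cvgB; [exact: cvg_id|exact: cvg_cst]|exact: cvg_cst].
    apply: cvgM; first by apply: cvgN; apply: cvgB; [exact: cvg_id|exact: cvg_cst].
    apply: continuous_comp; last exact: continuous_sin.
    by apply: cvgD; [apply: cvgMl; apply: cvgB; [exact: cvg_id|exact: cvg_cst]|exact: cvg_cst].
  have ih1 : leb.-integrable setT (EFin \o (fun x => w * f w x)).
    by apply: eq_integrable (integrableZl measurableT w (if_ w)).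
  have ih2 : leb.-integrable setT (EFin \o (fun x => 2 * r * f' w x)).
    by apply: eq_integrable (integrableZl measurableT (2 * r) (if'_ w)).
  have ih' : leb.-integrable setT (EFin \o h').
    by apply: eq_integrable (integrableD measurableT ih1 ih2).
  have hb x : `|h x| <= 1 * g1 r a x.
    rewrite /h mul1r normrM (ger0_norm (g1_ge0 _ _ _)) ler_piMl ?g1_ge0//.
    by rewrite ler_norml sin_geN1 sin_le1.
  have h0 : (\int[leb]_x (h' x)%:E = 0)%E.
    apply: (integral_derive0 dh) => //.
    - apply: (cvg_g1_nat (f := h) (u := fun n => n%:R) r0 ler01 _ hb) => n.
      by rewrite -{1}(normr_nat R n) lerB_dist.
    - apply: (cvg_g1_nat (f := h) (u := fun n => - n%:R) r0 ler01 _ hb) => n.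
      by rewrite -{1}(normr_nat R n) -normrN lerB_dist.
  have : F' w * (2 * r) + F w * w = 0.
    rewrite /F /F' -!RintegralZr// -RintegralD//; last 2 first.
    - by apply: eq_integrable ih2 => // x _ /=; rewrite mulrC.
    - by apply: eq_integrable ih1 => // x _ /=; rewrite mulrC.
    rewrite /Rintegral -[RHS]/(fine 0%E) -h0; congr fine; apply: eq_integral => x _.
    by congr EFin; rewrite /h'; ring.
  move=> e; apply: (@mulIf _ (2 * r)); first by rewrite mulf_neq0 ?gt_eqF.
  rewrite (_ : F' w * _ = - (F w * w)); last by apply/eqP; rewrite -addr_eq0; apply/eqP.
  by field; exact: lt0r_neq0.
pose K w := F w * expR (w ^+ 2 / (4 * r)).
have dK w : is_derive (w : R) (1 : R) K 0.
  have dFw := dF w.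
  by rewrite /K; apply: is_derive_eq; rewrite /GRing.scale /= ibp; field; exact: lt0r_neq0.
have KE : K v = K 0 by exact: is_derive_0_is_cst.
have F0 : F 0 = cos th * Num.sqrt (pi / r).
  rewrite /F /Rintegral (_ : (fun x => _) = (fun x => (cos th)%:E * (g1 r a x)%:E)%E).
    by rewrite integralZl//; [rewrite integral_g1|exact: integrable_g1].
  by apply/funext => x; rewrite /f mulr0 add0r EFinM.
have FE : F v = cos th * Num.sqrt (pi / r) * expR (- (v ^+ 2 / (4 * r))).
  rewrite -F0 expRN; apply: (@mulIf _ (expR (v ^+ 2 / (4 * r)))); first by rewrite gt_eqF // expR_gt0.
  by rewrite -/(K v) KE /K expr0n /= mul0r expR0 mulr1 divfK// gt_eqF ?expR_gt0.
rewrite -FE /F /Rintegral fineK//; exact: (integrable_fin_num measurableT (if_ v)).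
Qed.

End Gauss1FT.

(** * Measurability and Gaussian integrals in several variables *)

Section Caratheodory.
Variable R : realType.

Lemma cvg_floor_div (x : R) : (Num.floor (x * n.+1%:R))%:~R / n.+1%:R @[n --> \oo] --> x.
Proof.
apply/cvgrPdist_le => e e0; near=> n.
have n0 : 0 < n.+1%:R :> R by [].
set k := Num.floor _.
have k1 : k%:~R <= x * n.+1%:R by exact: floor_le_tmp.
have k2 : x * n.+1%:R < k%:~R + 1.
  by rewrite -[1]/(1%:~R) -intrD; exact: floorD1_gt.
have -> : x - k%:~R / n.+1%:R = (x * n.+1%:R - k%:~R) / n.+1%:R.
  by field; exact: lt0r_neq0.
rewrite ger0_norm; last by rewrite divr_ge0 ?subr_ge0// ltW.
apply: (@le_trans _ _ (n.+1%:R^-1)).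
  by rewrite ler_pdivrMr// mulVf ?gt_eqF//; lra.
apply: ltW; near: n; exact: (@near_infty_natSinv_lt R (PosNum e0)).
Unshelve. all: by end_near. Qed.

(** Rounding x down to a multiple of 1/(n+1) gives a function that, on each of countably many
    strips, depends on y only. By continuity in x these functions converge pointwise to f. *)
Lemma measurable_caratheodory d (T : measurableType d) (f : R -> T -> R) :
  (forall y, continuous (f^~ y)) -> (forall x, measurable_fun setT (f x)) ->
  measurable_fun setT (fun z : measurableTypeR R * T => f z.1 z.2).
Proof.
move=> cf mf.
pose q n (x : R) : R := (Num.floor (x * n.+1%:R))%:~R / n.+1%:R.
apply: (@measurable_fun_cvg _ _ _ _ (fun n z => f (q n z.1) z.2)); last first.
  move=> [x y] _ /=.
  exact: (cvg_comp (fun n => q n x) (f^~ y) (@cvg_floor_div x) (cf y x)).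
move=> n _ B mB; rewrite setTI.
rewrite (_ : _ @^-1` B = \bigcup_(k in [set: int])
  ([set x : measurableTypeR R | Num.floor (x * n.+1%:R) = k] `*` (f (k%:~R / n.+1%:R) @^-1` B))); last first.
  apply/seteqP; split => [[x y] /= h|[x y] /= [k _ [/= xk]]].
    by exists (Num.floor (x * n.+1%:R)).
  by rewrite /q xk.
apply: countable_bigcupT_measurable => // k.
apply: measurableX; last by rewrite -[X in measurable X]setTI; exact: mf.
rewrite (_ : [set _ | _] = `[k%:~R / n.+1%:R, (k + 1)%:~R / n.+1%:R[%classic); last first.
  apply/seteqP; split => x /=; rewrite in_itv /= ler_pdivrMr// ltr_pdivlMr//.
    by move=> <-; rewrite floor_le_tmp floorD1_gt.
  by move=> h; exact/floor_def.
exact: measurable_itv.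
Qed.

End Caratheodory.

Section SeqIntegrals.
Variable R : realType.
Local Notation leb := (@lebesgue_measure R).

(* Separate continuity is the regularity that directional derivatives provide, and
   by Caratheodory it suffices for joint measurability. *)
Fixpoint sepcont (n : nat) (g : seq R -> R) : Prop :=
  if n is n'.+1 then
    (forall s, size s = n' -> continuous (fun x : R => g (x :: s))) /\
    (forall x, sepcont n' (fun s => g (x :: s)))
  else True.

Lemma sepcont_measurable n (g : seq R -> R) : sepcont n g ->
  measurable_fun setT (fun z : E R n => g (coords z)).
Proof.
elim: n g => [g _|n IH g [cg sg]]; first by [].
apply: (@measurable_caratheodory R _ (E R n) (fun x y => g (x :: coords y))).
  by move=> y; apply: cg; exact: size_coords.
by move=> x; exact: IH (sg x).
Qed.

Fixpoint prodS (f : nat -> R -> R) (s : seq R) : R :=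
  if s is x :: s' then f 0 x * prodS (fun i => f i.+1) s' else 1.

(** The centre is a sequence indexed by nat, so that removing the first coordinate is a mere
    shift. *)
Definition gw (r : R) (a : nat -> R) : seq R -> R := prodS (fun i => g1 r (a i)).

Lemma gw_cons r a x s : gw r a (x :: s) = g1 r (a 0) x * gw r (fun i => a i.+1) s.
Proof. by []. Qed.

Lemma gw_ge0 r a s : 0 <= gw r a s.
Proof. by elim: s a => [|x s IH] a //; rewrite gw_cons mulr_ge0 ?g1_ge0 ?IH. Qed.

(** The factor [k] is there for the induction: at each step it takes up the factor of the outermost
    variable. *)
Lemma iint_prodS n (f : nat -> R -> R) (c : nat -> R) (k : R) : 0 <= k ->
  (forall i x, 0 <= f i x) -> (forall i, 0 <= c i) ->
  (forall i, measurable_fun setT (f i)) ->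
  (forall i, \int[leb]_x (f i x)%:E = (c i)%:E)%E ->
  iint n (fun s => (k * prodS f s)%:E) = (k * \prod_(i < n) c i)%:E.
Proof.
elim: n f c k => [f c k k0 f0 c0 mf fc|n IH f c k k0 f0 c0 mf fc] /=; first by rewrite big_ord0.
under eq_integral => x _.
  under eq_fun do rewrite mulrA.
  rewrite (IH (fun i => f i.+1) (fun i => c i.+1)) ?mulr_ge0//.
  rewrite (mulrC k) -mulrA EFinM.
  over.
rewrite ge0_integralZr//=; last 3 first.
- by apply/measurable_EFinP; exact: mf.
- by move=> x _; rewrite lee_fin.
- by rewrite lee_fin mulr_ge0// prodr_ge0.
by rewrite fc -EFinM big_ord_recl mulrCA.
Qed.

Lemma sepcont_gw n r k a : sepcont n (fun s => k * gw r a s).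
Proof.
elim: n k a => //= n IH k a; split.
  by move=> s _ x; apply: cvgMr; rewrite /gw /=; apply: cvgMl; exact: continuous_g1.
move=> x; have := IH (k * g1 r (a 0) x) (fun i => a i.+1).
by congr (sepcont n _); apply/funext => s; rewrite -mulrA -gw_cons.
Qed.

Lemma measurable_gw n r a : measurable_fun setT (fun z : E R n => gw r a (coords z)).
Proof.
apply: sepcont_measurable; have := sepcont_gw n r 1 a.
by congr (sepcont n _); apply/funext => s; rewrite mul1r.
Qed.

Lemma iint_gw n r a k : 0 < r -> 0 <= k ->
  iint n (fun s => (k * gw r a s)%:E) = (k * Num.sqrt (pi / r) ^+ n)%:E.
Proof.
move=> r0 k0; rewrite (iint_prodS n (c := fun=> Num.sqrt (pi / r)))//.
- by rewrite prodr_const card_ord.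
- by move=> i x; exact: g1_ge0.
- by move=> i; exact: measurable_g1.
- by move=> i; exact: integral_g1.
Qed.

Definition gdomS n (g : seq R -> R) :=
  measurable_fun setT (fun z : E R n => g (coords z)) /\
  exists r a A, [/\ 0 < r, 0 <= A & forall s, size s = n -> `|g s| <= A * gw r a s].

Lemma gdomS_integrable n g : gdomS n g ->
  (mu R n).-integrable setT (fun z => (g (coords z))%:E).
Proof.
move=> [mg [r [a [A [r0 A0 gA]]]]]; apply/integrableP; split; first exact/measurable_EFinP.
apply: (@le_lt_trans _ _ (\int[mu R n]_z (A * gw r a (coords z))%:E)%E).
  apply: ge0_le_integral_nomeas => // z _ /=.
  by rewrite lee_fin gA ?size_coords.
rewrite -(iint_tonelli (g := fun s => (A * gw r a s)%:E)).
- by rewrite iint_gw// ltry.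
- by move=> s; rewrite lee_fin mulr_ge0// gw_ge0.
- apply/measurable_EFinP; apply: measurable_funM => //; exact: measurable_gw.
Qed.

Lemma gdomS_cons n g x : gdomS n.+1 g -> gdomS n (fun s => g (x :: s)).
Proof.
move=> [mg [r [a [A [r0 A0 gA]]]]]; split.
  exact: (measurable_fun_pair2 (T1 := measurableTypeR R) (T2 := E R n)
    (f := fun z : measurableTypeR R * E R n => g (@coords R n.+1 z)) x mg).
exists r, (fun i => a i.+1), (A * g1 r (a 0) x); split => //.
  by rewrite mulr_ge0// g1_ge0.
by move=> s sn; rewrite -mulrA; apply: gA; rewrite /= sn.
Qed.

Lemma iint_gdomS n g : gdomS n g ->
  iint n (fun s => (g s)%:E) = (\int[mu R n]_z (g (coords z))%:E)%E.
Proof.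
elim: n g => [g [mg _]|n IH g dg] /=.
  have mc : measurable_fun [set: unit] (fun=> (g [::])%:E) by exact: measurable_cst.
  have := integral_dirac tt measurableT mc.
  by rewrite diracT mul1e => e; exact: (esym e).
have := gdomS_integrable dg => ig.
rewrite -(integral12_prod_meas1 (m1 := leb) (m2 := mu R n) (f := fun z => (g (@coords R n.+1 z))%:E) ig).
by apply: eq_integral => x _; rewrite IH//; exact: gdomS_cons.
Qed.

End SeqIntegrals.

Section SeqFourier.
Variable R : realType.
Local Notation leb := (@lebesgue_measure R).

Fixpoint dotS (a v : nat -> R) (s : seq R) : R :=
  if s is x :: s' then
    (x - a 0) * v 0 + dotS (fun i => a i.+1) (fun i => v i.+1) s'
  else 0.

(** The phase [th] is arbitrary so that in the induction it can take up the contribution of the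
    outermost variable. Sines never appear: they are cosines with phase -pi/2. *)
Lemma iint_gw_cos n (r : R) (a v : nat -> R) (k th : R) : 0 < r ->
  iint n (fun s => (k * cos (dotS a v s + th) * gw r a s)%:E) =
  (k * cos th * \prod_(i < n) (Num.sqrt (pi / r) * expR (- (v i ^+ 2 / (4 * r)))))%:E.
Proof.
move=> r0; elim: n a v k th => [a v k th|n IH a v k th] /=.
  by rewrite big_ord0 add0r.
under eq_integral => x _.
  have -> : (fun s => (k * cos ((x - a 0) * v 0 + dotS (fun i => a i.+1) (fun i => v i.+1) s + th) *
      gw r a (x :: s))%:E) =
    (fun s => (k * g1 r (a 0) x * cos (dotS (fun i => a i.+1) (fun i => v i.+1) s + ((x - a 0) * v 0 + th)) *
      gw r (fun i => a i.+1) s)%:E).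
    apply/funext => s; rewrite gw_cons; congr EFin.
    rewrite (_ : dotS _ _ s + (_ + th) = (x - a 0) * v 0 + dotS (fun i => a i.+1) (fun i => v i.+1) s + th); last by ring.
    by ring.
  rewrite IH.
  set P := \prod_(i < n) _.
  rewrite (_ : k * _ * _ * P = (k * P) * (cos ((x - a 0) * v 0 + th) * g1 r (a 0) x)); last by ring.
  rewrite EFinM.
  over.
set P := \prod_(i < n) _.
have ig : leb.-integrable setT (EFin \o (fun x => cos ((x - a 0) * v 0 + th) * g1 r (a 0) x)).
  apply: (@integrable_g1M R r (a 0) _ 1) => //.
    apply: measurable_funM; last exact: measurable_g1.
    apply: continuous_measurable_fun => x; apply: continuous_comp; last exact: continuous_cos.
    by apply: cvgD; [apply: cvgMl; apply: cvgB; [exact: cvg_id|exact: cvg_cst]|exact: cvg_cst].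
  move=> x; rewrite normrM (ger0_norm (g1_ge0 _ _ _)) ler_wpM2r ?g1_ge0//.
  by rewrite ler_norml cos_geN1 cos_le1.
rewrite integralZl// integral_g1_cos// -EFinM big_ord_recl /= -/P.
by congr EFin; rewrite /bump /=; ring.
Qed.

Lemma dotSE a v s : dotS a v s = \sum_(i < size s) (s`_i - a i) * v i.
Proof.
by elim: s a v => [|x s IH] a v /=; [rewrite big_ord0|rewrite big_ord_recl IH].
Qed.

Lemma prodSE f (s : seq R) : prodS f s = \prod_(i < size s) f i s`_i.
Proof.
by elim: s f => [|x s IH] f /=; [rewrite big_ord0|rewrite big_ord_recl IH].
Qed.

Lemma gwE r a (s : seq R) : gw r a s = expR (- (r * \sum_(i < size s) (s`_i - a i) ^+ 2)).
Proof.
rewrite /gw prodSE /g1 mulr_sumr -sumrN expR_sum //.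
Qed.

(** By Fubini's theorem the i-th variable may be integrated innermost, where the one-dimensional
    statement applies. For i = 0 the order of integration is exchanged; otherwise the first variable
    is frozen and the induction runs on the tail. *)
Lemma ibp_seq n (i : nat) (h h' : seq R -> R) r a A : (i < n)%N ->
  0 < r -> 0 <= A ->
  (forall s, size s = n -> forall t : R,
    is_derive t (1 : R) (fun t => h (set_nth 0 s i t)) (h' (set_nth 0 s i t))) ->
  (forall s, size s = n -> continuous (fun t : R => h' (set_nth 0 s i t))) ->
  (forall s, size s = n -> `|h s| <= A * gw r a s) ->
  gdomS n h' ->
  (\int[mu R n]_z (h' (coords z))%:E = 0)%E.
Proof.
elim: n i h h' a A => [//|n IH [|i] h h' a A].
  move=> _ r0 A0 dh ch hA dom; have ih := gdomS_integrable dom.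
  rewrite -(integral21_prod_meas1 (m1 := leb) (m2 := mu R n) (f := fun z => (h' (@coords R n.+1 z))%:E) ih).
  apply: integral0_eq => y _; rewrite /fubini_G /=.
  have sy := size_coords y.
  apply: (@integral_derive0 R (fun x => h (x :: coords y))).
  - by move=> x; have := dh (0 :: coords y); rewrite /= sy => /(_ erefl).
  - by have := ch (0 :: coords y); rewrite /= sy => /(_ erefl).
  - have [mh' [r' [a' [A' [r'0 A'0 h'A]]]]] := dom.
    apply: (@integrable_g1M R r' (a' 0) _ (A' * gw r' (fun i => a' i.+1) (coords y))) => //.
      exact: (measurable_fun_pair1 (T1 := measurableTypeR R) (T2 := E R n)
        (f := fun z : measurableTypeR R * E R n => h' (@coords R n.+1 z)) y mh').
    move=> x; apply: le_trans (h'A _ _) _; first by rewrite /= sy.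
    by rewrite gw_cons mulrCA mulrC.
  - have hb x : `|h (x :: coords y)| <= A * gw r (fun i => a i.+1) (coords y) * g1 r (a 0) x.
      apply: le_trans (hA _ _) _; first by rewrite /= sy.
      by rewrite gw_cons mulrCA mulrC.
    apply: (cvg_g1_nat (u := fun n => n%:R) r0 _ _ hb); first by rewrite mulr_ge0// gw_ge0.
    by move=> m; rewrite -{1}(normr_nat R m) lerB_dist.
  - have hb x : `|h (x :: coords y)| <= A * gw r (fun i => a i.+1) (coords y) * g1 r (a 0) x.
      apply: le_trans (hA _ _) _; first by rewrite /= sy.
      by rewrite gw_cons mulrCA mulrC.
    apply: (cvg_g1_nat (u := fun n => - n%:R) r0 _ _ hb); first by rewrite mulr_ge0// gw_ge0.
    by move=> m; rewrite -{1}(normr_nat R m) -normrN lerB_dist.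
rewrite ltnS => ilt r0 A0 dh ch hA dom; have ih := gdomS_integrable dom.
rewrite -(integral12_prod_meas1 (m1 := leb) (m2 := mu R n) (f := fun z => (h' (@coords R n.+1 z))%:E) ih).
apply: integral0_eq => x _; rewrite /fubini_F /=.
apply: (IH i (fun s => h (x :: s)) (fun s => h' (x :: s)) (fun i => a i.+1) (A * g1 r (a 0) x)) => //.
- by rewrite mulr_ge0 ?g1_ge0.
- by move=> s ss t; have := dh (x :: s); rewrite /= ss => /(_ erefl).
- by move=> s ss; have := ch (x :: s); rewrite /= ss => /(_ erefl).
- by move=> s ss; rewrite -mulrA -gw_cons; apply: hA; rewrite /= ss.
- exact: gdomS_cons.
Qed.

End SeqFourier.

(** * Integration of functions of vectors *)

Section Vec.
Variables (R : realType) (d : nat).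
Local Notation vec := (Defs.vec R d).
Implicit Types (x y a v : vec) (f : vec -> R).

Definition vcoord (z : E R d) : vec := seq_to_vec d (coords z).

Definition integralv f : R := (\int[mu R d]_z f (vcoord z))%R.

Definition vmeas f := measurable_fun setT (fun z : E R d => f (vcoord z)).

Definition gs (r : R) (a x : vec) : R := expR (- (r * dotv (x - a) (x - a))).

(** Coordinates continued by 0 to all of nat, the format in which Gaussians on lists take their
    centres. *)
Definition ext (a : vec) (i : nat) : R := oapp (a ord0) 0 (insub i).

Lemma extE a (i : 'I_d) : ext a i = a ord0 i.
Proof. by rewrite /ext valK. Qed.

Lemma gs_ge0 r a x : 0 <= gs r a x. Proof. exact: expR_ge0. Qed.
Lemma gs_gt0 r a x : 0 < gs r a x. Proof. exact: expR_gt0. Qed.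

Lemma dotvv_ge0 x : 0 <= dotv x x.
Proof. by apply: sumr_ge0 => i _; rewrite -expr2 sqr_ge0. Qed.

Lemma gs_le1 r a x : 0 <= r -> gs r a x <= 1.
Proof. by move=> r0; rewrite -expR0 ler_expR oppr_le0 mulr_ge0// dotvv_ge0. Qed.

Lemma gsE r a s : size s = d -> gs r a (seq_to_vec d s) = gw r (ext a) s.
Proof.
move=> sd; rewrite gwE /gs sd; congr (expR (- (r * _))).
by apply: eq_bigr => i _; rewrite !mxE extE expr2.
Qed.

Lemma gs_prod r a x : gs r a x = \prod_(i < d) expR (- (r * (x ord0 i - a ord0 i) ^+ 2)).
Proof.
rewrite /gs /dotv mulr_sumr -sumrN expR_sum; apply: eq_bigr => i _.
by rewrite !mxE expr2.
Qed.

(* Measurable functions dominated by a Gaussian: a class on which every integral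
   identity below holds without side conditions. *)
Definition gdom f := vmeas f /\
  exists r a A, [/\ 0 < r, 0 <= A & forall x, `|f x| <= A * gs r a x].

Lemma gdom_gdomS f : gdom f -> gdomS d (fun s => f (seq_to_vec d s)).
Proof.
move=> [mf [r [a [A [r0 A0 fA]]]]]; split; first exact: mf.
by exists r, (ext a), A; split => // s sd; rewrite -gsE.
Qed.

Lemma gdom_integrable f : gdom f -> (mu R d).-integrable setT (fun z => (f (vcoord z))%:E).
Proof. by move=> /gdom_gdomS/gdomS_integrable. Qed.

Lemma intRd_gdom f : gdom f -> intRd (fun x => (f x)%:E) = (integralv f)%:E.
Proof.
move=> df; rewrite /intRd (iint_gdomS (gdom_gdomS df)) /integralv /Rintegral fineK//.
exact: (integrable_fin_num measurableT (gdom_integrable df)).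
Qed.

Lemma vmeas_sep f : (forall x (i : 'I_d), continuous (fun t : R => f (x + t *: dir R i))) ->
  vmeas f.
Proof.
move=> cf; apply: (sepcont_measurable (g := fun s => f (seq_to_vec d s))).
(* The prefix [p] collects the coordinates that are already fixed; moving the next one is a motion
   along a coordinate direction. *)
suff gen n p : (size p + n)%N = d -> sepcont n (fun s => f (seq_to_vec d (p ++ s))).
  exact: (gen d [::]).
elim: n p => //= n IH p pd; split.
  move=> s sn.
  have pl : (size p < d)%N by rewrite -pd addnS ltnS leq_addr.
  have e : (fun x : R => f (seq_to_vec d (p ++ x :: s))) =
     (fun t : R => f (seq_to_vec d (p ++ 0 :: s) + t *: dir R (Ordinal pl))).
    apply/funext => t; congr f; apply/rowP => j; rewrite !mxE !nth_cat -val_eqE /=.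
    case: ltngtP => jp; rewrite ?mulr0 ?addr0//.
      have [k ->] : exists k, (j = size p + k.+1 :> nat)%N.
        by exists (j - size p).-1; rewrite prednK ?subn_gt0// subnKC// ltnW.
      by rewrite -addnBAC// subnn.
    by rewrite jp subnn /= mulr1 add0r.
  by rewrite e; exact: cf.
move=> x; have := IH (rcons p x); rewrite size_rcons addSnnS => /(_ pd).
by under eq_fun do rewrite cat_rcons.
Qed.

Lemma vmeas_coord i : vmeas (fun x => x ord0 i).
Proof.
apply: vmeas_sep => x j.
have -> : (fun t : R => (x + t *: dir R j) ord0 i) = (fun t : R => x ord0 i + t * dir R j ord0 i).
  by apply/funext => u; rewrite !mxE.
by move=> t; apply: cvgD; [exact: cvg_cst|apply: cvgMl; exact: cvg_id].
Qed.

Lemma vmeas_cst k : vmeas (fun=> k).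
Proof. exact: measurable_cst. Qed.

Lemma vmeasD f g : vmeas f -> vmeas g -> vmeas (fun x => f x + g x).
Proof. by move=> mf mg; exact: measurable_funD. Qed.

Lemma vmeasM f g : vmeas f -> vmeas g -> vmeas (fun x => f x * g x).
Proof. by move=> mf mg; exact: measurable_funM. Qed.

Lemma vmeas_comp (h : R -> R) f : measurable_fun setT h -> vmeas f -> vmeas (fun x => h (f x)).
Proof. by move=> mh mf; exact: (measurableT_comp mh mf). Qed.

Lemma vmeas_sum (I : Type) (s : seq I) (F : I -> vec -> R) :
  (forall i, vmeas (F i)) -> vmeas (fun x => \sum_(i <- s) F i x).
Proof. by move=> mF; apply: measurable_sum. Qed.

Lemma vmeas_dot (a v : vec) : vmeas (fun x => dotv (x - a) v).
Proof.
apply: vmeas_sum => i; apply: vmeasM; last exact: vmeas_cst.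
have -> : (fun x => (x - a) ord0 i) = (fun x => x ord0 i + (- a ord0 i)).
  by apply/funext => x; rewrite !mxE.
by apply: vmeasD; [exact: vmeas_coord|exact: vmeas_cst].
Qed.

Lemma vmeas_sqdist (a : vec) : vmeas (fun x => dotv (x - a) (x - a)).
Proof.
have m i : vmeas (fun x => (x - a) ord0 i).
  have -> : (fun x => (x - a) ord0 i) = (fun x => x ord0 i + (- a ord0 i)).
    by apply/funext => x; rewrite !mxE.
  by apply: vmeasD; [exact: vmeas_coord|exact: vmeas_cst].
by apply: vmeas_sum => i; apply: vmeasM.
Qed.

Lemma vmeas_gs r a : vmeas (gs r a).
Proof.
apply: (@vmeas_comp (fun t => expR (- (r * t)))); last exact: vmeas_sqdist.
apply: measurableT_comp; first exact: measurable_expR.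
by apply: measurable_funN; apply: measurable_funM.
Qed.

Lemma gdom_gs r a : 0 < r -> gdom (gs r a).
Proof.
move=> r0; split; first exact: vmeas_gs.
by exists r, a, 1; split => // x; rewrite mul1r ger0_norm ?gs_ge0.
Qed.

Lemma gdom_le f r a A : vmeas f -> 0 < r -> (forall x, `|f x| <= A * gs r a x) -> gdom f.
Proof.
move=> mf r0 fA; split => //; exists r, a, `|A|; split => // x.
by apply: le_trans (fA x) _; rewrite ler_wpM2r ?gs_ge0// ler_norm.
Qed.

Lemma gdomM f g (B : R) : gdom f -> vmeas g -> (forall x, `|g x| <= B) -> gdom (fun x => f x * g x).
Proof.
move=> [mf [r [a [A [r0 A0 fA]]]]] mg gB.
apply: (@gdom_le _ r a (A * `|B|)) => //; first exact: vmeasM.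
move=> x; rewrite normrM mulrAC ler_pM//.
by apply: le_trans (gB x) (ler_norm _).
Qed.

Lemma gdomZ k f : gdom f -> gdom (fun x => k * f x).
Proof.
move=> [mf [r [a [A [r0 A0 fA]]]]].
apply: (@gdom_le _ r a (`|k| * A)) => //; first by apply: vmeasM => //; exact: vmeas_cst.
by move=> x; rewrite normrM -mulrA ler_wpM2l.
Qed.

Lemma integralv_eq f g : f =1 g -> integralv f = integralv g.
Proof. by move=> /funext ->. Qed.

Lemma integralvZ k f : gdom f -> integralv (fun x => k * f x) = k * integralv f.
Proof. by move=> /gdom_integrable df; rewrite /integralv RintegralZl. Qed.

Lemma integralvD_int f g :
  (mu R d).-integrable setT (fun z => (f (vcoord z))%:E) ->
  (mu R d).-integrable setT (fun z => (g (vcoord z))%:E) ->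
  integralv (fun x => f x + g x) = integralv f + integralv g.
Proof. by move=> df dg; rewrite /integralv RintegralD. Qed.

Lemma integralvD f g : gdom f -> gdom g -> integralv (fun x => f x + g x) = integralv f + integralv g.
Proof. by move=> /gdom_integrable df /gdom_integrable dg; exact: integralvD_int. Qed.

Lemma integralvB f g : gdom f -> gdom g -> integralv (fun x => f x - g x) = integralv f - integralv g.
Proof.
by move=> /gdom_integrable df /gdom_integrable dg; rewrite /integralv RintegralB.
Qed.

(** Integrability is carried along in the induction, because closure of [gdom] under addition
    requires moving Gaussians to a common centre, which is only established with the geometric
    estimates. *)
Lemma integralv_sum (I : Type) (s : seq I) (F : I -> vec -> R) : (forall i, gdom (F i)) ->
  integralv (fun x => \sum_(i <- s) F i x) = \sum_(i <- s) integralv (F i) /\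
  (mu R d).-integrable setT (fun z => (\sum_(i <- s) F i (vcoord z))%:E).
Proof.
move=> dF; elim: s => [|i s [IH1 IH2]].
  split; first by rewrite big_nil /integralv; under eq_Rintegral do rewrite big_nil; rewrite Rintegral_cst// mul0r.
  by under eq_fun do rewrite big_nil; exact: integrable0.
split; last first.
  under eq_fun do rewrite big_cons EFinD.
  by apply: integrableD => //; exact: gdom_integrable.
rewrite big_cons -IH1 -integralvD_int//; last exact: gdom_integrable.
by apply: integralv_eq => x; rewrite big_cons.
Qed.

Lemma integralv_le f g : gdom f -> gdom g -> (forall x, f x <= g x) -> integralv f <= integralv g.
Proof.
move=> /gdom_integrable df /gdom_integrable dg fg; apply: le_Rintegral => //.
Qed.

Lemma integralv_ge0 f : (forall x, 0 <= f x) -> 0 <= integralv f.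
Proof. by move=> f0; apply: Rintegral_ge0. Qed.

Lemma normr_integralv f : gdom f -> `|integralv f| <= integralv (fun x => `|f x|).
Proof. by move=> /gdom_integrable df; apply: le_normr_Rintegral. Qed.

Lemma gdom_norm f : gdom f -> gdom (fun x => `|f x|).
Proof.
move=> [mf [r [a [A [r0 A0 fA]]]]]; split.
  by apply: (vmeas_comp (h := fun t => `|t|)) mf; exact: normr_measurable.
by exists r, a, A; split => // x; rewrite normr_id.
Qed.

Lemma integralv_gs_cos r a v th : 0 < r ->
  integralv (fun x => cos (dotv (x - a) v + th) * gs r a x) =
  cos th * Num.sqrt (pi / r) ^+ d * expR (- (dotv v v / (4 * r))).
Proof.
move=> r0; apply: EFin_inj.
rewrite -intRd_gdom; last first.
  under eq_fun do rewrite mulrC.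
  apply: (@gdomM _ _ 1); first exact: gdom_gs.
    apply: (vmeas_comp (h := fun t => cos (t + th))); last exact: vmeas_dot.
    apply: measurableT_comp; first by apply: continuous_measurable_fun; exact: continuous_cos.
    by apply: measurable_funD.
  by move=> x; rewrite ler_norml cos_geN1 cos_le1.
have := iint_gw_cos d (ext a) (ext v) 1 th r0.
rewrite mul1r => e; rewrite /intRd; transitivity ((cos th *
      \prod_(i < d) (Num.sqrt (pi / r) * expR (- (ext v i ^+ 2 / (4 * r)))))%:E).
  rewrite -e; apply: iint_eq => s sd; rewrite gsE// mul1r; congr ((cos (_ + _) * _)%:E).
  by rewrite dotSE sd; apply: eq_bigr => i _; rewrite !mxE !extE.
rewrite big_split /= prodr_const card_ord -mulrA; congr ((_ * (_ * _))%:E).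
rewrite -expR_sum; congr expR; rewrite sumrN mulr_suml; congr (- _).
by apply: eq_bigr => i _; rewrite extE expr2.
Qed.

Lemma integralv_gs r a : 0 < r -> integralv (gs r a) = Num.sqrt (pi / r) ^+ d.
Proof.
move=> r0; have := integralv_gs_cos a 0 0 r0.
rewrite cos0 mul1r (_ : dotv 0 0 = 0); last by rewrite /dotv big1// => i _; rewrite mxE mul0r.
rewrite mul0r oppr0 expR0 mulr1 => <-; apply: integralv_eq => x.
rewrite (_ : dotv _ 0 = 0); first by rewrite addr0 cos0 mul1r.
by rewrite /dotv big1// => i _; rewrite [X in _ * X]mxE mulr0.
Qed.

End Vec.

Section VecCalculus.
Variables (R : realType) (d : nat).
Local Notation vec := (Defs.vec R d).
Implicit Types (x y a v : vec) (f : vec -> R).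

Lemma is_derive_shift (F : R -> R) (t D : R) :
  is_derive (0 : R) (1 : R) (fun u => F (t + u)) D -> is_derive t (1 : R) F D.
Proof.
move=> dF.
have {}dF : is_derive (t - t) (1 : R) (fun u => F (t + u)) D by rewrite subrr.
have dg : is_derive t (1 : R) (fun u : R => u - t) 1.
  by apply: is_derive_eq; rewrite subr0.
have -> : F = (fun u => F (t + u)) \o (fun u => u - t).
  by apply/funext => u /=; rewrite addrC subrK.
by have := @is_derive1_comp R (fun u => F (t + u)) (fun u => u - t) t D 1 dF dg; rewrite mulr1.
Qed.

Lemma seq_to_vec_upd (s : seq R) (i : 'I_d) (t u : R) : size s = d ->
  seq_to_vec d (set_nth 0 s i (t + u)) = seq_to_vec d (set_nth 0 s i t) + u *: dir R i.
Proof.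
move=> sd; apply/rowP => j; rewrite !mxE !nth_set_nth /=.
have -> : (j == i :> nat) = (i == j) by rewrite eq_sym.
by case: (i == j); rewrite ?mulr1 ?mulr0 ?addr0.
Qed.

Lemma integralv_ibp (i : 'I_d) f f' r a A : 0 < r -> 0 <= A ->
  (forall x, is_derive (0 : R) (1 : R) (fun t => f (x + t *: dir R i)) (f' x)) ->
  (forall x, continuous (fun t : R => f' (x + t *: dir R i))) ->
  (forall x, `|f x| <= A * gs r a x) -> gdom f' ->
  integralv f' = 0.
Proof.
move=> r0 A0 df cf fA dom.
rewrite /integralv /Rintegral.
suff e : (\int[mu R d]_z (f' (vcoord z))%:E = 0)%E by rewrite e.
apply: (@ibp_seq R d i (fun s => f (seq_to_vec d s)) (fun s => f' (seq_to_vec d s)) r (ext a) A) => //.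
- move=> s sd t; apply: is_derive_shift; have := df (seq_to_vec d (set_nth 0 s i t)).
  by under eq_fun do rewrite -seq_to_vec_upd//.
- move=> s sd; have := cf (seq_to_vec d (set_nth 0 s i 0)).
  by under eq_fun do rewrite -seq_to_vec_upd// add0r.
- by move=> s sd; rewrite -gsE//; exact: fA.
- exact: gdom_gdomS.
Qed.

Definition vmeas2 (K : vec -> vec -> R) :=
  measurable_fun setT (fun z : E R d * E R d => K (vcoord z.1) (vcoord z.2)).

Lemma vmeas2_l f : vmeas f -> vmeas2 (fun x _ => f x).
Proof. by move=> mf; exact: (measurableT_comp mf measurable_fst). Qed.

Lemma vmeas2_r f : vmeas f -> vmeas2 (fun _ y => f y).
Proof. by move=> mf; exact: (measurableT_comp mf measurable_snd). Qed.

Lemma vmeas2D K L : vmeas2 K -> vmeas2 L -> vmeas2 (fun x y => K x y + L x y).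
Proof. by move=> mf mg; exact: measurable_funD. Qed.

Lemma vmeas2M K L : vmeas2 K -> vmeas2 L -> vmeas2 (fun x y => K x y * L x y).
Proof. by move=> mf mg; exact: measurable_funM. Qed.

Lemma vmeas2_comp (h : R -> R) K : measurable_fun setT h -> vmeas2 K ->
  vmeas2 (fun x y => h (K x y)).
Proof. by move=> mh mf; exact: (measurableT_comp mh mf). Qed.

Lemma vmeas2_dot : vmeas2 (fun x y => dotv x y).
Proof.
apply: measurable_sum => i; apply: (@vmeas2M (fun x _ => x ord0 i) (fun _ y => y ord0 i)).
  by apply: (@vmeas2_l (fun x => x ord0 i)); exact: vmeas_coord.
by apply: (@vmeas2_r (fun x => x ord0 i)); exact: vmeas_coord.
Qed.

(** Tonelli's theorem yields the measurability of the integrals of the positive and the negative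
    part separately. *)
Lemma vmeas_integralv K : vmeas2 K -> vmeas (fun x => integralv (K x)).
Proof.
move=> mK; rewrite /vmeas /integralv /Rintegral.
apply: (measurableT_comp (@fine_measurable R setT measurableT)) => //.
have mK' : measurable_fun setT (fun z : E R d * E R d => (K (vcoord z.1) (vcoord z.2))%:E).
  exact/measurable_EFinP.
under eq_fun do rewrite integralE.
have tp := measurable_fun_fubini_tonelli_F (m2 := mu R d) _ (measurable_funepos mK').
have tn := measurable_fun_fubini_tonelli_F (m2 := mu R d) _ (measurable_funeneg mK').
apply: emeasurable_funB.
  have {}tp := tp (fun z => funepos_ge0 _ z).
  by congr (measurable_fun _ _): tp; apply/funext => x; apply: eq_integral => y _; rewrite !funeposE.
have {}tn := tn (fun z => funeneg_ge0 _ z).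
by congr (measurable_fun _ _): tn; apply/funext => x; apply: eq_integral => y _; rewrite !funenegE.
Qed.

Lemma integralv_fubini (K : vec -> vec -> R) r a r' b A : 0 < r -> 0 < r' ->
  vmeas2 K -> (forall x y, `|K x y| <= A * gs r a x * gs r' b y) ->
  integralv (fun x => integralv (K x)) = integralv (fun y => integralv (K^~ y)).
Proof.
move=> r0 r'0 mK KA; pose KK (z : E R d * E R d) := (K (vcoord z.1) (vcoord z.2))%:E.
have iK : ((mu R d : {measure set _ -> \bar R}) \x (mu R d : {measure set _ -> \bar R}))%E.-integrable setT KK.
  apply/integrable12ltyP; first exact/measurable_EFinP.
  apply: (@le_lt_trans _ _ (\int[mu R d]_x \int[mu R d]_y (`|A| * gs r a (vcoord x) * gs r' b (vcoord y))%:E)%E).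
    apply: ge0_le_integral_nomeas => [x _|x _]; first exact: integral_ge0.
    apply: ge0_le_integral_nomeas => [y _|y _]; first exact: abse_ge0.
    rewrite /= lee_fin; apply: le_trans (KA _ _) _.
    by rewrite !ler_wpM2r ?gs_ge0// ler_norm.
  under eq_integral => x _.
    under eq_integral do rewrite EFinM.
    rewrite integralZl//; last by apply: gdom_integrable; exact: gdom_gs.
    rewrite mulrC EFinM -muleA muleC.
    over.
  have fc : (\int[mu R d]_z (gs r' b (vcoord z))%:E)%E \is a fin_num.
    by apply: integrable_fin_num => //; apply: gdom_integrable; exact: gdom_gs.
  rewrite -(fineK fc) -EFinM integralZl//; last by apply: gdom_integrable; exact: gdom_gs.
  rewrite lte_mul_pinfty//.
  - by rewrite lee_fin mulr_ge0// fine_ge0// integral_ge0// => z _; rewrite lee_fin gs_ge0.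
  - have /integrable_fin_num := gdom_integrable (gdom_gs (d := d) a r0).
    by move=> /(_ measurableT); rewrite fin_numE => /andP[_]; rewrite ltey.
have mKx (x : E R d) : measurable_fun setT (fun y : E R d => K (vcoord x) (vcoord y)).
  exact: (measurable_fun_pair2 (f := fun z : E R d * E R d => K (vcoord z.1) (vcoord z.2)) x mK).
have mKy (y : E R d) : measurable_fun setT (fun x : E R d => K (vcoord x) (vcoord y)).
  exact: (measurable_fun_pair1 (f := fun z : E R d * E R d => K (vcoord z.1) (vcoord z.2)) y mK).
have secx (x : E R d) : gdom (K (vcoord x)).
  by apply: (@gdom_le _ _ _ r' b (A * gs r a (vcoord x))) => //; exact: mKx.
have secy (y : E R d) : gdom (K^~ (vcoord y)).
  apply: (@gdom_le _ _ _ r a (A * gs r' b (vcoord y))) => //; first exact: mKy.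
  by move=> x; rewrite mulrAC.
rewrite /integralv /Rintegral; congr fine.
transitivity (\int[mu R d]_x \int[mu R d]_y KK (x, y))%E.
  apply: eq_integral => x _; rewrite fineK//.
  by apply: integrable_fin_num => //; exact: gdom_integrable (secx x).
rewrite (Fubini iK); apply: eq_integral => y _; rewrite fineK//.
by apply: integrable_fin_num => //; exact: gdom_integrable (secy y).
Qed.

Lemma intRd_le (f g : vec -> \bar R) : (forall x, 0 <= f x)%E -> (forall x, f x <= g x)%E ->
  (intRd f <= intRd g)%E.
Proof. by move=> f0 fg; apply: iint_le. Qed.

End VecCalculus.

(** * Elementary estimates *)

Section Numeric.
Variable R : realType.

Section lattice.
Variable c : R.
Hypothesis c0 : 0 < c.

(* The unit increments of this bounded increasing function dominate [exp (- c |y|)],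
   so that lattice sums of the latter telescope. *)
Definition tele (y : R) : R := if 0 <= y then 1 - expR (- (c * y)) else expR (c * y) - 1.

Lemma tele_bound y : -1 <= tele y <= 1.
Proof.
rewrite /tele; case: ifPn => [y0|]; last rewrite -ltNge => y0.
  have : expR (- (c * y)) <= 1 by rewrite -expR0 ler_expR oppr_le0 mulr_ge0// ltW.
  by have := expR_gt0 (- (c * y)); lra.
have : expR (c * y) <= 1 by rewrite -expR0 ler_expR pmulr_rle0// ltW.
by have := expR_gt0 (c * y); lra.
Qed.

Lemma tele_incr y : (1 - expR (- c)) * expR (- (c * `|y|)) <= tele (y + 1) - tele y.
Proof.
rewrite /tele; case: (leP 0 y) => y0.
  have -> : 0 <= y + 1 by lra.
  rewrite ger0_norm// mulrDr mulr1 opprD expRD; lra.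
rewrite ltr0_norm// mulrN opprK; case: (leP 0 (y + 1)) => y1.
  have -> : - (c * (y + 1)) = - (c * y) + - c by ring.
  have p1 : expR (c * y) <= 1 by rewrite -expR0 ler_expR pmulr_rle0// ltW.
  have p2 : expR (- c) <= expR (c * y) by rewrite ler_expR; have := mulr_ge0 (ltW c0) y1; rewrite mulrDr mulr1; lra.
  have q1 : expR (- c) < 1 by rewrite -expR0 ltr_expR oppr_lt0.
  rewrite expRD [expR (- (c * y))]expRN; set p := expR (c * y) in p1 p2 *; set q := expR (- c) in p2 q1 *.
  have p0 : 0 < p by exact: expR_gt0.
  have q0 : 0 < q by exact: expR_gt0.
  rewrite -subr_ge0.
  (* This is the increment that straddles 0, where q <= p <= 1. The difference of the two sides is
     exactly the sum of this quantity and (1 - p)(1 - q). *)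
  have : 0 <= (1 - p) * (p - q) / p by apply: divr_ge0; [apply: mulr_ge0|]; lra.
  have -> : (1 - p) * (p - q) / p = 1 + q - p - p^-1 * q by field; exact: lt0r_neq0.
  have : 0 <= (1 - p) * (1 - q) by apply: mulr_ge0; lra.
  move: (p^-1 * q) => z h1 h2.
  by lra.
have -> : c * (y + 1) = c * y + c by ring.
rewrite expRD; set p := expR (c * y).
have p0 : 0 < p by exact: expR_gt0.
have e1 : 1 - expR (- c) <= expR c - 1.
  rewrite -subr_ge0.
  have -> : expR c - 1 - (1 - expR (- c)) = (expR c - 1) ^+ 2 / expR c.
    by rewrite expRN; field; rewrite gt_eqF ?expR_gt0.
  by rewrite divr_ge0 ?sqr_ge0// expR_ge0.
by nra.
Qed.

(** The telescoping sum is at most 2 / (1 - e^(-c)), as [tele] takes values in [-1, 1]; the factor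
    e^(c/4) is the price of y^2 >= |y| - 1/4. *)
Definition lattice_const : R := expR (c / 4) * (2 / (1 - expR (- c))).

Lemma lattice_const_gt0 : 0 < lattice_const.
Proof.
by rewrite mulr_gt0 ?expR_gt0// divr_gt0// subr_gt0 -expR0 ltr_expR oppr_lt0.
Qed.

Lemma sum_gauss_le n (x : R) : \sum_(a < n) expR (- (c * (x - a%:R) ^+ 2)) <= lattice_const.
Proof.
have q1 : 0 < 1 - expR (- c) by rewrite subr_gt0 -expR0 ltr_expR oppr_lt0.
have tel m : (1 - expR (- c)) * \sum_(a < m) expR (- (c * `|x - a%:R|)) <= tele (x + 1) - tele (x + 1 - m%:R).
  elim: m => [|m IH]; first by rewrite big_ord0 mulr0 subr0 subrr.
  rewrite big_ord_recr /= mulrDr.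
  have := tele_incr (x - m%:R).
  rewrite (_ : x - m%:R + 1 = x + 1 - m%:R); last by ring.
  rewrite (_ : x + 1 - m.+1%:R = x - m%:R); last by rewrite -natr1; ring.
  lra.
have : \sum_(a < n) expR (- (c * `|x - a%:R|)) <= 2 / (1 - expR (- c)).
  rewrite ler_pdivlMr// mulrC; apply: le_trans (tel n) _.
  have := tele_bound (x + 1); have := tele_bound (x + 1 - n%:R); lra.
move=> h; rewrite /lattice_const; apply: le_trans (ler_wpM2l (expR_ge0 _) h).
rewrite mulr_sumr; apply: ler_sum => a _; rewrite -expRD ler_expR.
set y := x - _; have y2 : y ^+ 2 = `|y| ^+ 2 by rewrite real_normK ?num_real.
rewrite y2; have : 0 <= c * (`|y| - 2^-1) ^+ 2 by rewrite mulr_ge0 ?sqr_ge0// ltW.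
rewrite sqrrB -mulr_natr; lra.
Qed.

(** The sum over a cube of the lattice factors into d one-dimensional sums. The bound depends
    neither on the centre nor on the size of the cube. *)
Lemma sum_gauss_ffun d n (x : 'I_d -> R) :
  \sum_(a : {ffun 'I_d -> 'I_n}) \prod_(i < d) expR (- (c * (x i - (a i)%:R) ^+ 2)) <= lattice_const ^+ d.
Proof.
rewrite -(bigA_distr_bigA (fun i (j : 'I_n) => expR (- (c * (x i - j%:R) ^+ 2)))).
apply: (@le_trans _ _ (\prod_(i < d) lattice_const)); last by rewrite prodr_const card_ord.
apply: ler_prod => i _; rewrite sumr_ge0 => [|j _]; last exact: expR_ge0.
exact: sum_gauss_le.
Qed.

End lattice.

(** This is how powers are absorbed into Gaussians throughout. With r = c/p, e^(c t^2) is the p-th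
    power of e^(r t^2), so that the linear bound 1 + t <= (2 + 1/r) e^(r t^2) suffices. *)
Lemma powR_1D_le (p c : R) : 0 < p -> 0 < c ->
  exists2 C : R, 1 <= C & forall t, 0 <= t -> (1 + t) `^ p <= C * expR (c * t ^+ 2).
Proof.
move=> p0 c0.
have [r r0 pr] : exists2 r : R, 0 < r & p * r = c.
  by exists (c / p); [rewrite divr_gt0|rewrite mulrC divfK// gt_eqF].
have ir : 0 < r^-1 by rewrite invr_gt0.
exists ((2 + r^-1) `^ p).
  apply: (@le_trans _ _ (1 `^ p)); first by rewrite powR1.
  apply: ge0_ler_powR; rewrite ?nnegrE; lra.
move=> t t0.
have e1 : 1 <= expR (r * t ^+ 2) by rewrite -expR0 ler_expR mulr_ge0 ?sqr_ge0// ltW.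
have := le_norm_expR t r0; rewrite ger0_norm// => e2.
apply: (@le_trans _ _ (((2 + r^-1) * expR (r * t ^+ 2)) `^ p)).
  apply: ge0_ler_powR; rewrite ?nnegrE; [exact: ltW|lra| |lra].
  by apply: mulr_ge0; [lra|exact: expR_ge0].
rewrite powRM ?expR_ge0//; last by lra.
rewrite [expR _ `^ p]/powR gt_eqF ?expR_gt0// expRK.
by rewrite mulrA pr.
Qed.

Lemma subX_le (s : R) m : 0 <= s <= 1 -> 1 - s ^+ m <= m%:R * (1 - s).
Proof.
move=> /andP[s0 s1]; elim: m => [|m IH]; first by rewrite expr0 subrr mul0r.
rewrite exprS -natr1 mulrDl mul1r.
have : 0 <= s ^+ m <= 1 by rewrite exprn_ge0//= exprn_ile1.
nra.
Qed.

(** With s = x/y <= 1, the real power is compared with an integer one, s^m <= s^b, and Bernoulli's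
    inequality bounds 1 - s^m by m (1 - s). The factor y on the left keeps negative powers out when
    b < 1. *)
Lemma powR_sub_le (b : R) (m : nat) (x y : R) : 0 < b -> b <= m%:R -> 0 < x -> x <= y ->
  y * (y `^ b - x `^ b) <= m%:R * y `^ b * (y - x).
Proof.
move=> b0 bm x0 xy; have y0 : 0 < y by lra.
pose s := x / y; have xE : x = s * y by rewrite /s divfK// gt_eqF.
have s0 : 0 < s by rewrite divr_gt0.
have s1 : s <= 1 by rewrite ler_pdivrMr// mul1r.
rewrite xE powRM ?(ltW s0) ?(ltW y0)//.
have sb : s ^+ m <= s `^ b.
  by rewrite -powR_mulrn ?(ltW s0)// ger_powR// s0.
have sm : 1 - s ^+ m <= m%:R * (1 - s) by apply: subX_le; rewrite s1 ltW.
have yb : 0 < y `^ b by rewrite powR_gt0.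
have -> : y * (y `^ b - s `^ b * y `^ b) = (y * y `^ b) * (1 - s `^ b) by ring.
have -> : m%:R * y `^ b * (y - s * y) = (y * y `^ b) * (m%:R * (1 - s)) by ring.
apply: ler_wpM2l; last by lra.
by rewrite mulr_ge0// ltW.
Qed.

Lemma powR_sub_norm_le (b : R) (m : nat) (x y M : R) : 0 < b -> b <= m%:R -> 0 < x -> 0 < y ->
  x <= M -> y <= M ->
  y * `|y `^ b - x `^ b| <= m%:R * M `^ b * `|y - x|.
Proof.
move=> b0 bm x0 y0 xM yM; have M0 : 0 <= M by lra.
have mono u v : 0 < u -> u <= v -> u `^ b <= v `^ b.
  by move=> u0 uv; apply: ge0_ler_powR; rewrite ?nnegrE; lra.
have [xy|yx] := leP x y.
  rewrite !ger0_norm ?subr_ge0 ?mono//.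
  apply: le_trans (powR_sub_le b0 bm x0 xy) _.
  by rewrite ler_wpM2r ?subr_ge0// ler_wpM2l// mono.
rewrite (distrC (y `^ b)) (distrC y) !ger0_norm ?subr_ge0 ?mono ?(ltW yx)//.
apply: (@le_trans _ _ (x * (x `^ b - y `^ b))).
  by rewrite ler_wpM2r ?subr_ge0 ?mono// ltW.
apply: le_trans (powR_sub_le b0 bm y0 (ltW yx)) _.
by rewrite ler_wpM2r ?subr_ge0 ?(ltW yx)// ler_wpM2l// mono.
Qed.

(** Subtracting the multiple of t^2 that has the same derivative at A leaves a function h with h'(t)
    = (b+2) t (t^b - A^b). This vanishes at A and is O(M^b |t - A|), so the mean value theorem gives
    a quadratic remainder. The comparison is with t^2 rather than t because |xi|^2 is a polynomial
    in xi. *)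
Lemma phase_scalar (b : R) (m : nat) (A B M : R) : 0 < b -> b <= m%:R -> 0 < A -> 0 <= B ->
  A <= M -> B <= M ->
  `|B `^ (b + 2) - A `^ (b + 2) - (b + 2) / 2 * A `^ b * (B ^+ 2 - A ^+ 2)|
   <= (b + 2) * m%:R * M `^ b * (B - A) ^+ 2.
Proof.
move=> b0 bm A0 B0 AM BM.
have pw2 x : 0 < x -> x `^ (b + 2) = x `^ b * x ^+ 2.
  by move=> x0; rewrite powRD; [rewrite -(powR_mulrn 2 (ltW x0))|rewrite (gt_eqF x0) implybT].
have mono u v : 0 < u -> u <= v -> u `^ b <= v `^ b.
  by move=> u0 uv; apply: ge0_ler_powR; rewrite ?nnegrE; lra.
have m1 : 1 <= m%:R :> R.
  by rewrite ler1n lt0n; apply/eqP => m0; move: bm; rewrite m0; lra.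
have AMb := mono _ _ A0 AM.
have Ab := powR_gt0 b A0.
(* B = 0 is computed directly, since t^(b+2) is differentiated on the open half-line only. *)
move: B0; rewrite le_eqVlt => /orP[/eqP <-|B0].
  rewrite powR0 ?gt_eqF//; last lra.
  rewrite pw2// expr0n /= !sub0r.
  have -> : - (A `^ b * A ^+ 2) - (b + 2) / 2 * A `^ b * - A ^+ 2 = b / 2 * (A `^ b * A ^+ 2) by field.
  rewrite ger0_norm; last by rewrite mulr_ge0// ?mulr_ge0 ?sqr_ge0 ?divr_ge0// ltW.
  have -> : (b + 2) * m%:R * M `^ b * (- A) ^+ 2 = (b + 2) * (m%:R * (M `^ b * A ^+ 2)) by ring.
  have : A `^ b * A ^+ 2 <= M `^ b * A ^+ 2 by rewrite ler_wpM2r ?sqr_ge0.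
  have : 0 <= A `^ b * A ^+ 2 by rewrite mulr_ge0 ?sqr_ge0 ?ltW.
  move: (A `^ b * _) (M `^ b * _) => z w z0 zw.
  have w0 : 0 <= w by lra.
  have mw : 0 <= (m%:R - 1) * w by apply: mulr_ge0; lra.
  have bw : 0 <= b * (w - z) by apply: mulr_ge0; lra.
  have bw2 : 0 <= b * w by apply: mulr_ge0; lra.
  have bmw : 0 <= b * ((m%:R - 1) * w) by apply: mulr_ge0; lra.
  lra.
pose h t := t `^ (b + 2) - (b + 2) / 2 * A `^ b * t ^+ 2.
pose h' t := (b + 2) * (t * (t `^ b - A `^ b)).
have dh t : 0 < t -> is_derive (t : R) (1 : R) h (h' t).
  move=> t0; have tin : t \in `]0, +oo[%R by rewrite in_itv /= t0.
  have dp : is_derive (t : R) (1 : R) (fun t => t `^ (b + 2)) ((b + 2) * t `^ (b + 2 - 1)).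
    apply: DeriveDef; first exact: derivable_powR.
    by rewrite -derive1E powR_derive1.
  have -> : h' t = (b + 2) * t `^ (b + 2 - 1) - (b + 2) / 2 * A `^ b * (t + t).
    rewrite (_ : b + 2 - 1 = b + 1); last by ring.
    rewrite powRD; last by rewrite (gt_eqF t0) implybT.
    by rewrite (powRr1 (ltW t0)) /h'; field.
  apply: is_derive_eq; rewrite /GRing.scale /=; ring.
have key u v : 0 < u -> u < v -> v <= M -> (u = A \/ v = A) ->
    `|h v - h u| <= (b + 2) * m%:R * M `^ b * (v - u) ^+ 2.
  move=> u0 uv vM uvA.
  have [c] : exists2 c, c \in `]u, v[%R & h v - h u = h' c * (v - u).
    apply: MVT => //.
      by move=> x; rewrite in_itv /= => /andP[ux _]; apply: dh; lra.
    apply: continuous_in_subspaceT => x; rewrite inE /= in_itv /= => /andP[ux _].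
    have x0 : 0 < x by lra.
    by have [/derivable1_diffP/differentiable_continuous] := dh x x0.
  rewrite in_itv /= => /andP[uc cv] ->.
  have c0 : 0 < c by lra.
  rewrite /h' !normrM (ger0_norm (ltW c0)) (ger0_norm (_ : 0 <= b + 2)); last lra.
  have AleM : A <= M by [].
  have cM : c <= M by lra.
  have := powR_sub_norm_le b0 bm A0 c0 AleM cM => K.
  have cA : `|c - A| <= v - u.
    by case: uvA => <-; [rewrite ger0_norm|rewrite ler0_norm]; lra.
  rewrite (ger0_norm (_ : 0 <= v - u)); last lra.
  have Mb : 0 <= m%:R * M `^ b by rewrite mulr_ge0 ?powR_ge0.
  have K2 : c * `|c `^ b - A `^ b| <= m%:R * M `^ b * (v - u).
    by apply: le_trans K _; rewrite ler_wpM2l.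
  rewrite expr2 !mulrA ler_wpM2r; [by []|lra|].
  rewrite -!mulrA ler_wpM2l; [by []|lra|].
  by rewrite mulrA.
have E : B `^ (b + 2) - A `^ (b + 2) - (b + 2) / 2 * A `^ b * (B ^+ 2 - A ^+ 2) = h B - h A.
  by rewrite /h; ring.
rewrite E; have [AB|BA|->] := ltgtP A B.
- by apply: key => //; left.
- by rewrite distrC (_ : (B - A) ^+ 2 = (A - B) ^+ 2); [apply: key => //; right|ring].
- by rewrite !subrr normr0 expr0n /= mulr0.
Qed.

End Numeric.

(** * Euclidean geometry and the phase |xi|^beta *)

Section Geometry.
Variables (R : realType) (d : nat).
Local Notation vec := (Defs.vec R d).
Implicit Types (x y z a v : vec) (f : vec -> R).

Lemma dotvC x y : dotv x y = dotv y x.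
Proof. by apply: eq_bigr => i _; rewrite mulrC. Qed.

Lemma dotvDl x y z : dotv (x + y) z = dotv x z + dotv y z.
Proof. by rewrite -big_split; apply: eq_bigr => i _; rewrite mxE mulrDl. Qed.

Lemma dotvNl x y : dotv (- x) y = - dotv x y.
Proof. by rewrite -sumrN; apply: eq_bigr => i _; rewrite mxE mulNr. Qed.

Lemma dotvZl k x y : dotv (k *: x) y = k * dotv x y.
Proof. by rewrite /dotv mulr_sumr; apply: eq_bigr => i _; rewrite mxE mulrA. Qed.

Lemma dotvBl x y z : dotv (x - y) z = dotv x z - dotv y z.
Proof. by rewrite dotvDl dotvNl. Qed.

Lemma dotvDr x y z : dotv x (y + z) = dotv x y + dotv x z.
Proof. by rewrite dotvC dotvDl !(dotvC x). Qed.

Lemma dotvNr x y : dotv x (- y) = - dotv x y.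
Proof. by rewrite dotvC dotvNl dotvC. Qed.

Lemma dotvBr x y z : dotv x (y - z) = dotv x y - dotv x z.
Proof. by rewrite dotvDr dotvNr. Qed.

Lemma dotvZr k x y : dotv x (k *: y) = k * dotv x y.
Proof. by rewrite dotvC dotvZl dotvC. Qed.

Lemma normv_ge0 x : 0 <= normv x. Proof. exact: sqrtr_ge0. Qed.

Lemma normv_sqr x : normv x ^+ 2 = dotv x x.
Proof. by rewrite sqr_sqrtr// dotvv_ge0. Qed.

Lemma dotv_sqr_le x y : dotv x y ^+ 2 <= dotv x x * dotv y y.
Proof.
have := dotvv_ge0 (dotv y y *: x - dotv x y *: y).
rewrite !(dotvBl, dotvBr, dotvZl, dotvZr) (dotvC y x).
set a := dotv x x; set b := dotv y y; set c := dotv x y => h.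
have := dotvv_ge0 y; rewrite le_eqVlt => /orP[/eqP y0|b0].
  have yi i : y ord0 i = 0.
    have /psumr_eq0P := esym y0; move=> /(_ (fun i _ => sqr_ge0 (y ord0 i))) /(_ i isT)/eqP.
    by rewrite -expr2 sqrf_eq0 => /eqP.
  have -> : c = 0 by rewrite /c /dotv big1// => i _; rewrite yi mulr0.
  by rewrite expr0n /= /b -y0 mulr0.
have b1 : 0 < b by [].
have {}h : 0 <= b * (a * b - c ^+ 2).
  by rewrite (_ : b * _ = b * (b * a) - b * (c * c) - (c * (b * c) - c * (c * b)) - (b * (c * c) - c * (c * b))) ?subr_ge0; [lra|ring].
by rewrite -subr_ge0 -(pmulr_rge0 _ b1).
Qed.

Lemma dotv_le x y : `|dotv x y| <= normv x * normv y.
Proof.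
rewrite -(@ler_pXn2r _ 2)// ?nnegrE ?mulr_ge0 ?normv_ge0//.
by rewrite real_normK ?num_real// exprMn !normv_sqr dotv_sqr_le.
Qed.

Lemma normvD x y : normv (x + y) <= normv x + normv y.
Proof.
rewrite -(@ler_pXn2r _ 2)// ?nnegrE ?addr_ge0 ?normv_ge0//.
rewrite normv_sqr sqrrD !normv_sqr !(dotvDl, dotvDr) (dotvC y x).
have := ler_norm (dotv x y); have := dotv_le x y; rewrite mulr2n; lra.
Qed.

Lemma normvN x : normv (- x) = normv x.
Proof. by rewrite /normv dotvNl dotvNr opprK. Qed.

Lemma normvB x y : normv (x - y) = normv (y - x).
Proof. by rewrite -normvN opprB. Qed.

Lemma normv_coord x i : `|x ord0 i| <= normv x.
Proof.
rewrite -(@ler_pXn2r _ 2)// ?nnegrE ?normv_ge0//.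
rewrite real_normK ?num_real// normv_sqr /dotv (bigD1 i)//= -expr2 lerDl.
by apply: sumr_ge0 => j _; rewrite -expr2 sqr_ge0.
Qed.

Lemma dotv_sqr_dist x y a : dotv (x - a) (x - a) <= 2 * dotv (x - y) (x - y) + 2 * dotv (y - a) (y - a).
Proof.
rewrite -(subrK y x) -addrA -[X in dotv X _](_ : x - y + (y - a) = _)//.
have := dotvv_ge0 (x - y - (y - a)).
rewrite (_ : x - y + y - y = x - y); last by rewrite subrK.
move: (x - y) (y - a) => p q.
by rewrite !(dotvDl, dotvDr, dotvNl, dotvNr) (dotvC q p); lra.
Qed.

(** A Gaussian can be moved to any other centre at the cost of a constant and of half its rate. This
    makes [gdom] stable under addition. *)
Lemma gs_recenter r a b x : 0 <= r -> gs r a x <= expR (r * dotv (b - a) (b - a)) * gs (r / 2) b x.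
Proof.
move=> r0; rewrite /gs -expRD ler_expR.
have := dotv_sqr_dist x a b; rewrite (_ : dotv (a - b) (a - b) = dotv (b - a) (b - a)); last first.
  by rewrite -opprB dotvNl dotvNr opprK.
move=> h; have := ler_wpM2l r0 h; lra.
Qed.

Lemma gs_le_rate r r' a x : r' <= r -> gs r a x <= gs r' a x.
Proof. by move=> rr; rewrite ler_expR lerN2 ler_wpM2r// dotvv_ge0. Qed.

Lemma gdomD f g : gdom f -> gdom g -> gdom (fun x => f x + g x).
Proof.
move=> [mf [r [a [A [r0 A0 fA]]]]] [mg [r' [a' [A' [r'0 A'0 gA]]]]].
have m0 : 0 < Num.min (r / 2) (r' / 2) by rewrite lt_min !divr_gt0.
apply: (@gdom_le _ _ _ (Num.min (r / 2) (r' / 2)) 0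
  (A * expR (r * dotv (0 - a) (0 - a)) + A' * expR (r' * dotv (0 - a') (0 - a')))) => //.
  exact: vmeasD.
move=> x; apply: le_trans (ler_normD _ _) _; rewrite mulrDl lerD// -mulrA.
  apply: le_trans (fA x) _; rewrite ler_wpM2l//.
  apply: le_trans (gs_recenter a 0 x (ltW r0)) _; rewrite ler_wpM2l ?expR_ge0//.
  by apply: gs_le_rate; rewrite ge_min lexx.
apply: le_trans (gA x) _; rewrite ler_wpM2l//.
apply: le_trans (gs_recenter a' 0 x (ltW r'0)) _; rewrite ler_wpM2l ?expR_ge0//.
by apply: gs_le_rate; rewrite ge_min lexx orbT.
Qed.

Lemma gdom0 : gdom (fun _ : vec => 0).
Proof.
split; first exact: vmeas_cst.
by exists 1, 0, 0; split => // x; rewrite normr0 mul0r.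
Qed.

Lemma gdom_sum (I : Type) (s : seq I) (F : I -> vec -> R) : (forall i, gdom (F i)) ->
  gdom (fun x => \sum_(i <- s) F i x).
Proof.
move=> dF; elim: s => [|i s IH].
  by under eq_fun do rewrite big_nil; exact: gdom0.
by under eq_fun do rewrite big_cons; exact: gdomD.
Qed.

Lemma integralv_sumE (I : Type) (s : seq I) (F : I -> vec -> R) : (forall i, gdom (F i)) ->
  integralv (fun x => \sum_(i <- s) F i x) = \sum_(i <- s) integralv (F i).
Proof. by move=> dF; have [] := integralv_sum s dF. Qed.

Variable b : R.
Hypothesis b0 : 0 < b.

Definition phi x : R := normv x `^ (b + 2).
Definition gradphi x : vec := ((b + 2) * normv x `^ b) *: x.

(** With v = xi - xi0 one has |xi|^2 - |xi0|^2 = 2 xi0.v + |v|^2. Inserted in [phase_scalar], the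
    first term is exactly the linear part of the expansion, and the second joins the remainder,
    which turns m into m + 1. *)
Lemma phase_taylor m xi0 xi : b <= m%:R -> 0 < normv xi0 ->
  `|phi xi - phi xi0 - dotv (gradphi xi0) (xi - xi0)| <=
  (b + 2) * m.+1%:R * (normv xi0 + normv (xi - xi0)) `^ b * dotv (xi - xi0) (xi - xi0).
Proof.
move=> bm A0; set v := xi - xi0.
set A := normv xi0 in A0 *; set B := normv xi; set V := normv v.
have B0 : 0 <= B by exact: normv_ge0.
have V0 : 0 <= V by exact: normv_ge0.
have BAV : B <= A + V by rewrite /B -(subrK xi0 xi) addrC normvD.
have ABV : A <= B + V by rewrite /A -(subrK xi xi0) addrC /V /v normvB normvD.
have := @phase_scalar R b m A B (A + V) b0 bm A0 B0 _ BAV.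
rewrite lerDl => /(_ V0); rewrite -/(phi xi) -/(phi xi0).
have E2 : B ^+ 2 - A ^+ 2 = 2 * dotv xi0 v + dotv v v.
  suff gen w : normv (w + xi0) ^+ 2 - normv xi0 ^+ 2 = 2 * dotv xi0 w + dotv w w.
    by rewrite -gen subrK.
  by rewrite !normv_sqr !(dotvDl, dotvDr) (dotvC w xi0); ring.
rewrite E2 => h.
have -> : dotv (gradphi xi0) v = (b + 2) * A `^ b * dotv xi0 v by rewrite dotvZl.
have Vv : dotv v v = V ^+ 2 by rewrite normv_sqr.
clearbody A B V v.
move: (phi xi) (phi xi0) (dotv xi0 v) (dotv v v) E2 h Vv => P Q D W E2 h Vv.
clear xi xi0 v.
have b00 := b0.
have -> : P - Q - (b + 2) * A `^ b * D =
  (P - Q - (b + 2) / 2 * A `^ b * (2 * D + W)) + (b + 2) / 2 * A `^ b * W.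
  by field.
apply: le_trans (ler_normD _ _) _.
have BA2 : (B - A) ^+ 2 <= V ^+ 2.
  rewrite -[leLHS]real_normK ?num_real// ler_pXn2r ?nnegrE//.
  by rewrite ler_norml; apply/andP; split; lra.
have AM : A `^ b <= (A + V) `^ b.
  by apply: ge0_ler_powR; rewrite ?nnegrE; lra.
have Ab0 : 0 <= A `^ b by exact: powR_ge0.
have V20 : 0 <= V ^+ 2 by exact: sqr_ge0.
rewrite (ger0_norm (_ : 0 <= (b + 2) / 2 * A `^ b * W)); last first.
  by rewrite Vv !mulr_ge0 ?invr_ge0//; lra.
rewrite Vv -[m.+1%:R]natr1 in h *.
set M := (A + V) `^ b in h AM *.
have h1 : (b + 2) * m%:R * M * (B - A) ^+ 2 <= (b + 2) * m%:R * M * V ^+ 2.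
  by rewrite ler_wpM2l// !mulr_ge0//; lra.
have h2 : (b + 2) / 2 * A `^ b * V ^+ 2 <= (b + 2) * M * V ^+ 2.
  by rewrite ler_wpM2r//; apply: ler_pM => //; lra.
have -> : (b + 2) * (m%:R + 1) * M * V ^+ 2 = (b + 2) * m%:R * M * V ^+ 2 + (b + 2) * M * V ^+ 2 by ring.
by rewrite lerD// (le_trans h).
Qed.

(** The product of the gradient difference with x - y splits into (b+2)/2 (|x|^b + |y|^b) |x - y|^2
    and (b+2)/2 (|x|^b - |y|^b)(|x|^2 - |y|^2). The latter is nonnegative, and Cauchy-Schwarz
    concludes. *)
Lemma gradphi_mono (N : R) x y : 0 < N -> N <= normv x -> N <= normv y ->
  (b + 2) * N `^ b * normv (x - y) <= normv (gradphi x - gradphi y).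
Proof.
move=> N0 Nx Ny; set X := normv x in Nx *; set Y := normv y in Ny *.
have bp := ltW b0; have X0 : 0 <= X := normv_ge0 x; have Y0 : 0 <= Y := normv_ge0 y.
have XN : N `^ b <= X `^ b by apply: ge0_ler_powR; rewrite ?nnegrE// ltW.
have YN : N `^ b <= Y `^ b by apply: ge0_ler_powR; rewrite ?nnegrE// ltW.
have [/eqP V0|V0] := boolP (normv (x - y) == 0).
  by rewrite V0 mulr0 normv_ge0.
have V1 : 0 < normv (x - y) by rewrite lt0r V0 normv_ge0.
rewrite -(ler_pM2r V1); apply: le_trans (le_trans (ler_norm _) (dotv_le _ (x - y))).
have -> : (b + 2) * N `^ b * normv (x - y) * normv (x - y) = (b + 2) * N `^ b * dotv (x - y) (x - y).
  by rewrite -mulrA -expr2 normv_sqr.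
have -> : dotv (gradphi x - gradphi y) (x - y) = (b + 2) *
  (2^-1 * (X `^ b + Y `^ b) * dotv (x - y) (x - y) + 2^-1 * (X `^ b - Y `^ b) * (X ^+ 2 - Y ^+ 2)).
  rewrite !normv_sqr /gradphi -/X -/Y !(dotvBl, dotvBr, dotvZl, dotvZr) (dotvC y x); by field.
rewrite -mulrA ler_wpM2l ?addr_ge0//.
have mono : 0 <= (X `^ b - Y `^ b) * (X ^+ 2 - Y ^+ 2).
  have [XY|/ltW YX] := leP X Y.
    by rewrite mulr_le0// subr_le0; [apply: ge0_ler_powR; rewrite ?nnegrE|rewrite lerXn2r].
  by rewrite mulr_ge0// subr_ge0; [apply: ge0_ler_powR; rewrite ?nnegrE|rewrite lerXn2r].
have : N `^ b * dotv (x - y) (x - y) <= 2^-1 * (X `^ b + Y `^ b) * dotv (x - y) (x - y).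
  by apply: ler_wpM2r (dotvv_ge0 _) _ _ _; move: XN YN; clear; lra.
move: mono; clear; lra.
Qed.

End Geometry.

(** * The test functions *)

Section TestFunction.
Variables (R : realType) (d : nat).
Local Notation vec := (Defs.vec R d).
Implicit Types (x y z a v xi : vec) (f g : vec -> R).

Lemma cint_gdom (h : vec -> R[i]) : gdom (fun x => complex.Re (h x)) -> gdom (fun x => complex.Im (h x)) ->
  cint h = Complex (integralv (fun x => complex.Re (h x))) (integralv (fun x => complex.Im (h x))).
Proof. by move=> h1 h2; rewrite /cint !intRd_gdom. Qed.

Lemma vmeas_trig (h : R -> R) v th : continuous h -> vmeas (fun x => h (dotv x v + th)).
Proof.
move=> ch; have := vmeas_dot 0 v; under eq_fun do rewrite subr0; move=> mv.
apply: (@vmeas_comp R d (fun t => h (t + th)) (fun x => dotv x v)) => //.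
apply: measurableT_comp; first exact: continuous_measurable_fun.
by apply: measurable_funD.
Qed.

Lemma gdom_cos_gs r a v th : 0 < r -> gdom (fun x => cos (dotv x v + th) * gs r a x).
Proof.
move=> r0; under eq_fun do rewrite mulrC.
apply: (@gdomM _ _ (gs r a) (fun x => cos (dotv x v + th)) 1); first exact: gdom_gs.
  by apply: vmeas_trig; exact: continuous_cos.
by move=> x; rewrite ler_norml cos_geN1 cos_le1.
Qed.

Variables (N n : nat).

Definition kv (a : {ffun 'I_d -> 'I_n}) : vec := \row_i (N + a i)%:R.

Definition testu (x : vec) : R[i] :=
  Complex (\sum_a cos (dotv x (kv a)) * gs 2^-1 0 x) (\sum_a sin (dotv x (kv a)) * gs 2^-1 0 x).

(** The total mass (2 pi)^(d/2) of e^(-|x|^2/2). *)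
Definition G0 : R := Num.sqrt (pi / 2^-1) ^+ d.

Lemma G0_gt0 : 0 < G0.
Proof. by rewrite exprn_gt0// sqrtr_gt0 divr_gt0// pi_gt0. Qed.

Definition uhat xi : R := \sum_a G0 * gs 2^-1 (kv a) xi.

Lemma uhat_ge0 xi : 0 <= uhat xi.
Proof. by apply: sumr_ge0 => a _; rewrite mulr_ge0 ?gs_ge0// ltW// G0_gt0. Qed.

Lemma gdom_uhat : gdom uhat.
Proof. by apply: gdom_sum => a; apply: gdomZ; exact: gdom_gs. Qed.

Lemma integral_cos_test v th :
  integralv (fun x => cos (dotv x v + th) * gs 2^-1 0 x) = cos th * (G0 * gs 2^-1 v 0).
Proof.
have h0 : 0 < 2^-1 :> R by rewrite invr_gt0.
have := integralv_gs_cos 0 v th h0.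
rewrite (@integralv_eq _ _ _ (fun x => cos (dotv x v + th) * gs 2^-1 0 x)); last first.
  by move=> x; rewrite subr0.
move=> ->; rewrite -mulrA; congr (_ * (_ * expR (- _))).
rewrite sub0r dotvNl dotvNr opprK mulrC; congr (_ * _).
by field.
Qed.

Lemma fourier_testu xi : fourier testu xi = Complex (uhat xi) 0.
Proof.
have reE x : complex.Re (testu x * cexpi (- dotv x xi)) =
    \sum_a cos (dotv x (kv a - xi) + 0) * gs 2^-1 0 x.
  rewrite /= mulr_suml [X in _ - X]mulr_suml -sumrB; apply: eq_bigr => a _.
  by rewrite cosN sinN addr0 dotvBr cosB; ring.
(* The imaginary part is a sum of cosines with phase -pi/2, so that its integral carries the factor
   cos(-pi/2) = 0. *)
have imE x : complex.Im (testu x * cexpi (- dotv x xi)) =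
    \sum_a cos (dotv x (kv a - xi) + - (pi / 2)) * gs 2^-1 0 x.
  rewrite /= mulr_suml [X in _ + X]mulr_suml -big_split; apply: eq_bigr => a _ /=.
  by rewrite cosBpihalf cosN sinN dotvBr sinB; ring.
have h0 : 0 < 2^-1 :> R by rewrite invr_gt0.
rewrite /fourier cint_gdom; last 2 first.
- by rewrite (funext reE); apply: gdom_sum => a; exact: gdom_cos_gs.
- by rewrite (funext imE); apply: gdom_sum => a; exact: gdom_cos_gs.
rewrite (funext reE) (funext imE) !integralv_sumE; try by move=> a; exact: gdom_cos_gs.
congr Complex.
  apply: eq_bigr => a _; rewrite integral_cos_test cos0 mul1r /gs; congr (_ * expR (- (_ * _))).
  by rewrite sub0r dotvNl dotvNr opprK -[in RHS]opprB dotvNl dotvNr opprK.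
by apply: big1 => a _; rewrite integral_cos_test cosN cos_pihalf mul0r.
Qed.

(* A class containing the real and imaginary parts of the test functions, closed
   under directional derivatives and made of rapidly decreasing functions. *)
Inductive hermite : (vec -> R) -> Prop :=
| hermite_cos k : hermite (fun x => cos (dotv x k) * gs 2^-1 0 x)
| hermite_sin k : hermite (fun x => sin (dotv x k) * gs 2^-1 0 x)
| hermite0 : hermite (fun _ => 0)
| hermiteD f g : hermite f -> hermite g -> hermite (fun x => f x + g x)
| hermiteZ c f : hermite f -> hermite (fun x => c * f x)
| hermiteX i f : hermite f -> hermite (fun x => x ord0 i * f x).

Lemma hermite_sum (I : Type) (s : seq I) (F : I -> vec -> R) : (forall i, hermite (F i)) ->
  hermite (fun x => \sum_(i <- s) F i x).
Proof.
move=> dF; elim: s => [|i s IH].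
  by under eq_fun do rewrite big_nil; exact: hermite0.
by under eq_fun do rewrite big_cons; exact: hermiteD.
Qed.

Lemma dotv_dirr x i : dotv x (dir R i) = x ord0 i.
Proof.
rewrite /dotv (bigD1 i)//= mxE eqxx mulr1 big1 ?addr0// => j ji.
by rewrite mxE eq_sym (negbTE ji) mulr0.
Qed.

Lemma dir_coord i j : (dir R i : vec) ord0 j = (i == j)%:R.
Proof. by rewrite mxE. Qed.

Lemma gs_line r a x i t : gs r a (x + t *: dir R i) =
  expR (- (r * (dotv (x - a) (x - a) + 2 * t * (x - a) ord0 i + t ^+ 2))).
Proof.
rewrite /gs; congr (expR (- (r * _))).
have -> : x + t *: dir R i - a = (x - a) + t *: dir R i by rewrite addrAC.
move: (x - a) => p; rewrite !(dotvDl, dotvDr, dotvZl, dotvZr) (dotvC (dir R i)) !dotv_dirr dir_coord eqxx.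
by rewrite mulr1; ring.
Qed.

Lemma is_derive_gs r a x i :
  is_derive (0 : R) (1 : R) (fun t => gs r a (x + t *: dir R i))
    (- (2 * r * (x - a) ord0 i) * gs r a x).
Proof.
under eq_fun do rewrite gs_line.
have -> : gs r a x = expR (- (r * (dotv (x - a) (x - a) + 2 * 0 * (x - a) ord0 i + 0 ^+ 2))).
  by rewrite -gs_line scale0r addr0.
by apply: is_derive_eq; rewrite /GRing.scale /=; ring.
Qed.

Lemma hermite_derive f i : hermite f -> exists2 f', hermite f' &
  forall x, is_derive (0 : R) (1 : R) (fun t => f (x + t *: dir R i)) (f' x).
Proof.
elim=> [k|k||{}f g hf [f' hf' df] hg [g' hg' dg]|c {}f hf [f' hf' df]|j {}f hf [f' hf' df]].
- exists (fun x => (- k ord0 i) * (sin (dotv x k) * gs 2^-1 0 x) + (-1) * (x ord0 i * (cos (dotv x k) * gs 2^-1 0 x))).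
    apply: hermiteD; apply: hermiteZ; first exact: hermite_sin.
    by apply: hermiteX; exact: hermite_cos.
  move=> x; have dg := is_derive_gs 2^-1 0 x i; rewrite subr0 in dg.
  have -> : (fun t : R => cos (dotv (x + t *: dir R i) k) * gs 2^-1 0 (x + t *: dir R i)) =
    (fun t : R => cos (dotv x k + t * k ord0 i) * gs 2^-1 0 (x + t *: dir R i)).
    by apply/funext => t; rewrite dotvDl dotvZl (dotvC (dir R i)) dotv_dirr.
  have x0 : x + 0 *: dir R i = x by rewrite scale0r addr0.
  apply: is_derive_eq; rewrite x0 /GRing.scale /= !mul0r !addr0.
  by field.
- exists (fun x => (k ord0 i) * (cos (dotv x k) * gs 2^-1 0 x) + (-1) * (x ord0 i * (sin (dotv x k) * gs 2^-1 0 x))).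
    apply: hermiteD; apply: hermiteZ; first exact: hermite_cos.
    by apply: hermiteX; exact: hermite_sin.
  move=> x; have dg := is_derive_gs 2^-1 0 x i; rewrite subr0 in dg.
  have -> : (fun t : R => sin (dotv (x + t *: dir R i) k) * gs 2^-1 0 (x + t *: dir R i)) =
    (fun t : R => sin (dotv x k + t * k ord0 i) * gs 2^-1 0 (x + t *: dir R i)).
    by apply/funext => t; rewrite dotvDl dotvZl (dotvC (dir R i)) dotv_dirr.
  have x0 : x + 0 *: dir R i = x by rewrite scale0r addr0.
  apply: is_derive_eq; rewrite x0 /GRing.scale /= !mul0r !addr0.
  by field.
- by exists (fun=> 0); [exact: hermite0|move=> x; exact: is_derive_cst].
- exists (fun x => f' x + g' x); first exact: hermiteD.
  by move=> x; apply: is_deriveD.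
- exists (fun x => c * f' x); first exact: hermiteZ.
  move=> x; have dfx := df x; apply: is_derive_eq; rewrite /GRing.scale /=; ring.
- exists (fun x => (i == j)%:R * f x + x ord0 j * f' x).
    by apply: hermiteD; [exact: hermiteZ|exact: hermiteX].
  move=> x; have dfx := df x.
  have -> : (fun t : R => (x + t *: dir R i) ord0 j * f (x + t *: dir R i)) =
     (fun t : R => (x ord0 j + t * (i == j)%:R) * f (x + t *: dir R i)).
    by apply/funext => t; rewrite !mxE.
  have x0 : x + 0 *: dir R i = x by rewrite scale0r addr0.
  apply: is_derive_eq; rewrite x0 /GRing.scale /= !mul0r !addr0.
  ring.
Qed.

Lemma hermite_pder f l : hermite f -> hermite (pder l f).
Proof.
elim: l => //= i l IH hf; have [f' hf' df] := hermite_derive i (IH hf).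
suff -> : (fun x => (fun t : R => pder l f (x + t *: dir R i))^`()%classic 0) = f' by [].
by apply/funext => x; rewrite derive1E; have [] := df x.
Qed.

Lemma jbr_le x : jbr x <= 1 + normv x.
Proof.
rewrite -(@ler_pXn2r _ 2)// ?nnegrE ?sqrtr_ge0 ?addr_ge0 ?normv_ge0//.
rewrite sqr_sqrtr; last by rewrite addr_ge0// dotvv_ge0.
by rewrite -normv_sqr sqrrD; have := normv_ge0 x; rewrite mulr2n; lra.
Qed.

Lemma jbr_ge1 x : 1 <= jbr x.
Proof. by rewrite -sqrtr1 ler_wsqrtr// lerDl dotvv_ge0. Qed.

(** A coordinate factor costs one power of the bracket, hence the induction is over all m
    simultaneously. *)
Lemma hermite_decay f m : hermite f -> exists M, forall x, jbr x ^+ m * `|f x| <= M.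
Proof.
move=> hf; elim: hf m => [k|k||{}f g hf IHf hg IHg|c {}f hf IHf|j {}f hf IHf] m.
- have [||C C1 HC] := @powR_1D_le R m.+1%:R 2^-1; [by []|by rewrite invr_gt0|].
  exists C => x.
  have gb : jbr x ^+ m * gs 2^-1 0 x <= C.
    rewrite /gs subr0 expRN ler_pdivrMr ?expR_gt0//.
    have := HC _ (normv_ge0 x); rewrite powR_mulrn ?addr_ge0 ?normv_ge0// normv_sqr.
    apply: le_trans; rewrite (@le_trans _ _ (jbr x ^+ m.+1))//.
      by rewrite exprS ler_peMl ?jbr_ge1// exprn_ge0// sqrtr_ge0.
    by rewrite lerXn2r ?nnegrE ?sqrtr_ge0 ?addr_ge0 ?normv_ge0// jbr_le.
  apply: le_trans gb; rewrite normrM ler_wpM2l ?exprn_ge0 ?sqrtr_ge0//.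
  by rewrite (ger0_norm (gs_ge0 _ _ _)) ler_piMl ?gs_ge0// ler_norml cos_geN1 cos_le1.
- have [||C C1 HC] := @powR_1D_le R m.+1%:R 2^-1; [by []|by rewrite invr_gt0|].
  exists C => x.
  have gb : jbr x ^+ m * gs 2^-1 0 x <= C.
    rewrite /gs subr0 expRN ler_pdivrMr ?expR_gt0//.
    have := HC _ (normv_ge0 x); rewrite powR_mulrn ?addr_ge0 ?normv_ge0// normv_sqr.
    apply: le_trans; rewrite (@le_trans _ _ (jbr x ^+ m.+1))//.
      by rewrite exprS ler_peMl ?jbr_ge1// exprn_ge0// sqrtr_ge0.
    by rewrite lerXn2r ?nnegrE ?sqrtr_ge0 ?addr_ge0 ?normv_ge0// jbr_le.
  apply: le_trans gb; rewrite normrM ler_wpM2l ?exprn_ge0 ?sqrtr_ge0//.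
  by rewrite (ger0_norm (gs_ge0 _ _ _)) ler_piMl ?gs_ge0// ler_norml sin_geN1 sin_le1.
- by exists 0 => x; rewrite normr0 mulr0.
- have [M HM] := IHf m; have [M' HM'] := IHg m; exists (M + M') => x.
  apply: le_trans (lerD (HM x) (HM' x)); rewrite -mulrDr ler_wpM2l ?exprn_ge0 ?sqrtr_ge0//.
  exact: ler_normD.
- have [M HM] := IHf m; exists (`|c| * M) => x.
  by rewrite normrM mulrCA ler_wpM2l.
- have [M HM] := IHf m.+1; exists M => x; apply: le_trans (HM x).
  rewrite normrM exprSr -mulrA ler_wpM2l ?exprn_ge0 ?sqrtr_ge0//.
  rewrite ler_wpM2r// (le_trans (normv_coord x j))// ler_wsqrtr// lerDr//.
Qed.

Lemma schwartz_testu : schwartz testu.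
Proof.
have hr : hermite (fun x => complex.Re (testu x)).
  by apply: hermite_sum => a; exact: hermite_cos.
have hi : hermite (fun x => complex.Im (testu x)).
  by apply: hermite_sum => a; exact: hermite_sin.
split; [|split].
- move=> l i x; have [f' _ df] := hermite_derive i (hermite_pder l hr).
  by have [] := df x.
- move=> l i x; have [f' _ df] := hermite_derive i (hermite_pder l hi).
  by have [] := df x.
move=> l m; have [M HM] := hermite_decay m (hermite_pder l hr).
have [M' HM'] := hermite_decay m (hermite_pder l hi).
by exists (M + M') => x; rewrite mulrDr lerD.
Qed.

End TestFunction.

(** * Upper bound for the modulation norm *)

Section BumpDecay.
Variables (R : realType) (d : nat).
Local Notation vec := (Defs.vec R d).
Implicit Types (x y z v xi k : vec) (f h : vec -> R).

(** The product is at most 2^d times the 2d-th power of max(1, |x_i|) for the largest coordinate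
    x_i. Decay of order 2d in each single coordinate therefore suffices, and mixed integrations by
    parts are avoided. *)
Lemma prod_weight_le (x : vec) (y A : R) : (0 < d)%N -> 0 <= y -> y <= A ->
  (forall i, `|x ord0 i| ^+ (2 * d) * y <= A) ->
  y * \prod_(i < d) (1 + x ord0 i ^+ 2) <= 2 ^+ d * A.
Proof.
case: d x => // d' x _ y0 yA xA.
have [i _ imax] := @Order.TotalTheory.arg_maxP _ _ _ (ord0 : 'I_d'.+1) xpredT (fun i => `|x ord0 i|) isT.
pose M := Num.max 1 `|x ord0 i|.
have M1 : 1 <= M by rewrite le_max lexx.
have p2 : \prod_(j < d'.+1) (1 + x ord0 j ^+ 2) <= \prod_(j < d'.+1) (2 * M ^+ 2).
  apply: ler_prod => j _; rewrite addr_ge0 ?sqr_ge0//=.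
  have -> : x ord0 j ^+ 2 = `|x ord0 j| ^+ 2 by rewrite real_normK ?num_real.
  have : `|x ord0 j| <= M by rewrite le_max; apply/orP; right; exact: imax.
  have := normr_ge0 (x ord0 j); set w := `|_|; nra.
apply: le_trans (ler_wpM2l y0 p2) _.
rewrite prodr_const card_ord exprMn -exprM mulrCA ler_wpM2l ?exprn_ge0// mulrC.
rewrite /M; case: (leP 1 `|x ord0 i|) => _; first exact: xA.
by rewrite expr1n mul1r.
Qed.

Lemma all_partials_continuous f l (i : 'I_d) x : all_partials_exist f ->
  continuous (fun t : R => pder l f (x + t *: dir R i)).
Proof.
move=> af t.
have dt : derivable (fun u : R => pder l f (x + u *: dir R i)) t 1.
  have D := af l i (x + t *: dir R i).
  have : is_derive (0 : R) (1 : R) (fun u => pder l f (x + (t + u) *: dir R i))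
    ('D_1 (fun u : R => pder l f (x + t *: dir R i + u *: dir R i)) 0).
    under eq_fun do rewrite scalerDl addrA.
    exact: DeriveDef.
  by move=> /(is_derive_shift (F := fun u => pder l f (x + u *: dir R i)))[].
by move/derivable1_diffP/differentiable_continuous: dt.
Qed.

Variables (h : vec -> R) (i : 'I_d) (k : vec).
Hypothesis sm : all_partials_exist h.

(* A term (c, a, m) stands for c (d_i^a h)(xi) (xi_i - k_i)^m e^(-|xi - k|^2/2); the
   i-th derivative of such a term is a sum of three of them. *)
Definition term := (R * nat * nat)%type.
Local Notation Dh a := (pder (nseq a i) h).

Definition evt (q : term) xi : R :=
  q.1.1 * Dh q.1.2 xi * (xi ord0 i - k ord0 i) ^+ q.2 * gs 2^-1 k xi.
Definition dterm (q : term) : seq term :=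
  [:: (q.1.1, q.1.2.+1, q.2); (q.1.1 * q.2%:R, q.1.2, q.2.-1); (- q.1.1, q.1.2, q.2.+1)].
Definition dterms (T : seq term) := flatten (map dterm T).
Definition ev (T : seq term) xi : R := \sum_(q <- T) evt q xi.

Lemma is_derive_Dh a x :
  is_derive (0 : R) (1 : R) (fun t => Dh a (x + t *: dir R i)) (Dh a.+1 x).
Proof. by apply: DeriveDef; [exact: sm|rewrite /= derive1E]. Qed.

Lemma is_derive_pow (c : R) b : is_derive (0 : R) (1 : R) (fun t => (c + t) ^+ b) (b%:R * c ^+ b.-1).
Proof.
case: b => [|b].
  by rewrite mul0r; under eq_fun do rewrite expr0; exact: is_derive_cst.
have -> : (fun t : R => (c + t) ^+ b.+1) = (fun t : R => c + t) ^+ b.+1.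
  by rewrite exprfctE.
have d1 : is_derive (0 : R) (1 : R) (fun t : R => c + t) 1.
  by have := is_deriveD (is_derive_cst c (0 : R) (1 : R)) (is_derive_id (0 : R) (1 : R)); rewrite add0r.
by apply: is_derive_eq; rewrite /GRing.scale /= addr0 mulr1.
Qed.

Lemma is_derive_evt q x :
  is_derive (0 : R) (1 : R) (fun t => evt q (x + t *: dir R i)) (ev (dterm q) x).
Proof.
rewrite /ev !big_cons big_nil addr0 /evt /=.
have dg := is_derive_gs 2^-1 k x i; have dh := is_derive_Dh q.1.2 x.
rewrite /= in dh.
have dp := is_derive_pow (x ord0 i - k ord0 i) q.2.
have -> : (fun t : R => q.1.1 * Dh q.1.2 (x + t *: dir R i) *
    ((x + t *: dir R i) ord0 i - k ord0 i) ^+ q.2 * gs 2^-1 k (x + t *: dir R i)) =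
  (fun t : R => q.1.1 * Dh q.1.2 (x + t *: dir R i) *
    ((x ord0 i - k ord0 i) + t) ^+ q.2 * gs 2^-1 k (x + t *: dir R i)).
  apply/funext => t; congr (_ * _ ^+ _ * _); rewrite !mxE eqxx /= mulr1; ring.
have x0 : x + 0 *: dir R i = x by rewrite scale0r addr0.
apply: is_derive_eq; rewrite x0 addr0 /GRing.scale /= !mxE exprS.
by field.
Qed.

Lemma is_derive_ev T x :
  is_derive (0 : R) (1 : R) (fun t => ev T (x + t *: dir R i)) (ev (dterms T) x).
Proof.
elim: T => [|q T IH].
  by rewrite /ev big_nil; under eq_fun do rewrite big_nil; exact: is_derive_cst.
have -> : dterms (q :: T) = dterm q ++ dterms T by [].
rewrite /ev big_cat /=; under eq_fun do rewrite big_cons.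
have dq := is_derive_evt q x; exact: is_deriveD.
Qed.

Lemma vmeas_evt q : vmeas (evt q).
Proof.
have mD : vmeas (Dh q.1.2).
  by apply: vmeas_sep => x j; exact: all_partials_continuous.
have mi : vmeas (fun xi => xi ord0 i - k ord0 i).
  by apply: vmeasD; [exact: vmeas_coord|exact: vmeas_cst].
rewrite /evt; apply: vmeasM; last exact: vmeas_gs.
apply: vmeasM; first by apply: vmeasM => //; exact: vmeas_cst.
apply: (@vmeas_comp _ _ (fun t => t ^+ q.2)) mi.
exact: exprn_measurable.
Qed.

Lemma vmeas_ev T : vmeas (ev T).
Proof. by apply: vmeas_sum => q; exact: vmeas_evt. Qed.

Lemma continuous_line f f' : (forall x, is_derive (0 : R) (1 : R) (fun t => f (x + t *: dir R i)) (f' x)) ->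
  forall x, continuous (fun t : R => f (x + t *: dir R i)).
Proof.
move=> df x t.
have : is_derive (0 : R) (1 : R) (fun u => f (x + (t + u) *: dir R i)) (f' (x + t *: dir R i)).
  by under eq_fun do rewrite scalerDl addrA; exact: df.
move=> /(is_derive_shift (F := fun u => f (x + u *: dir R i)))[].
by move/derivable1_diffP/differentiable_continuous.
Qed.

Variables (J : vec) (C0 : R).
Hypothesis C00 : 0 <= C0.
Hypothesis supp : forall a x, C0 <= normv (x - J) -> Dh a x = 0.

(** On the ball |xi - J| < C0, e^(-|xi - k|^2/4) is at most [spread] times e^(-|xi - J|^2). *)
Definition spread := expR (C0 ^+ 2 * 2) * expR (- (8^-1 * dotv (J - k) (J - k))).

(** Half of the Gaussian around k absorbs the polynomial factor. The other half, on the support of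
    the bump, becomes [spread] times a Gaussian around J, which stands in for compact support in the
    class [gdom]. *)
Lemma evt_bound q M C : (forall x, `|Dh q.1.2 x| <= M) ->
  (forall t, 0 <= t -> (1 + t) `^ q.2.+1%:R <= C * expR (4^-1 * t ^+ 2)) -> 0 <= C ->
  forall xi, `|evt q xi| <= `|q.1.1| * M * C * (spread * gs 1 J xi).
Proof.
move=> hM hC C0' xi.
have M0 : 0 <= M by apply: le_trans (hM 0).
have [far|near] := leP C0 (normv (xi - J)).
  rewrite /evt supp// mulr0 !mul0r normr0; apply: mulr_ge0; first by rewrite !mulr_ge0.
  by apply: mulr_ge0; [apply: mulr_ge0; exact: expR_ge0|exact: gs_ge0].
rewrite /evt !normrM (ger0_norm (gs_ge0 _ _ _)) -!mulrA ler_wpM2l//.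
rewrite ler_pM// ?mulr_ge0 ?gs_ge0//.
set V := normv (xi - k).
have V0 : 0 <= V by exact: normv_ge0.
apply: (@le_trans _ _ (C * expR (4^-1 * V ^+ 2) * gs 2^-1 k xi)).
  rewrite ler_wpM2r ?gs_ge0//; apply: le_trans (hC V V0).
  rewrite powR_mulrn ?addr_ge0// normrX.
  have -> : xi ord0 i - k ord0 i = (xi - k) ord0 i by rewrite !mxE.
  apply: (@le_trans _ _ ((1 + V) ^+ q.2)).
    rewrite lerXn2r ?nnegrE ?addr_ge0//.
    by apply: le_trans (normv_coord _ _) _; rewrite -/V lerDr.
  by rewrite exprS ler_peMl ?exprn_ge0 ?addr_ge0// lerDl.
rewrite -mulrA ler_wpM2l// /spread /gs -!expRD ler_expR /V normv_sqr.
have h1 := dotv_sqr_dist J xi k.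
have h2 : dotv (xi - J) (xi - J) <= C0 ^+ 2.
  by rewrite -normv_sqr lerXn2r ?nnegrE ?normv_ge0// ltW.
have h3 : dotv (J - xi) (J - xi) = dotv (xi - J) (xi - J).
  by rewrite -opprB dotvNl dotvNr opprK.
have h4 := sqr_ge0 C0.
move: h1; rewrite h3 => h1; lra.
Qed.

Lemma spread_ge0 : 0 <= spread.
Proof. by rewrite /spread mulr_ge0 ?expR_ge0. Qed.

(** The derivative of cos(xi.x + th + pi/2) in xi_i is -x_i cos(xi.x + th). Encoding it as a phase
    shift keeps the shape of the integral, so the step can be iterated. *)
Lemma ibp_step T x th K K' :
  (forall xi, `|ev T xi| <= K * gs 1 J xi) -> (forall xi, `|ev (dterms T) xi| <= K' * gs 1 J xi) ->
  x ord0 i * integralv (fun xi => ev T xi * cos (dotv xi x + th)) =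
  integralv (fun xi => ev (dterms T) xi * cos (dotv xi x + (th + pi / 2))).
Proof.
move=> hK hK'.
have K0 : 0 <= K.
  by have := le_trans (normr_ge0 _) (hK J); rewrite pmulr_lge0// gs_gt0.
have gT : gdom (ev T) by apply: gdom_le (vmeas_ev T) ltr01 hK.
have gT' : gdom (ev (dterms T)) by apply: gdom_le (vmeas_ev _) ltr01 hK'.
have cosb t : `|cos t| <= 1 :> R by rewrite ler_norml cos_geN1 cos_le1.
have mc ph : vmeas (fun xi => cos (dotv xi x + ph)) by apply: vmeas_trig; exact: continuous_cos.
have g1' : gdom (fun xi => ev T xi * cos (dotv xi x + th)).
  by apply: gdomM gT (mc th) (fun xi => cosb _).
have g2' : gdom (fun xi => ev (dterms T) xi * cos (dotv xi x + (th + pi / 2))).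
  by apply: gdomM gT' (mc _) (fun xi => cosb _).
have g3 : gdom (fun xi => x ord0 i * (ev T xi * cos (dotv xi x + th))) by exact: gdomZ.
have E0 : integralv (fun xi => ev (dterms T) xi * cos (dotv xi x + (th + pi / 2)) -
    x ord0 i * (ev T xi * cos (dotv xi x + th))) = 0.
  apply: (@integralv_ibp _ _ i (fun xi => ev T xi * cos (dotv xi x + (th + pi / 2))) _ 1 J K) => //.
  - move=> xi; have dT := is_derive_ev T xi.
    have -> : (fun t : R => ev T (xi + t *: dir R i) * cos (dotv (xi + t *: dir R i) x + (th + pi / 2))) =
       (fun t : R => ev T (xi + t *: dir R i) * cos ((dotv xi x + t * x ord0 i) + (th + pi / 2))).
      by apply/funext => t; rewrite dotvDl dotvZl (dotvC (dir R i)) dotv_dirr.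
    have x0 : xi + 0 *: dir R i = xi by rewrite scale0r addr0.
    apply: is_derive_eq; rewrite x0 /GRing.scale /= !mul0r !addr0.
    by rewrite !addrA sinDpihalf; ring.
  - move=> xi; have cl : continuous (fun t : R => dotv (xi + t *: dir R i) x).
      have -> : (fun t : R => dotv (xi + t *: dir R i) x) = (fun t : R => dotv xi x + t * x ord0 i).
        by apply/funext => u; rewrite dotvDl dotvZl (dotvC (dir R i)) dotv_dirr.
      by move=> t; apply: cvgD; [exact: cvg_cst|apply: cvgMl; exact: cvg_id].
    have cc ph : continuous (fun t : R => cos (dotv (xi + t *: dir R i) x + ph)).
      move=> t; apply: continuous_comp; last exact: continuous_cos.
      by apply: cvgD; [exact: cl|exact: cvg_cst].
    have c1 := @continuous_line (ev T) _ (is_derive_ev T) xi.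
    have c2 := @continuous_line (ev (dterms T)) _ (is_derive_ev (dterms T)) xi.
    move=> t; apply: (@cvgB _ R^o _ _ _ (fun t => ev (dterms T) (xi + t *: dir R i) * cos (dotv (xi + t *: dir R i) x + (th + pi / 2)))
      (fun t => x ord0 i * (ev T (xi + t *: dir R i) * cos (dotv (xi + t *: dir R i) x + th)))).
      by apply: (@cvgM _ _ _ _ (fun t => ev (dterms T) (xi + t *: dir R i))); [exact: c2|exact: cc].
    apply: cvgMr; apply: (@cvgM _ _ _ _ (fun t => ev T (xi + t *: dir R i))); [exact: c1|exact: cc].
  - move=> xi; rewrite normrM; apply: le_trans (hK xi).
    by rewrite ler_piMr.
  - have := gdomD g2' (gdomZ (-1) g3).
    by under eq_fun do rewrite mulN1r.
move: E0; rewrite integralvB// integralvZ// => /eqP; rewrite subr_eq0 => /eqP ->.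
by [].
Qed.

End BumpDecay.

Section BoxBound.
Variables (R : realType) (d : nat).
Local Notation vec := (Defs.vec R d).
Implicit Types (x y z v xi k J : vec) (h : vec -> R).

(** The order of quantifiers is the point: K serves for all bumps, directions and centres at once,
    as needed to sum over boxes and Gaussians. *)
Lemma ev_bound_uniform (C0 : R) (M : nat -> R) (T : seq (term R)) : (forall a, 0 <= M a) -> 0 <= C0 ->
  exists2 K, 0 <= K & forall h i k J,
    (forall a x, C0 <= normv (x - J) -> pder (nseq a i) h x = 0) ->
    (forall a x, `|pder (nseq a i) h x| <= M a) ->
    forall xi, `|ev h i k T xi| <= K * (spread k J C0 * gs 1 J xi).
Proof.
move=> M0 C00; elim: T => [|q T [K K0 IH]].
  by exists 0 => // h i k J _ _ xi; rewrite /ev big_nil normr0 mul0r.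
have [||C C1 HC] := @powR_1D_le R q.2.+1%:R 4^-1; [by []|by rewrite invr_gt0|].
have C0' : 0 <= C by lra.
exists (`|q.1.1| * M q.1.2 * C + K).
  by rewrite addr_ge0// !mulr_ge0.
move=> h i k J supp hM xi; rewrite /ev big_cons.
apply: le_trans (ler_normD _ _) _; rewrite mulrDl lerD//; last exact: IH.
by apply: evt_bound => //; exact: hM.
Qed.

(** m integrations by parts in the variable xi_i, each shifting the phase by pi/2. The Gaussian
    factor in J - k expresses that a box far from k hardly sees the Gaussian around k. *)
Lemma integralv_decay (C0 : R) (M : nat -> R) (m : nat) : (forall a, 0 <= M a) -> 0 <= C0 ->
  exists2 K, 0 <= K & forall h i k J,
    all_partials_exist h ->
    (forall a x, C0 <= normv (x - J) -> pder (nseq a i) h x = 0) ->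
    (forall a x, `|pder (nseq a i) h x| <= M a) ->
    forall x th, `|x ord0 i| ^+ m * `|integralv (fun xi => h xi * gs 2^-1 k xi * cos (dotv xi x + th))|
      <= K * expR (- (8^-1 * dotv (J - k) (J - k))).
Proof.
move=> M0 C00.
pose T n : seq (term R) := iter n (@dterms R) [:: (1, 0%N, 0%N)].
have [K K0 HK] := ev_bound_uniform (T m) M0 C00.
exists (K * expR (C0 ^+ 2 * 2) * Num.sqrt (pi / 1) ^+ d).
  by rewrite !mulr_ge0 ?expR_ge0 ?exprn_ge0 ?sqrtr_ge0.
move=> h i k J sm supp hM x th.
have evb n : exists2 K, 0 <= K & forall xi, `|ev h i k (T n) xi| <= K * gs 1 J xi.
  have [K' K'0 HK'] := ev_bound_uniform (T n) M0 C00.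
  exists (K' * spread k J C0); first by rewrite mulr_ge0 ?spread_ge0.
  by move=> xi; rewrite -mulrA; exact: HK'.
have step n : `|x ord0 i| ^+ n * `|integralv (fun xi => ev h i k (T 0) xi * cos (dotv xi x + th))| =
    `|integralv (fun xi => ev h i k (T n) xi * cos (dotv xi x + (th + n%:R * (pi / 2))))|.
  elim: n => [|n IH]; first by rewrite expr0 mul1r mul0r addr0.
  rewrite exprS -mulrA IH -normrM.
  have [K1 _ h1] := evb n; have [K2 _ h2] := evb n.+1.
  rewrite (ibp_step sm x _ h1 h2).
  by rewrite (_ : th + n.+1%:R * (pi / 2) = th + n%:R * (pi / 2) + pi / 2)// -[n.+1%:R]natr1; ring.
have T0 : integralv (fun xi => h xi * gs 2^-1 k xi * cos (dotv xi x + th)) =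
    integralv (fun xi => ev h i k (T 0) xi * cos (dotv xi x + th)).
  by apply: integralv_eq => xi; rewrite /ev big_seq1 /evt /= mul1r expr0 mulr1.
rewrite T0 step.
set ph := th + _.
have cosb t : `|cos t| <= 1 :> R by rewrite ler_norml cos_geN1 cos_le1.
have [K1 K10 h1] := evb m.
have gT : gdom (ev h i k (T m)) by apply: gdom_le (vmeas_ev _ _ sm _) ltr01 h1.
have gTc : gdom (fun xi => ev h i k (T m) xi * cos (dotv xi x + ph)).
  by apply: gdomM gT _ (fun xi => cosb _); apply: vmeas_trig; exact: continuous_cos.
apply: le_trans (normr_integralv gTc) _.
apply: (@le_trans _ _ (integralv (fun xi => (K * spread k J C0) * gs 1 J xi))).
  apply: integralv_le; first exact: gdom_norm.
    by apply: gdomZ; exact: gdom_gs.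
  move=> xi; rewrite normrM -mulrA; apply: le_trans (HK h i k J supp hM xi).
  by rewrite ler_piMr.
rewrite integralvZ; last exact: gdom_gs.
rewrite integralv_gs// /spread le_eqVlt; apply/orP; left; apply/eqP; ring.
Qed.

(** On an open set where h vanishes, difference quotients with small increments vanish too. Thus the
    derivatives of a bump inherit its support. *)
Lemma pder_supp h (U : set vec) : open U -> (forall x, U x -> h x = 0) ->
  forall l x, U x -> pder l h x = 0.
Proof.
move=> oU hU; elim=> [|i l IH] x Ux /=; first exact: hU.
rewrite derive1E.
have nU : \forall t \near (0 : R), pder l h (x + t *: dir R i) = cst 0 t.
  have cx : (fun t : R => x + t *: dir R i) t @[t --> (0 : R)] --> x.
    rewrite -[X in _ --> X](_ : x + 0 *: dir R i = x); last by rewrite scale0r addr0.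
    by apply: cvgD; [exact: cvg_cst|apply: cvgZl; exact: cvg_id].
  have : \forall y \near x, U y by exact: open_nbhs_nbhs.
  move/cx; rewrite near_simpl => nU; near=> t.
  by apply: IH; near: t.
rewrite (near_eq_derive (g := cst 0)); [exact: derive_cst|exact: nU].
Unshelve. all: by end_near. Qed.

End BoxBound.

Section BoxBound2.
Variables (R : realType) (d : nat) (eta : 'rV[int]_d -> 'rV[R]_d -> R[i]).
Local Notation vec := (Defs.vec R d).
Implicit Types (x y z v xi : vec).
Hypothesis d0 : (0 < d)%N.
Hypothesis eta_bapu : bapu eta.

Definition bump (j : 'rV[int]_d) (c : bool) (xi : vec) : R :=
  if c then complex.Re (eta j xi) else complex.Im (eta j xi).

Lemma bump_smooth j c : all_partials_exist (bump j c).
Proof. by have [sm _] := eta_bapu; have [h1 [h2 _]] := sm j; case: c. Qed.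

Lemma bump_consts : exists2 C0 : R, 0 <= C0 & exists2 M : nat -> R, (forall a, 0 <= M a) &
  forall j c i, (forall a x, C0 <= normv (x - Defs.intv R j) -> pder (nseq a i) (bump j c) x = 0) /\
    (forall a x, `|pder (nseq a i) (bump j c) x| <= M a).
Proof.
have [_ [_ [[C0 hC] [_ hM]]]] := eta_bapu.
have [Mf HMf] := choice hM.
exists `|C0|; first exact: normr_ge0.
exists (fun a => \sum_(i < d) `|Mf (nseq a i)|); first by move=> a; exact: sumr_ge0.
move=> j c i; split => [a x xC|a x].
  apply: (@pder_supp _ _ _ (~` closure [set xi | eta j xi != 0])).
  - by apply: closed_openC; exact: closed_closure.
  - move=> y Uy; have e0 : eta j y = 0.
      by apply/eqP; apply: contra_notT Uy => e0; exact: subset_closure.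
    by rewrite /bump e0; case: c.
  - by move=> /(hC j) /=; apply/negP; rewrite -leNgt; apply: le_trans xC; exact: ler_norm.
apply: (@le_trans _ _ `|Mf (nseq a i)|); last first.
  by rewrite (bigD1 i)//= lerDl sumr_ge0.
apply: le_trans (ler_norm _); apply: le_trans (HMf (nseq a i) j x).
by rewrite /bump; case: c; rewrite ?lerDl ?lerDr.
Qed.

Definition spreadw (k : vec) (j : 'rV[int]_d) : R :=
  expR (- (8^-1 * dotv (Defs.intv R j - k) (Defs.intv R j - k))).

(** The decay estimate is used with 0 and with 2d integrations by parts, the two inputs of
    [prod_weight_le]. *)
Lemma bump_integral_bound : exists2 K : R, 0 <= K & forall j c k x th,
  `|integralv (fun xi => bump j c xi * gs 2^-1 k xi * cos (dotv xi x + th))|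
     * \prod_(i < d) (1 + x ord0 i ^+ 2) <= K * spreadw k j.
Proof.
have [C0 C00 [M M0 H]] := bump_consts.
have [K K0 HK] := integralv_decay d 0 M0 C00.
have [K' K'0 HK'] := integralv_decay d (2 * d) M0 C00.
exists (2 ^+ d * (K + K')); first by rewrite mulr_ge0 ?exprn_ge0 ?addr_ge0.
move=> j c k x th; rewrite -mulrA; apply: prod_weight_le => //.
  have i0 : 'I_d by exact: Ordinal d0.
  have [H1 H2] := H j c i0.
  have := HK _ i0 k _ (@bump_smooth j c) H1 H2 x th; rewrite expr0 mul1r => h.
  by apply: le_trans h _; rewrite ler_wpM2r ?expR_ge0// lerDl.
move=> i; have [H1 H2] := H j c i.
apply: le_trans (HK' _ i k _ (@bump_smooth j c) H1 H2 x th) _.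
by rewrite ler_wpM2r ?expR_ge0// lerDr.
Qed.

Lemma vmeas_bump j c : vmeas (bump j c).
Proof.
by apply: vmeas_sep => x i; exact: (@all_partials_continuous R d (bump j c) [::] i x (@bump_smooth j c)).
Qed.

Lemma gdom_bump j c k x th : gdom (fun xi => bump j c xi * gs 2^-1 k xi * cos (dotv xi x + th)).
Proof.
have [C0 C00 [M M0 H]] := bump_consts.
have i0 : 'I_d by exact: Ordinal d0.
have [_ H2] := H j c i0.
apply: (@gdom_le _ _ _ 2^-1 k (M 0)); rewrite ?invr_gt0//.
  apply: vmeasM; last by apply: vmeas_trig; exact: continuous_cos.
  by apply: vmeasM; [exact: vmeas_bump|exact: vmeas_gs].
move=> xi; rewrite !normrM (ger0_norm (gs_ge0 _ _ _)).
rewrite -[leRHS]mulr1 ler_pM ?mulr_ge0 ?gs_ge0//; last by rewrite ler_norml cos_geN1 cos_le1.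
by rewrite ler_wpM2r ?gs_ge0//; exact: (H2 0).
Qed.

Definition weight x : R := \prod_(i < d) (1 + x ord0 i ^+ 2)^-1.

Lemma weight_gt0 x : 0 < weight x.
Proof. by apply: prodr_gt0 => i _; rewrite invr_gt0 ltr_pwDl ?sqr_ge0. Qed.

Lemma cabs_le (z : R[i]) : cabs z <= `|complex.Re z| + `|complex.Im z|.
Proof.
case: z => a b; rewrite /cabs /= -(@ler_pXn2r _ 2)// ?nnegrE ?sqrtr_ge0 ?addr_ge0//.
rewrite sqr_sqrtr ?addr_ge0 ?sqr_ge0// sqrrD !real_normK ?num_real//.
by have := mulr_ge0 (normr_ge0 a) (normr_ge0 b); rewrite mulr2n; lra.
Qed.

Lemma box_bound : exists2 K : R, 0 <= K & forall j N n x,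
  cabs (box eta j (@testu R d N n) x) <=
  K * (\sum_(k : {ffun 'I_d -> 'I_n}) spreadw (kv R N k) j) * weight x.
Proof.
have [K K0 HK] := bump_integral_bound.
exists ((2 * pi) ^- d * (G0 R d * (4 * K))).
  apply: mulr_ge0; first by rewrite invr_ge0 exprn_ge0// mulr_ge0 ?pi_ge0.
  by apply: mulr_ge0; [exact: ltW (G0_gt0 R d)|rewrite mulr_ge0].
move=> j N n x; pose I c (k : {ffun 'I_d -> 'I_n}) th :=
  integralv (fun xi => bump j c xi * gs 2^-1 (kv R N k) xi * cos (dotv xi x + th)).
have IB c k th : `|I c k th| <= K * spreadw (kv R N k) j * weight x.
  have w0 := weight_gt0 x.
  rewrite -ler_pdivrMr// /weight -prodfV; under eq_bigr do rewrite invrK.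
  exact: HK.
(* The real and the imaginary part of the integrand are both of this form, a combination of two
   cosine terms: a sine is a cosine with phase -pi/2, and s = -1 or 1 is the sign in the complex
   product. *)
pose F c c' th th' s (k : {ffun 'I_d -> 'I_n}) xi : R :=
  G0 R d * (bump j c xi * gs 2^-1 (kv R N k) xi * cos (dotv xi x + th)
   + s * (bump j c' xi * gs 2^-1 (kv R N k) xi * cos (dotv xi x + th'))).
have gF c c' th th' s k : gdom (F c c' th th' s k).
  by apply: gdomZ; apply: gdomD; [|apply: gdomZ]; exact: gdom_bump.
have iF c c' th th' s k : integralv (F c c' th th' s k) = G0 R d * (I c k th + s * I c' k th').
  rewrite integralvZ; last by apply: gdomD; [|apply: gdomZ]; exact: gdom_bump.
  rewrite integralvD; [|exact: gdom_bump|by apply: gdomZ; exact: gdom_bump].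
  by rewrite integralvZ//; exact: gdom_bump.
have bF c c' th th' s : `|s| = 1 ->
    `|integralv (fun xi => \sum_k F c c' th th' s k xi)| <=
     G0 R d * (2 * K) * (\sum_(k : {ffun 'I_d -> 'I_n}) spreadw (kv R N k) j) * weight x.
  move=> s1; rewrite integralv_sumE//.
  apply: le_trans (ler_norm_sum _ _ _) _.
  rewrite mulr_sumr mulr_suml; apply: ler_sum => k _; rewrite iF normrM.
  rewrite (ger0_norm (ltW (G0_gt0 R d))) -!mulrA ler_wpM2l ?(ltW (G0_gt0 R d))//.
  apply: le_trans (ler_normD _ _) _; rewrite normrM s1 mul1r.
  by rewrite mulr2n mulrDl mul1r !mulrA lerD.
have reE xi : complex.Re (eta j xi * fourier (@testu R d N n) xi * cexpi (dotv x xi)) =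
    \sum_k F true false 0 (- (pi / 2)) (-1) k xi.
  rewrite fourier_testu /F /bump (dotvC x xi); case: (eta j xi) => a b /=.
  rewrite addr0 cosBpihalf /uhat !mulr0 subr0 add0r.
  rewrite -mulrA -[X in _ - X]mulrA mulrCA [X in _ - X]mulrCA -mulrBr mulr_suml.
  by apply: eq_bigr => k _; ring.
have imE xi : complex.Im (eta j xi * fourier (@testu R d N n) xi * cexpi (dotv x xi)) =
    \sum_k F true false (- (pi / 2)) 0 1 k xi.
  rewrite fourier_testu /F /bump (dotvC x xi); case: (eta j xi) => a b /=.
  rewrite addr0 cosBpihalf /uhat !mulr0 subr0 add0r.
  rewrite -mulrA -[X in _ + X]mulrA mulrCA [X in _ + X]mulrCA -mulrDr mulr_suml.
  by apply: eq_bigr => k _; ring.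
rewrite /box /ifourier cint_gdom; last 2 first.
- by rewrite (funext reE); apply: gdom_sum => k; exact: gF.
- by rewrite (funext imE); apply: gdom_sum => k; exact: gF.
rewrite (funext reE) (funext imE).
apply: le_trans (cabs_le _) _; rewrite /= !mul0r subr0 addr0 !normrM.
have c0 : 0 <= (2 * pi) ^- d :> R by rewrite invr_ge0 exprn_ge0// mulr_ge0 ?pi_ge0.
rewrite (ger0_norm c0) -mulrDr -!mulrA ler_wpM2l//.
have h1 := bF true false 0 (- (pi / 2)) (-1).
have h2 := bF true false (- (pi / 2)) 0 1.
rewrite normrN normr1 in h1; rewrite normr1 in h2.
apply: le_trans (lerD (h1 erefl) (h2 erefl)) _.
by rewrite le_eqVlt; apply/orP; left; apply/eqP; ring.
Qed.

End BoxBound2.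

(** * Lp norms of the boxes and their sum *)

Section LpWeight.
Variables (R : realType) (d : nat).
Local Notation vec := (Defs.vec R d).
Local Notation leb := (@lebesgue_measure R).
Implicit Types (x y z v xi : vec).

Lemma integral_oneDsqrV : (\int[leb]_x ((oneDsqr x)^-1)%:E = (pi : R)%:E)%E.
Proof.
rewrite ge0_symfun_integralT.
- rewrite -set_itvcy integral0y_oneDsqr -EFinM; congr EFin; by field.
- by move=> x; rewrite invr_ge0 (le_trans ler01)// oneDsqr_ge1.
- exact: continuous_oneDsqrV.
- by move=> x /=; rewrite /oneDsqr sqrrN.
Qed.

Lemma intRd_weight (k : R) : 0 <= k -> intRd (fun x : vec => (k * weight x)%:E) = (k * pi ^+ d)%:E.
Proof.
move=> k0.
have := iint_prodS d (f := fun _ t => (oneDsqr t)^-1) (c := fun=> pi) k0.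
rewrite prodr_const card_ord => <-//.
- apply: iint_eq => s sd; congr (_ * _)%:E.
  by rewrite prodSE sd; apply: eq_bigr => i _; rewrite !mxE.
- by move=> _ /=; rewrite pi_ge0.
- by move=> _; apply: continuous_measurable_fun; exact: continuous_oneDsqrV.
- by move=> _; exact: integral_oneDsqrV.
Qed.

Lemma weight_le1 x : weight x <= 1.
Proof.
apply: prodr_ile1 => i _; rewrite invr_ge0 addr_ge0 ?sqr_ge0//=.
by rewrite invf_le1 ?lerDl ?sqr_ge0// ltr_pwDl ?sqr_ge0.
Qed.

Lemma le_poweR (x y : \bar R) (r : R) : 0 <= r -> (0 <= x)%E -> (x <= y)%E -> (poweR x r <= poweR y r)%E.
Proof.
move=> r0 x0 xy; apply: gt0_ler_poweR => //; rewrite in_itv /= ?leey ?andbT//.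
exact: le_trans xy.
Qed.

Lemma einv_bound (p : \bar R) : (1 <= p)%E -> 0 <= einv p <= 1.
Proof.
case: p => [r| |]//; rewrite /einv ?lexx ?ler01// lee_fin => r1.
by rewrite invr_ge0 (le_trans ler01)//= invf_le1// (lt_le_trans ltr01).
Qed.

(** As 0 < [weight] <= 1, its r-th power lies below it and has integral at most pi^d. The maximum
    with 1 bounds pi^(d/r) for all r >= 1 and also covers p = oo. *)
Lemma LpRd_weight (p : \bar R) (f : vec -> R[i]) (B : R) : (1 <= p)%E -> 0 <= B ->
  (forall x, cabs (f x) <= B * weight x) -> (LpRd p f <= (B * Num.max 1 (pi ^+ d))%:E)%E.
Proof.
move=> p1 B0 fB; have c0 x : 0 <= cabs (f x) by exact: sqrtr_ge0.
have w0 x : 0 < weight x by exact: weight_gt0.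
have M1 : 1 <= Num.max 1 (pi ^+ d) :> R by rewrite le_max lexx.
case: p p1 => [r r1| _|//]; last first.
  rewrite /LpRd /Lp_of; apply: ereal_inf_lbound => /=.
  rewrite (_ : (fun x => _) = (fun=> 0%E)).
    by rewrite /intRd; elim: (d) => //= n ->; rewrite integral0.
  apply/funext => x; rewrite ifF//; apply/negbTE; rewrite -leNgt lee_fin ger0_norm//.
  apply: le_trans (fB x) _; rewrite ler_wpM2l//.
  by apply: le_trans (weight_le1 x) _.
rewrite lee_fin in r1; have r0 : 0 < r by exact: lt_le_trans r1.
have pd : 0 <= pi ^+ d :> R by rewrite exprn_ge0// pi_ge0.
rewrite /LpRd /Lp_of.
apply: (@le_trans _ _ (poweR (B `^ r * pi ^+ d)%:E r^-1)).
  apply: le_poweR; first by rewrite invr_ge0 ltW.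
    by apply: iint_ge0 => s; rewrite lee_fin powR_ge0.
  rewrite -intRd_weight ?powR_ge0//; apply: intRd_le => x; rewrite lee_fin ?powR_ge0//.
  rewrite ger0_norm//; apply: (@le_trans _ _ ((B * weight x) `^ r)).
    by apply: ge0_ler_powR; rewrite ?nnegrE ?mulr_ge0// ltW.
  rewrite powRM// ?(ltW (w0 x))// ler_wpM2l ?powR_ge0//.
  by apply: ge1r_powR => //; rewrite w0 weight_le1.
rewrite poweR_EFin lee_fin powRM ?powR_ge0// -powRrM mulfV ?gt_eqF// powRr1//.
rewrite ler_wpM2l// le_max; have [h|h] := leP 1 (pi ^+ d : R).
  by rewrite ler1_powR ?orbT// invf_le1.
have := @ge0_ler_powR R r^-1; rewrite invr_ge0 => /(_ (ltW r0) (pi ^+ d) 1).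
by rewrite !nnegrE pd ler01 powR1 => -> //; exact: ltW.
Qed.

End LpWeight.

Section ModUpper.
Variables (R : realType) (d : nat).
Local Notation vec := (Defs.vec R d).
Implicit Types (x y z v xi : vec).

Lemma jbr_gt0 x : 0 < jbr x. Proof. exact: lt_le_trans (jbr_ge1 x). Qed.

Lemma jbrD x y : jbr (x + y) <= 2 * jbr x * jbr y.
Proof.
have jx := jbr_ge1 x; have jy := jbr_ge1 y.
rewrite -(@ler_pXn2r _ 2)// ?nnegrE ?mulr_ge0 ?sqrtr_ge0//.
have s z : jbr z ^+ 2 = 1 + dotv z z by rewrite sqr_sqrtr// addr_ge0 ?dotvv_ge0.
rewrite !exprMn !s; have := dotvv_ge0 (x - y).
rewrite !(dotvDl, dotvDr, dotvNl, dotvNr) (dotvC y x).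
have := dotvv_ge0 x; have := dotvv_ge0 y.
move: (dotv x x) (dotv y y) (dotv x y) => p q r; nra.
Qed.

Lemma powR_neg_inv (t s : R) : 0 <= t -> t `^ (- s) = t^-1 `^ s.
Proof. by move=> t0; rewrite -powR_inv1// -powRrM mulN1r. Qed.

(** Two-sided comparability of a and b gives one bound for both signs of s. *)
Lemma powR_ratio (a b c s : R) : 0 < a -> 0 < b -> 1 <= c -> a <= c * b -> b <= c * a ->
  a `^ s <= c `^ `|s| * b `^ s.
Proof.
move=> a0 b0 c1 ab ba; have c0 : 0 < c by exact: lt_le_trans c1.
have [s0|s0] := leP 0 s.
  rewrite ger0_norm// -powRM ?(ltW c0) ?(ltW b0)//.
  by apply: ge0_ler_powR; rewrite ?nnegrE ?mulr_ge0// ltW.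
rewrite ltr0_norm//; have : 0 < - s by rewrite oppr_gt0.
move: (- s) (opprK s) => t <- t0 {s s0}.
rewrite !(powR_neg_inv t) ?(ltW a0) ?(ltW b0)//.
rewrite -powRM ?(ltW c0) ?invr_ge0 ?(ltW b0)//.
apply: ge0_ler_powR; rewrite ?nnegrE ?mulr_ge0 ?invr_ge0 ?(ltW a0) ?(ltW b0) ?(ltW c0) ?(ltW t0)//.
by rewrite -[leLHS]mul1r ler_pdivrMr// mulrAC ler_pdivlMr// mul1r.
Qed.

(** Peetre's inequality, with the power of the bracket of y - x absorbed by a growing Gaussian. The
    rate 1/16 is half of the decay rate 1/8 in [spreadw], so a factor [spread16], summable over the
    boxes, is left. *)
Lemma jbr_powR_le (s : R) : exists2 K : R, 0 <= K & forall x y,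
  jbr y `^ s <= K * jbr x `^ s * expR (16^-1 * dotv (y - x) (y - x)).
Proof.
have [||C C1 HC] := @powR_1D_le R (`|s| + 1) 16^-1; [by rewrite ltr_pwDr|by rewrite invr_gt0|].
exists (2 `^ `|s| * C); first by rewrite mulr_ge0 ?powR_ge0//; lra.
move=> x y; have j1 := jbr_ge1 (y - x); have n0 := normv_ge0 (y - x).
have h1 : jbr y <= 2 * jbr (y - x) * jbr x.
  by have := jbrD (y - x) x; rewrite subrK.
have h2 : jbr x <= 2 * jbr (y - x) * jbr y.
  have := jbrD (x - y) y; rewrite subrK => h; apply: le_trans h _.
  by rewrite /jbr -(opprB y x) dotvNl dotvNr opprK.
have c1 : 1 <= 2 * jbr (y - x) by lra.
apply: le_trans (powR_ratio s (jbr_gt0 y) (jbr_gt0 x) c1 h1 h2) _.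
rewrite -[leRHS]mulrA [_ `^ s * _]mulrC [leRHS]mulrA ler_wpM2r ?powR_ge0//.
rewrite powRM ?sqrtr_ge0// -mulrA ler_wpM2l ?powR_ge0//.
rewrite -normv_sqr; apply: le_trans (HC _ n0).
apply: (@le_trans _ _ ((1 + normv (y - x)) `^ `|s|)).
  by apply: ge0_ler_powR; rewrite ?nnegrE ?sqrtr_ge0 ?addr_ge0 ?jbr_le.
by apply: ler_powR; [lra|rewrite lerDl].
Qed.

Lemma kv_coord N n (a : {ffun 'I_d -> 'I_n}) i : kv R N a ord0 i = N%:R + (a i)%:R.
Proof. by rewrite mxE natrD. Qed.

Lemma normv_kv_ge N n (a : {ffun 'I_d -> 'I_n}) : (0 < d)%N -> N%:R <= normv (kv R N a).
Proof.
move=> d0; apply: le_trans (normv_coord _ (Ordinal d0)); rewrite kv_coord.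
by rewrite ger0_norm ?addr_ge0// lerDl.
Qed.

Lemma dotv_le_max x (B : R) : (forall i, `|x ord0 i| <= B) -> dotv x x <= d%:R * B ^+ 2.
Proof.
move=> xB; apply: (@le_trans _ _ (\sum_(i < d) B ^+ 2)).
  apply: ler_sum => i _; rewrite -expr2 -[leLHS]real_normK ?num_real//.
  by rewrite lerXn2r ?nnegrE// (le_trans (normr_ge0 _) (xB i)).
by rewrite sumr_const card_ord mulr_natl.
Qed.

Lemma normv_le_max x (B : R) : 0 <= B -> (forall i, `|x ord0 i| <= B) -> normv x <= d%:R * B.
Proof.
move=> B0 xB; have [d0|d0] := posnP d.
  have z : d%:R = 0 :> R by rewrite d0.
  rewrite z mul0r; have := dotv_le_max xB; rewrite z mul0r -normv_sqr => h.
  by have := normv_ge0 x; nra.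
have d1 : 1 <= d%:R :> R by rewrite ler1n.
rewrite -(@ler_pXn2r _ 2)// ?nnegrE ?mulr_ge0 ?normv_ge0//.
rewrite normv_sqr exprMn; apply: le_trans (dotv_le_max xB) _.
by rewrite ler_wpM2r ?sqr_ge0// expr2 ler_peMl.
Qed.

Lemma normv_kv_le N n (a : {ffun 'I_d -> 'I_n}) : (n <= N)%N -> normv (kv R N a) <= d%:R * (2 * N%:R).
Proof.
move=> nN; apply: normv_le_max => [|i]; first by rewrite mulr_ge0.
rewrite kv_coord ger0_norm ?addr_ge0// mulr_natl mulr2n lerD2l ler_nat.
exact: leq_trans (ltnW (ltn_ord _)) nN.
Qed.

End ModUpper.

Section ModNorm.
Variables (R : realType) (d : nat) (eta : 'rV[int]_d -> 'rV[R]_d -> R[i]).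
Local Notation vec := (Defs.vec R d).
Implicit Types (x y z v xi k : vec) (j : 'rV[int]_d).
Hypothesis d0 : (0 < d)%N.
Hypothesis eta_bapu : bapu eta.

Definition spread16 k j : R := expR (- (16^-1 * dotv (Defs.intv R j - k) (Defs.intv R j - k))).

Definition lat N n j : R := \sum_(a : {ffun 'I_d -> 'I_n}) spread16 (kv R N a) j.

Lemma jbr_kv_le (s : R) : exists2 K : R, 0 <= K & forall N n (a : {ffun 'I_d -> 'I_n}),
  (0 < N)%N -> (n <= N)%N -> jbr (kv R N a) `^ s <= K * N%:R `^ s.
Proof.
exists ((1 + d%:R * 2) `^ `|s|); first exact: powR_ge0.
move=> N n a N0 nN; have N1 : 1 <= N%:R :> R by rewrite ler1n.
have dd : 0 <= d%:R :> R by [].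
have h1 := normv_kv_ge R N a d0; have h2 := normv_kv_le R a nN; have h3 := jbr_le (kv R N a).
have h4 : normv (kv R N a) <= jbr (kv R N a) by rewrite ler_wsqrtr// lerDr.
apply: powR_ratio; [exact: jbr_gt0|by rewrite ltr0n|lra| |].
  by apply: le_trans h3 _; nra.
have h5 := jbr_ge1 (kv R N a); apply: (@le_trans _ _ (jbr (kv R N a))); first lra.
by rewrite ler_peMl; lra.
Qed.

Local Notation B := (@lattice_const R 16^-1).

Lemma B_gt0 : 0 < B. Proof. by apply: lattice_const_gt0; rewrite invr_gt0. Qed.

Lemma spread16_prod k j : spread16 k j = \prod_(i < d) expR (- (16^-1 * ((j ord0 i)%:~R - k ord0 i) ^+ 2)).
Proof.
rewrite /spread16 /dotv mulr_sumr -sumrN expR_sum; apply: eq_bigr => i _.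
by rewrite !mxE expr2.
Qed.

Lemma lat_le N n j : lat N n j <= B ^+ d.
Proof.
have c0 : 0 < 16^-1 :> R by rewrite invr_gt0.
apply: le_trans (sum_gauss_ffun c0 n (fun i => (j ord0 i)%:~R - N%:R)).
apply: ler_sum => a _; rewrite spread16_prod le_eqVlt; apply/orP; left; apply/eqP.
by apply: eq_bigr => i _; rewrite kv_coord opprD addrA.
Qed.

Lemma lat_ge0 N n j : 0 <= lat N n j.
Proof. by apply: sumr_ge0 => a _; exact: expR_ge0. Qed.

(** Unordered sums are suprema over finite sets, so a bound uniform in the finite set F is what is
    needed. F lies in some cube [-L, L]^d, which is reindexed by natural numbers up to 2L in order
    to apply the lattice bound. *)
Lemma sum_spread16_le (F : seq 'rV[int]_d) k : uniq F -> \sum_(j <- F) spread16 k j <= B ^+ d.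
Proof.
move=> uF; have c0 : 0 < 16^-1 :> R by rewrite invr_gt0.
pose L := \max_(j <- F) \max_(i < d) `|j ord0 i|%N.
have Lj j i : j \in F -> (`|j ord0 i| <= L)%N.
  move=> jF; apply: (@leq_trans (\max_(i < d) `|j ord0 i|%N)).
    exact: (leq_bigmax (F := fun i => `|j ord0 i|%N)).
  exact: (leq_bigmax_seq (F := fun j => \max_(i < d) `|j ord0 i|%N)).
pose sh (a : {ffun 'I_d -> 'I_(2 * L).+1}) : 'rV[int]_d := \row_i ((a i)%:Z - L%:Z).
have shP j : j \in F -> exists a, sh a = j.
  move=> jF; exists [ffun i => inord `|j ord0 i + L%:Z|].
  apply/rowP => i; rewrite !mxE ffunE.
  have := Lj j i jF; move: (j ord0 i) => z zL.
  have zL0 : 0 <= z + L%:Z by lia.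
  rewrite inordK; first by rewrite gez0_abs// addrK.
  by lia.
apply: le_trans (sum_gauss_ffun c0 (2 * L).+1 (fun i => k ord0 i + L%:R)).
apply: (@le_trans _ _ (\sum_(a : {ffun 'I_d -> 'I_(2 * L).+1}) spread16 k (sh a))); last first.
  apply: ler_sum => a _; rewrite spread16_prod le_eqVlt; apply/orP; left; apply/eqP.
  apply: eq_bigr => i _; rewrite mxE intrB; congr (expR (- (_ * _))).
  by rewrite -!pmulrn; ring.
rewrite (eq_bigr (fun a => spread16 k (sh a))); last by [].
apply: (@le_trans _ _ (\sum_(j <- F) \sum_(a | sh a == j) spread16 k (sh a))).
  rewrite big_seq [leRHS]big_seq; apply: ler_sum => j jF; have [a aj] := shP j jF.
  rewrite (bigD1 a) ?aj//= lerDl; apply: sumr_ge0 => b _; exact: expR_ge0.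
rewrite (exchange_big_dep xpredT)//=; apply: ler_sum => a _.
rewrite -big_filter; have [aF|aF] := boolP (sh a \in F).
  rewrite (_ : [seq i <- F | sh a == i] = [:: sh a]) ?big_seq1//.
  have : [seq i <- F | pred1 (sh a) i] = [:: sh a] by rewrite filter_pred1_uniq.
  by move=> <-; apply: eq_filter => y /=; rewrite eq_sym.
rewrite (_ : [seq i <- F | sh a == i] = [::]) ?big_nil ?expR_ge0//.
apply/eqP; rewrite -size_eq0 size_filter -leqn0 leqNgt -has_count; apply/hasPn => y yF.
by apply: contraNneq aF => ->.
Qed.

Lemma sum_lat_le N n (F : seq 'rV[int]_d) : uniq F -> \sum_(j <- F) lat N n j <= (n ^ d)%:R * B ^+ d.
Proof.
move=> uF; rewrite exchange_big /=.
apply: (@le_trans _ _ (\sum_(a : {ffun 'I_d -> 'I_n}) B ^+ d)).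
  by apply: ler_sum => a _; exact: sum_spread16_le.
by rewrite sumr_const card_ffun !card_ord mulr_natl.
Qed.

Variables (s : R) (p q : \bar R).
Hypotheses (p1 : (1 <= p)%E) (q1 : (1 <= q)%E).

Lemma box_term_le : exists2 K : R, 0 < K & forall N n j, (0 < N)%N -> (n <= N)%N ->
  ((powR (jbr (Defs.intv R j)) s)%:E * LpRd p (box eta j (@testu R d N n)) <= (K * N%:R `^ s * lat N n j)%:E)%E.
Proof.
have [K K0 HK] := box_bound d0 eta_bapu.
have [K1 K10 HK1] := @jbr_powR_le R d s.
have [K2 K20 HK2] := jbr_kv_le s.
pose W := Num.max 1 (pi ^+ d) : R.
have W0 : 0 <= W by rewrite le_max ler01.
exists (1 + K1 * K2 * K * W); first by rewrite ltr_pwDl// !mulr_ge0.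
move=> N n j N0 nN.
set S := \sum_(k : {ffun 'I_d -> 'I_n}) spreadw (kv R N k) j.
have S0 : 0 <= S by apply: sumr_ge0 => a _; exact: expR_ge0.
have KS0 : 0 <= K * S by rewrite mulr_ge0.
have h1 : (LpRd p (box eta j (@testu R d N n)) <= (K * S * W)%:E)%E.
  by apply: LpRd_weight => // x; exact: HK.
have h2 : jbr (Defs.intv R j) `^ s * S <= K1 * K2 * N%:R `^ s * lat N n j.
  rewrite /lat !mulr_sumr; apply: ler_sum => a _.
  rewrite /spreadw /spread16.
  have := HK1 (kv R N a) (Defs.intv R j); set D := dotv _ _ => h3.
  have h4 := HK2 N n a N0 nN.
  apply: le_trans (ler_wpM2r (expR_ge0 _) h3) _.
  rewrite -!mulrA ler_wpM2l// -expRD.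
  have -> : 16^-1 * D + - (8^-1 * D) = - (16^-1 * D) by field.
  by rewrite mulrA ler_wpM2r ?expR_ge0.
apply: (@le_trans _ _ ((jbr (Defs.intv R j) `^ s)%:E * (K * S * W)%:E)%E).
  by rewrite lee_wpmul2l// lee_fin powR_ge0.
rewrite -EFinM lee_fin.
have -> : jbr (Defs.intv R j) `^ s * (K * S * W) = (jbr (Defs.intv R j) `^ s * S) * (K * W) by ring.
have KW : 0 <= K * W by rewrite mulr_ge0.
apply: le_trans (ler_wpM2r KW h2) _.
have -> : K1 * K2 * N%:R `^ s * lat N n j * (K * W) = (K1 * K2 * K * W) * N%:R `^ s * lat N n j by ring.
by rewrite !ler_wpM2r ?lat_ge0 ?powR_ge0// lerDr.
Qed.

Lemma LpRd_ge0 (f : vec -> R[i]) : (0 <= LpRd p f)%E.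
Proof.
rewrite /LpRd /Lp_of; case: (p) p1 => [r _| _|//]; first exact: poweR_ge0.
(* If p = oo and M < 0, the exceptional set is all of R^d, and its measure dominates a Gaussian
   integral, hence is not 0. *)
apply: le_ereal_inf_tmp => M /= M0; rewrite leNgt; apply/negP => Mneg.
have : (intRd (fun x : vec => (gs 1 0 x)%:E) <= 0)%E.
  rewrite -M0; apply: intRd_le => x; first by rewrite lee_fin gs_ge0.
  by rewrite ifT ?lee_fin ?gs_le1//; apply: lt_le_trans Mneg _; rewrite lee_fin.
rewrite intRd_gdom; last exact: gdom_gs.
by rewrite integralv_gs// lee_fin leNgt exprn_gt0// sqrtr_gt0 divr_gt0// pi_gt0.
Qed.

(** The box norms are controlled by [lat], which is bounded by B^d and has sum at most n^d B^d. For
    finite q = r the two are interpolated through lat^r <= B^(d (r-1)) lat; for q = oo the first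
    alone is used. *)
Lemma modnorm_bound : exists2 K : R, 0 < K & forall N n, (0 < N)%N -> (n <= N)%N ->
  (modnorm eta s p q (@testu R d N n) <= (K * N%:R `^ s * (n ^ d)%:R `^ einv q)%:E)%E.
Proof.
have [K K0 HK] := box_term_le.
have B0 : 0 < B ^+ d by rewrite exprn_gt0// B_gt0.
exists (K * B ^+ d); first by rewrite mulr_gt0.
move=> N n N0 nN; have Ns0 : 0 <= N%:R `^ s :> R by exact: powR_ge0.
have KN0 : 0 <= K * N%:R `^ s by rewrite mulr_ge0// ltW.
have T0 j : (0 <= (powR (jbr (Defs.intv R j)) s)%:E * LpRd p (box eta j (@testu R d N n)))%E.
  by rewrite mule_ge0 ?LpRd_ge0// lee_fin powR_ge0.
rewrite /modnorm /einv; case: (q) q1 => [r r1| _|//]; last first.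
  apply: ge_ereal_sup => _ [j _ <-]; apply: le_trans (HK N n j N0 nN) _.
  by rewrite powRr0 mulr1 lee_fin [leRHS]mulrAC ler_wpM2l// lat_le.
rewrite lee_fin in r1; have r0 : 0 < r by exact: lt_le_trans r1.
have Br0 : 0 <= (B ^+ d) `^ (r - 1) by exact: powR_ge0.
have tm j : (poweR ((powR (jbr (Defs.intv R j)) s)%:E * LpRd p (box eta j (@testu R d N n))) r <=
   ((K * N%:R `^ s) `^ r * (B ^+ d) `^ (r - 1) * lat N n j)%:E)%E.
  apply: le_trans (le_poweR (ltW r0) (T0 j) (HK N n j N0 nN)) _.
  rewrite poweR_EFin lee_fin powRM ?lat_ge0// -mulrA ler_wpM2l ?powR_ge0//.
  rewrite -(mulr_powRB1 (lat_ge0 N n j) r0) mulrC ler_wpM2r ?lat_ge0//.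
  by apply: ge0_ler_powR; rewrite ?nnegrE ?lat_ge0 ?subr_ge0 ?(ltW B0)// lat_le.
have es : (\esum_(j in [set: 'rV[int]_d]) poweR ((powR (jbr (Defs.intv R j)) s)%:E * LpRd p (box eta j (@testu R d N n))) r
   <= ((K * N%:R `^ s) `^ r * (B ^+ d) `^ r * (n ^ d)%:R)%:E)%E.
  apply: ge_ereal_sup => _ [A [fA _] <-]; rewrite fsbig_finite//=.
  pose c := (K * N%:R `^ s) `^ r * (B ^+ d) `^ (r - 1).
  have hs := lee_sum (finmap.enum_fset (fset_set A)) (P := xpredT) (fun j _ => tm j).
  apply: le_trans hs _.
  rewrite sumEFin lee_fin -mulr_sumr.
  have u := sum_lat_le N n (finmap.fset_uniq (fset_set A)).
  apply: (@le_trans _ _ ((K * N%:R `^ s) `^ r * (B ^+ d) `^ (r - 1) * ((n ^ d)%:R * B ^+ d))).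
    by rewrite ler_wpM2l// mulr_ge0 ?powR_ge0.
  rewrite -(mulr_powRB1 (ltW B0) r0) le_eqVlt; apply/orP; left; apply/eqP; ring.
have es0 : (0 <= \esum_(j in [set: 'rV[int]_d]) poweR ((powR (jbr (Defs.intv R j)) s)%:E * LpRd p (box eta j (@testu R d N n))) r)%E.
  by apply: esum_ge0 => j _; exact: poweR_ge0.
apply: le_trans (le_poweR _ es0 es) _; first by rewrite invr_ge0 ltW.
have root (P Q Z : R) : 0 <= P -> 0 <= Q -> 0 <= Z ->
    (P `^ r * Q `^ r * Z) `^ r^-1 = P * Q * Z `^ r^-1.
  move=> P0 Q0 Z0; rewrite !powRM ?mulr_ge0 ?powR_ge0//.
  by rewrite -!powRrM !mulfV ?gt_eqF// !powRr1.
rewrite poweR_EFin lee_fin root ?(ltW B0)//.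
by rewrite le_eqVlt; apply/orP; left; apply/eqP; ring.
Qed.

End ModNorm.

(** * The evolution of the test functions *)

Section Evolution.
Variables (R : realType) (d : nat).
Local Notation vec := (Defs.vec R d).
Local Notation leb := (@lebesgue_measure R).
Implicit Types (x y z v xi k : vec).

Lemma one_sub_cos_le (th : R) : 1 - `|th| <= cos th.
Proof.
have [c _ e] : exists2 c, c \in `[0, `|th|]%R & cos `|th| - cos 0 = - sin c * (`|th| - 0).
  apply: (@MVT_segment _ cos (fun c => - sin c)); first exact: normr_ge0.
  by apply: continuous_subspaceT; exact: continuous_cos.
have -> : cos th = cos `|th| by case: (ger0P th) => _; rewrite ?cosN.
move: e; rewrite cos0 subr0 => e; have := sin_le1 c; have := normr_ge0 th; nra.
Qed.

(** For finite p, V plays the role of the measure of a set where |F(t)| >= lam. For p = oo the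
    exponent of V is 0, and any positive lower bound e on the measure of the level set will do,
    provided that it is uniform in t. Only monotonicity is used for the integral in t. *)
Lemma LpIRd_lower (p : \bar R) (F : R -> vec -> R[i]) (t0 t1 V lam : R) :
  (1 <= p)%E -> 0 <= t0 -> t0 < t1 -> t1 <= 1 -> 0 <= V -> 0 <= lam ->
  (forall r, p = r%:E -> forall t, t0 <= t <= t1 ->
    ((V * lam `^ r)%:E <= intRd (fun x => ((cabs (F t x)) `^ r)%:E))%E) ->
  (p = +oo%E -> exists2 e, 0 < e & forall t, t0 <= t <= t1 ->
    (e%:E <= intRd (fun x => if (lam <= cabs (F t x))%R then 1%:E else 0%:E))%E) ->
  ((lam * ((t1 - t0) * V) `^ einv p)%:E <= LpIRd p F)%E.
Proof.
move=> p1 t00 t01 t11 V0 lam0 Hr Hoo.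
have cab (w : R[i]) : 0 <= cabs w by exact: sqrtr_ge0.
have tint (g : R -> \bar R) (m : R) : 0 <= m -> (forall t, 0 <= g t)%E ->
    (forall t, t0 <= t <= t1 -> (m%:E <= g t)%E) ->
    ((m * (t1 - t0))%:E <= \int[leb]_(t in [set t : R | (0 <= t <= 1)%R]) g t)%E.
  move=> m0 g0 mg.
  apply: (@le_trans _ _ (\int[leb]_(t in [set t : R | (0 <= t <= 1)%R]) (m * \1_(`[t0, t1]) t)%:E)%E).
    rewrite (_ : [set t : R | (0 <= t <= 1)%R] = `[0, 1]%classic); last first.
      by apply/seteqP; split => t /=; rewrite in_itv.
    under eq_integral do rewrite EFinM.
    rewrite ge0_integralZl//=; last first.
      by apply/measurable_EFinP; apply: measurable_funTS; exact: measurable_indic.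
    rewrite integral_indic//= setIidl; last first.
      by move=> t /=; rewrite !in_itv /= => /andP[? ?]; apply/andP; split; lra.
    by rewrite lebesgue_measure_itv /= lte_fin t01 -EFinB -EFinM.
  apply: ge0_le_integral_nomeas => t _; first by rewrite lee_fin mulr_ge0.
  rewrite indicE; have [tin|_] := boolP (t \in `[t0, t1]%classic); last by rewrite mulr0.
  by move: tin; rewrite inE /= in_itv /= mulr1; exact: mg.
case: p p1 Hr Hoo => [r r1 Hr _|_ _ Hoo|//]; last first.
  rewrite /einv powRr0 mulr1 /LpIRd /Lp_of.
  apply: le_ereal_inf_tmp => M /= M0; rewrite leNgt; apply/negP => Mlam.
  have [e e0 He] := Hoo erefl.
  have : ((e * (t1 - t0))%:E <= 0)%E.
    rewrite -M0; apply: tint; first exact: ltW.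
      by move=> t; apply: iint_ge0 => s; case: ifP; rewrite lee_fin.
    move=> t tt; apply: le_trans (He t tt) _; apply: intRd_le => x.
      by case: ifP; rewrite lee_fin.
    case: ifPn => h /=; last by case: ifP; rewrite lee_fin.
    by rewrite ifT// (lt_le_trans Mlam)// lee_fin ger0_norm.
  by rewrite lee_fin leNgt mulr_gt0// subr_gt0.
rewrite lee_fin in r1; have r0 : 0 < r by exact: lt_le_trans r1.
have Vl : 0 <= V * lam `^ r by rewrite mulr_ge0 ?powR_ge0.
rewrite /LpIRd /Lp_of /einv.
have h : ((V * lam `^ r * (t1 - t0))%:E <= \int[leb]_(t in [set t : R | (0 <= t <= 1)%R])
    intRd (fun x : vec => ((`|cabs (F t x)| `^ r)%:E)))%E.
  apply: tint => // t; first by apply: iint_ge0 => s; rewrite lee_fin powR_ge0.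
  move=> tt; apply: le_trans (Hr r erefl t tt) _; apply: intRd_le => x.
    by rewrite lee_fin powR_ge0.
  by rewrite ger0_norm.
have ti : 0 <= t1 - t0 by lra.
apply: le_trans (le_poweR _ _ h); rewrite ?invr_ge0 ?(ltW r0)//; last by rewrite lee_fin mulr_ge0.
rewrite poweR_EFin lee_fin (_ : V * _ * _ = lam `^ r * ((t1 - t0) * V)); last by ring.
rewrite [leRHS]powRM ?powR_ge0 ?mulr_ge0//.
by rewrite -powRrM mulfV ?gt_eqF// powRr1.
Qed.

Variables (b : R) (N n : nat).
Hypothesis b0 : 0 < b.
Local Notation u := (@testu R d N n).
Local Notation uh := (@uhat R d N n).
Definition cd : R := (2 * pi) ^- d.

Lemma cd_gt0 : 0 < cd.
Proof. by rewrite invr_gt0 exprn_gt0// mulr_gt0// pi_gt0. Qed.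

Definition SR (t : R) x : R := cd * integralv (fun xi => uh xi * cos (dotv xi x + t * phi b xi)).
Definition SI (t : R) x : R := cd * integralv (fun xi => uh xi * sin (dotv xi x + t * phi b xi)).

Lemma vmeas_normv : vmeas (fun x => normv x).
Proof.
apply: (@vmeas_comp _ _ (fun t => Num.sqrt t) (fun x => dotv x x)).
  by apply: continuous_measurable_fun; exact: sqrt_continuous.
by have := vmeas_sqdist (0 : vec); under eq_fun do rewrite subr0.
Qed.

Lemma vmeas_phi : vmeas (@phi R d b).
Proof.
apply: (@vmeas_comp _ _ (fun t => t `^ (b + 2)) (fun x => normv x)); last exact: vmeas_normv.
exact: measurable_powR.
Qed.

Lemma gdom_uhat_trig (f : R -> R) (g : vec -> R) : continuous f -> (forall t, `|f t| <= 1) -> vmeas g ->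
  gdom (fun xi => uh xi * f (g xi)).
Proof.
move=> cf f1 mg; apply: gdomM (gdom_uhat R d N n) _ (fun xi => f1 _).
by apply: vmeas_comp mg; exact: continuous_measurable_fun.
Qed.

Lemma cosb (t : R) : `|cos t| <= 1. Proof. by rewrite ler_norml cos_geN1 cos_le1. Qed.
Lemma sinb (t : R) : `|sin t| <= 1. Proof. by rewrite ler_norml sin_geN1 sin_le1. Qed.

Lemma vmeas_phase x t : vmeas (fun xi => dotv xi x + t * phi b xi).
Proof.
apply: vmeasD; last by apply: vmeasM; [exact: vmeas_cst|exact: vmeas_phi].
by have := vmeas_dot 0 x; under eq_fun do rewrite subr0.
Qed.

Lemma gdom_SR x t : gdom (fun xi => uh xi * cos (dotv xi x + t * phi b xi)).
Proof. exact: gdom_uhat_trig (@continuous_cos R) cosb (vmeas_phase x t). Qed.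

Lemma gdom_SI x t : gdom (fun xi => uh xi * sin (dotv xi x + t * phi b xi)).
Proof. exact: gdom_uhat_trig (@continuous_sin R) sinb (vmeas_phase x t). Qed.

Lemma Sbeta_testu t x : Sbeta (b + 2) t u x = Complex (SR t x) (SI t x).
Proof.
have reE xi : complex.Re (cexpi (t * powR (normv xi) (b + 2)) * fourier u xi * cexpi (dotv x xi)) =
   uh xi * cos (dotv xi x + t * phi b xi).
  by rewrite fourier_testu /= (dotvC xi) cosD -/(phi b xi); ring.
have imE xi : complex.Im (cexpi (t * powR (normv xi) (b + 2)) * fourier u xi * cexpi (dotv x xi)) =
   uh xi * sin (dotv xi x + t * phi b xi).
  by rewrite fourier_testu /= (dotvC xi) sinD -/(phi b xi); ring.
rewrite /Sbeta /ifourier cint_gdom; last 2 first.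
- by rewrite (funext reE); exact: gdom_SR.
- by rewrite (funext imE); exact: gdom_SI.
rewrite (funext reE) (funext imE).
by rewrite /= /SR /SI /cd; congr Complex; rewrite !mul0r ?subr0 ?addr0.
Qed.

(** The left side is the real part of e^(-i th) (a + i c). *)
Lemma cabs_ge_rot (a c th : R) : a * cos th + c * sin th <= cabs (Complex a c).
Proof.
apply: le_trans (ler_norm _) _.
rewrite -(@ler_pXn2r _ 2)// ?nnegrE ?sqrtr_ge0//.
rewrite sqr_sqrtr ?addr_ge0 ?sqr_ge0//= real_normK ?num_real//.
have := cos2Dsin2 th => e.
rewrite -subr_ge0 (_ : _ - _ = (a * sin th - c * cos th) ^+ 2); first exact: sqr_ge0.
have -> : a ^+ 2 + c ^+ 2 = (a ^+ 2 + c ^+ 2) * (cos th ^+ 2 + sin th ^+ 2) by rewrite e mulr1.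
by ring.
Qed.

Lemma vmeas_cabs_S t : vmeas (fun x => cabs (Complex (SR t x) (SI t x))).
Proof.
have m2 : vmeas2 (fun x xi => dotv xi x + t * phi b xi).
  apply: (@vmeas2D R d (fun x xi => dotv xi x) (fun _ xi => t * phi b xi)).
    by have := @vmeas2_dot R d; congr vmeas2; apply/funext => x; apply/funext => y; rewrite dotvC.
  by apply: (@vmeas2_r R d (fun xi => t * phi b xi)); apply: vmeasM; [exact: vmeas_cst|exact: vmeas_phi].
have mu' : vmeas2 (fun _ xi : vec => uh xi) by apply: vmeas2_r; case: (gdom_uhat R d N n).
have mR : vmeas (SR t).
  apply: vmeasM; first exact: vmeas_cst.
  apply: (@vmeas_integralv R d (fun x xi => uh xi * cos (dotv xi x + t * phi b xi))).
  apply: (@vmeas2M R d (fun _ xi => uh xi) (fun x xi => cos (dotv xi x + t * phi b xi))) => //.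
  by apply: (vmeas2_comp (h := cos)) m2; apply: continuous_measurable_fun; exact: continuous_cos.
have mI : vmeas (SI t).
  apply: vmeasM; first exact: vmeas_cst.
  apply: (@vmeas_integralv R d (fun x xi => uh xi * sin (dotv xi x + t * phi b xi))).
  apply: (@vmeas2M R d (fun _ xi => uh xi) (fun x xi => sin (dotv xi x + t * phi b xi))) => //.
  by apply: (vmeas2_comp (h := sin)) m2; apply: continuous_measurable_fun; exact: continuous_sin.
apply: (@vmeas_comp _ _ (fun t => Num.sqrt t) (fun x => SR t x ^+ 2 + SI t x ^+ 2)).
  by apply: continuous_measurable_fun; exact: sqrt_continuous.
by apply: vmeasD; [under eq_fun do rewrite expr2|under eq_fun do rewrite expr2]; exact: vmeasM.
Qed.

Lemma cabs_S_le t x : cabs (Complex (SR t x) (SI t x)) <= 2 * cd * integralv uh.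
Proof.
apply: le_trans (cabs_le _) _; rewrite /= /SR /SI !normrM (ger0_norm (ltW cd_gt0)) -mulrDr.
have uh0 := @uhat_ge0 R d N n.
have h (f : R -> R) (g : vec -> R) : (forall t, `|f t| <= 1) -> gdom (fun xi => uh xi * f (g xi)) ->
    `|integralv (fun xi => uh xi * f (g xi))| <= integralv uh.
  move=> f1 gf; apply: le_trans (normr_integralv gf) _.
  apply: integralv_le; [exact: gdom_norm|exact: gdom_uhat|move=> xi].
  by rewrite normrM (ger0_norm (uh0 xi)) ler_piMr.
have h1 := h cos _ cosb (gdom_SR x t); have h2 := h sin _ sinb (gdom_SI x t).
have c0 := cd_gt0.
rewrite -mulrA mulrCA ler_wpM2l ?(ltW c0)//; lra.
Qed.

Lemma integralv_uhat : integralv uh = (n ^ d)%:R * G0 R d ^+ 2.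
Proof.
rewrite integralv_sumE; last by move=> a; apply: gdomZ; exact: gdom_gs.
rewrite (eq_bigr (fun=> G0 R d ^+ 2)).
  by rewrite sumr_const card_ffun !card_ord mulr_natl.
move=> a _; rewrite integralvZ; last exact: gdom_gs.
by rewrite integralv_gs// expr2.
Qed.

End Evolution.

(** * Focusing at the origin *)

Section Focusing.
Variables (R : realType) (d : nat) (b : R).
Local Notation vec := (Defs.vec R d).
Local Notation leb := (@lebesgue_measure R).
Implicit Types (x y z v xi k : vec).
Hypothesis d0 : (0 < d)%N.
Hypothesis b0 : 0 < b.

Lemma intRd_box (k l : R) : 0 <= k -> 0 <= l ->
  intRd (fun x : vec => (k * \prod_(i < d) \1_(`[0, l]%classic : set R) (x ord0 i))%:E) = (k * l ^+ d)%:E.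
Proof.
move=> k0 l0.
have := iint_prodS d (f := fun _ t => \1_(`[0, l]%classic : set R) t) (c := fun=> l) k0.
rewrite prodr_const card_ord => <-//.
- apply: iint_eq => s sd; congr (_ * _)%:E.
  by rewrite prodSE sd; apply: eq_bigr => i _; rewrite !mxE.
- by move=> _; exact: measurable_indic.
- move=> _; rewrite integral_indic//= setIT lebesgue_measure_itv /= lte_fin.
  by move: l0; rewrite le_eqVlt => /orP[/eqP <-|l0]; rewrite ?ltxx ?l0 ?oppr0 ?adde0.
Qed.

Lemma box_indicator (l : R) x : \prod_(i < d) \1_(`[0, l]%classic : set R) (x ord0 i) =
  ([forall i, 0 <= x ord0 i <= l])%:R :> R.
Proof.
have [/forallP h|/forallPn[i h]] := boolP [forall i, 0 <= x ord0 i <= l].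
  by rewrite big1// => i _; rewrite indicE mem_set//= in_itv /= h.
rewrite (bigD1 i)//= indicE memNset ?mul0r//=.
by rewrite in_itv /=; exact/negP.
Qed.

(** The real part of S(t)u is bounded below through cos y >= 1 - |y|. At distance V from a frequency
    of u, the phase is at most delta C' (1 + V)^(b+2); the Gaussian absorbs the power, and the total
    error is a multiple of delta. *)
Lemma focusing_pointwise : exists2 delta : R, 0 < delta <= 1 & exists2 c : R, 0 < c &
  forall N, (0 < N)%N -> forall t x, 0 <= t <= delta * N%:R `^ (- (b + 2)) ->
    (forall i, 0 <= x ord0 i <= delta / N%:R) ->
    c * N%:R ^+ d <= cabs (Sbeta (b + 2) t (@testu R d N N) x).
Proof.
have b00 := b0; pose D : R := d%:R * 2.
have d1 : 1 <= d%:R :> R by rewrite ler1n.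
(* 3/8 = 1/2 - 1/8: after absorbing the power, the Gaussian keeps the rate 1/8. *)
have [||C'' C''1 HC] := @powR_1D_le R (b + 2) (3 / 8); [lra|lra|].
pose C' := D * d%:R + D `^ (b + 2).
have Db0 : 0 < D `^ (b + 2) by apply: powR_gt0; rewrite /D; lra.
have C'0 : 0 < C'.
  by rewrite /C' ltr_wpDl// mulr_ge0// /D mulr_ge0.
pose G8 : R := Num.sqrt (pi / 8^-1) ^+ d.
have G80 : 0 < G8 by rewrite exprn_gt0// sqrtr_gt0 divr_gt0// pi_gt0.
have G00 := G0_gt0 R d.
pose Q := C' * C'' * G8.
have C''0 : 0 < C'' by exact: lt_le_trans C''1.
have Q0 : 0 < Q by rewrite !mulr_gt0.
(* With this choice the error N^d delta Q G0 is at most half of the main term N^d G0^2. *)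
pose delta := Num.min 1 (G0 R d / (2 * Q)).
have de0 : 0 < delta by rewrite lt_min ltr01 divr_gt0// mulr_gt0.
have deQ : delta * Q <= G0 R d / 2.
  have : delta <= G0 R d / (2 * Q) by rewrite ge_min lexx orbT.
  rewrite ler_pdivlMr ?mulr_gt0// => h; lra.
exists delta; first by rewrite de0 ge_min lexx.
exists (cd R d * (G0 R d ^+ 2 / 2)).
  by rewrite mulr_gt0 ?cd_gt0// divr_gt0// exprn_gt0.
move=> N N0 t x /andP[t0 tN] xi01.
have N1 : 1 <= N%:R :> R by rewrite ler1n.
have Np : 0 < N%:R :> R by rewrite ltr0n.
rewrite Sbeta_testu; have := cabs_ge_rot (SR b N N t x) (SI b N N t x) 0.
rewrite cos0 sin0 mulr1 mulr0 addr0; apply: le_trans.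
rewrite /SR -mulrA ler_wpM2l ?(ltW (cd_gt0 R d))//.
pose err xi : R := \sum_(a : {ffun 'I_d -> 'I_N}) (delta * C' * C'') * (G0 R d * gs 8^-1 (kv R N a) xi).
have gerr : gdom err by apply: gdom_sum => a; apply: gdomZ; apply: gdomZ; apply: gdom_gs; rewrite invr_gt0.
have Ierr : integralv err = (N ^ d)%:R * (delta * Q * G0 R d).
  rewrite integralv_sumE; last by move=> a; apply: gdomZ; apply: gdomZ; apply: gdom_gs; rewrite invr_gt0.
  rewrite (eq_bigr (fun=> delta * Q * G0 R d)).
    by rewrite sumr_const card_ffun !card_ord mulr_natl.
  move=> a _; rewrite !integralvZ ?integralv_gs ?invr_gt0//; last 2 first.
  - by apply: gdom_gs; rewrite invr_gt0.
  - by apply: gdomZ; apply: gdom_gs; rewrite invr_gt0.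
  by rewrite /Q -/G8; ring.
have normx : normv x <= d%:R * (delta / N%:R).
  apply: normv_le_max; first by rewrite divr_ge0// ltW.
  by move=> i; have /andP[h1 h2] := xi01 i; rewrite ger0_norm.
have ptw xi (a : {ffun 'I_d -> 'I_N}) : `|dotv xi x + t * phi b xi| * gs 2^-1 (kv R N a) xi <=
    (delta * C' * C'') * gs 8^-1 (kv R N a) xi.
  set V := normv (xi - kv R N a).
  have V0 : 0 <= V by exact: normv_ge0.
  have nxi : normv xi <= D * N%:R * (1 + V).
    have h1 := normvD (kv R N a) (xi - kv R N a); rewrite addrC subrK -/V in h1.
    have h2 := normv_kv_le R a (leqnn N).
    have D1 : 1 <= D * N%:R by rewrite /D; nra.
    apply: le_trans h1 _; rewrite /D in D1 *; nra.
  have V1 : 1 + V <= (1 + V) `^ (b + 2).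
    by rewrite -{1}(powRr1 (_ : 0 <= 1 + V)); [apply: ler_powR; lra|lra].
  have nx0 := normv_ge0 xi.
  have th : `|dotv xi x + t * phi b xi| <= delta * C' * (1 + V) `^ (b + 2).
    apply: le_trans (ler_normD _ _) _.
    rewrite /C' mulrDr mulrDl lerD//.
      apply: le_trans (dotv_le _ _) _.
      apply: (@le_trans _ _ ((D * N%:R * (1 + V)) * (d%:R * (delta / N%:R)))).
        by rewrite ler_pM// normv_ge0.
      have -> : D * N%:R * (1 + V) * (d%:R * (delta / N%:R)) = delta * (D * d%:R) * (1 + V).
        by field; exact: lt0r_neq0.
      by rewrite ler_wpM2l// mulr_ge0 ?(ltW de0)// mulr_ge0// /D mulr_ge0.
    rewrite ger0_norm; last by rewrite mulr_ge0// powR_ge0.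
    apply: (@le_trans _ _ ((delta * N%:R `^ (- (b + 2))) * (D * N%:R * (1 + V)) `^ (b + 2))).
      rewrite ler_pM ?powR_ge0//; apply: ge0_ler_powR; rewrite ?nnegrE//; lra.
    have D0 : 0 <= D by rewrite /D mulr_ge0.
    rewrite !powRM ?mulr_ge0//; last by lra.
    rewrite powRN le_eqVlt; apply/orP; left; apply/eqP.
    by field; rewrite gt_eqF// powR_gt0.
  apply: (@le_trans _ _ (delta * C' * (C'' * expR (3 / 8 * V ^+ 2)) * gs 2^-1 (kv R N a) xi)).
    rewrite ler_wpM2r ?gs_ge0//; apply: le_trans th _.
    by rewrite ler_wpM2l ?HC// mulr_ge0// ltW.
  rewrite -!mulrA ler_wpM2l ?(ltW de0)// ler_wpM2l ?(ltW C'0)// ler_wpM2l//; first lra.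
  rewrite /gs /V normv_sqr -expRD ler_expR; lra.
apply: (@le_trans _ _ (integralv (fun xi => uhat N N xi - err xi))).
  rewrite integralvB//; last exact: gdom_uhat.
  rewrite integralv_uhat Ierr natrX -mulrBr [leLHS]mulrC ler_wpM2l ?exprn_ge0//.
  nra.
apply: integralv_le; [|exact: gdom_SR|].
  have := gdomD (gdom_uhat R d N N) (gdomZ (-1) gerr).
  by under eq_fun do rewrite mulN1r.
move=> xi; apply: (@le_trans _ _ (uhat N N xi * (1 - `|dotv xi x + t * phi b xi|))); last first.
  by rewrite ler_wpM2l ?uhat_ge0// one_sub_cos_le.
rewrite mulrBr mulr1 lerD2l lerN2 /uhat /err mulr_suml; apply: ler_sum => a _.
have h := ler_wpM2l (ltW G00) (ptw xi a).
rewrite [leRHS]mulrCA; apply: le_trans h; rewrite le_eqVlt; apply/orP; left; apply/eqP; ring.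
Qed.

Lemma focusing_lower (p : \bar R) : (1 <= p)%E -> exists2 c : R, 0 < c & forall N, (0 < N)%N ->
  ((c * N%:R `^ (d%:R - (d%:R + b + 2) * einv p))%:E <=
    LpIRd p (fun t => Sbeta (b + 2) t (@testu R d N N)))%E.
Proof.
move=> p1; have [de /andP[de0 de1] [c c0 H]] := focusing_pointwise.
exists (c * (de * de ^+ d) `^ einv p).
  by rewrite mulr_gt0// powR_gt0// mulr_gt0// exprn_gt0.
move=> N N0; have N1 : 1 <= N%:R :> R by rewrite ler1n.
have Np : 0 < N%:R :> R by rewrite ltr0n.
pose t1 := de * N%:R `^ (- (b + 2)).
have Nb : 0 < N%:R `^ (- (b + 2)) :> R by exact: powR_gt0.
have Nb1 : N%:R `^ (- (b + 2)) <= 1 :> R.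
  apply: (@le_trans _ _ (N%:R `^ 0)); last by rewrite powRr0.
  by apply: ler_powR => //; have := b0; lra.
pose l := de / N%:R; have l0 : 0 < l by rewrite divr_gt0.
have lam0 : 0 <= c * N%:R ^+ d by rewrite mulr_ge0 ?exprn_ge0// ltW.
have bx (r : R) (x : vec) : (r * \prod_(i < d) \1_(`[0, l]%classic : set R) (x ord0 i)) =
     if [forall i, 0 <= x ord0 i <= l] then r else 0.
  by rewrite box_indicator; case: ifP; rewrite ?mulr1 ?mulr0.
have h : (((c * N%:R ^+ d) * ((t1 - 0) * l ^+ d) `^ einv p)%:E <= LpIRd p (fun t => Sbeta (b + 2) t (@testu R d N N)))%E.
  apply: LpIRd_lower => //.
  - by rewrite mulr_gt0.
  - by rewrite /t1 -[leRHS]mulr1 ler_pM// ltW.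
  - by rewrite exprn_ge0// ltW.
  - move=> r pr t tt; rewrite mulrC -intRd_box ?powR_ge0 ?(ltW l0)//.
    apply: intRd_le => x; rewrite bx; first by case: ifP; rewrite lee_fin ?powR_ge0.
    case: ifPn => [/forallP xl|_]; rewrite lee_fin ?powR_ge0//.
    have r0 : 0 <= r by move: p1; rewrite pr lee_fin; apply: le_trans.
    by apply: ge0_ler_powR; rewrite ?nnegrE ?sqrtr_ge0//; exact: H.
  - move=> _; exists (l ^+ d); first by rewrite exprn_gt0.
    move=> t tt; rewrite -[l ^+ d]mul1r -intRd_box ?(ltW l0)//.
    apply: intRd_le => x; rewrite bx; first by case: ifP; rewrite lee_fin.
    case: ifPn => [/forallP xl|_].
      by rewrite ifT//; exact: H.
    by case: ifP; rewrite lee_fin.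
apply: le_trans h; rewrite lee_fin subr0.
have -> : t1 * l ^+ d = (de * de ^+ d) * N%:R `^ (- (d%:R + b + 2)).
  rewrite /t1 /l expr_div_n.
  have -> : - (d%:R + b + 2) = - (b + 2) + - d%:R by ring.
  rewrite powRD ?(gt_eqF Np) ?implybT// powR_invn ?(ltW Np)//.
  by rewrite -!mulrA; congr (_ * _); rewrite mulrCA.
set M := de * de ^+ d; have M0 : 0 <= M by rewrite mulr_ge0 ?exprn_ge0 ?(ltW de0).
rewrite (powRM _ M0 (powR_ge0 _ _)).
rewrite -powRrM -powR_mulrn ?(ltW Np)// powRD ?(gt_eqF Np) ?implybT//.
rewrite -mulNr le_eqVlt; apply/orP; left; apply/eqP; ring.
Qed.

End Focusing.

(** * Dispersion into wave packets *)

Section Dispersive.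
Variables (R : realType) (d : nat) (b : R).
Local Notation vec := (Defs.vec R d).
Implicit Types (x y z v xi k : vec).
Hypothesis d0 : (0 < d)%N.
Hypothesis b0 : 0 < b.

Section packets.
Variables (N n rho : nat).
Hypotheses (N0 : (0 < N)%N) (n0 : (0 < n)%N) (nN : (n <= N)%N) (rho0 : (0 < rho)%N).

Definition xij (j : {ffun 'I_d -> 'I_(n * rho)}) : vec := \row_i (N%:R + (j i)%:R / rho%:R).
Definition xj (t : R) j : vec := - (t *: gradphi b (xij j)).
Definition rate : R := (2 * rho%:R ^+ 2)^-1.
Definition chi t j x : R := gs rate (xj t j) x.

Lemma rhop : 0 < rho%:R :> R. Proof. by rewrite ltr0n. Qed.

Lemma rate_gt0 : 0 < rate.
Proof. by rewrite invr_gt0 mulr_gt0// exprn_gt0// rhop. Qed.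

Lemma xij_coord j i : N%:R <= xij j ord0 i <= 2 * N%:R.
Proof.
rewrite mxE; apply/andP; split; first by rewrite lerDl divr_ge0.
rewrite mulrDl mul1r lerD2l ler_pdivrMr ?rhop// -natrM ler_nat.
by apply: leq_trans (ltnW (ltn_ord _)) _; rewrite leq_mul2r nN orbT.
Qed.

Lemma normv_xij_ge j : N%:R <= normv (xij j).
Proof.
apply: le_trans (normv_coord _ (Ordinal d0)); apply: le_trans (ler_norm _).
by have /andP[] := xij_coord j (Ordinal d0).
Qed.

Lemma normv_xij_le j : normv (xij j) <= d%:R * (2 * N%:R).
Proof.
apply: normv_le_max => [|i]; first by rewrite mulr_ge0.
have /andP[h1 h2] := xij_coord j i; rewrite ger0_norm//.
exact: le_trans h1.
Qed.

(** Rounding the coordinates of [xij j] down to integers, by Euclidean division by rho, gives a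
    frequency of u. Thus the transform of u is bounded below near every packet frequency. *)
Lemma xij_near j : exists a : {ffun 'I_d -> 'I_n}, dotv (xij j - kv R N a) (xij j - kv R N a) <= d%:R.
Proof.
have lt i : (j i %/ rho < n)%N by rewrite ltn_divLR.
exists [ffun i => Ordinal (lt i)]; apply: (@le_trans _ _ (d%:R * 1 ^+ 2)); last by rewrite expr1n mulr1.
apply: dotv_le_max => i; rewrite !mxE ffunE /= natrD opprD addrACA subrr add0r.
have e := divn_eq (j i) rho.
rewrite {1}e natrD natrM mulrDl mulfK ?gt_eqF ?rhop// addrAC subrr add0r.
rewrite ger0_norm ?divr_ge0// ler_pdivrMr ?rhop// mul1r ler_nat ltnW//.
by rewrite ltn_mod.
Qed.

Lemma xij_sub j j' : dotv (xij j - xij j') (xij j - xij j') =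
  (rho%:R ^+ 2)^-1 * \sum_(i < d) ((j i)%:R - (j' i)%:R) ^+ 2.
Proof.
rewrite /dotv mulr_sumr; apply: eq_bigr => i _; rewrite !mxE.
by field; rewrite gt_eqF ?rhop.
Qed.

(* Compare with the packet j0 whose centre is nearest to x: by the expansion of the
   gradient map, |x - xj j| is at least a multiple of N^b |xij j - xij j0|. *)
Lemma overlap (K t : R) x : 0 < K -> 2^-1 <= t -> rho%:R <= 2 * K * N%:R `^ (b / 2) ->
  \sum_j chi t j x <= lattice_const ((128 * K ^+ 4)^-1) ^+ d.
Proof.
move=> K0 t2 rK; have b00 := b0.
have c0 : 0 < (128 * K ^+ 4)^-1 :> R by rewrite invr_gt0 mulr_gt0// exprn_gt0.
have p0 : (0 < n * rho)%N by rewrite muln_gt0 n0.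
have [j0 _ j0min] := @Order.TotalTheory.arg_minP _ _ _ [ffun=> Ordinal p0]
  (xpredT : pred {ffun 'I_d -> 'I_(n * rho)}) (fun j => normv (x - xj t j)) isT.
apply: le_trans (sum_gauss_ffun c0 (n * rho) (fun i => (j0 i)%:R)).
apply: ler_sum => j _; rewrite -expR_sum /chi /gs ler_expR sumrN lerN2 -mulr_sumr.
set S := \sum_(i < d) _.
have S0 : 0 <= S by apply: sumr_ge0 => i _; exact: sqr_ge0.
have xS : dotv (xij j - xij j0) (xij j - xij j0) = (rho%:R ^+ 2)^-1 * S.
  by rewrite xij_sub; congr (_ * _); apply: eq_bigr => i _; rewrite -sqrrN opprB.
have Np : 0 < N%:R :> R by rewrite ltr0n.
have Nb := powR_gt0 b Np; set NB := N%:R `^ b in Nb *.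
have gm := gradphi_mono b00 Np (normv_xij_ge j) (normv_xij_ge j0).
have h1 : NB * normv (xij j - xij j0) <= normv (xj t j - xj t j0).
  have -> : xj t j - xj t j0 = (- t) *: (gradphi b (xij j) - gradphi b (xij j0)).
    by rewrite /xj scaleNr scalerBr opprB opprK addrC.
  have -> : normv ((- t) *: (gradphi b (xij j) - gradphi b (xij j0))) =
      t * normv (gradphi b (xij j) - gradphi b (xij j0)).
    rewrite /normv dotvZl dotvZr mulrA mulrNN -expr2 sqrtrM ?sqr_ge0//.
    by rewrite sqrtr_sqr ger0_norm//; lra.
  apply: (@le_trans _ _ (2^-1 * ((b + 2) * NB * normv (xij j - xij j0)))).
    rewrite !mulrA ler_wpM2r ?normv_ge0// ler_peMl ?(ltW Nb)//; lra.
  by rewrite ler_pM// ?mulr_ge0 ?normv_ge0 ?(ltW Nb)//; lra.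
(* Triangle inequality through x, with j0 being the closest to x. *)
have h2 : normv (xj t j - xj t j0) <= 2 * normv (x - xj t j).
  have e : xj t j - xj t j0 = (x - xj t j0) - (x - xj t j) by rewrite [RHS]addrC opprB addrA subrK.
  rewrite e; apply: le_trans (normvD _ _) _; rewrite normvN.
  by rewrite mulr_natl mulr2n lerD2r; exact: j0min.
have h3 : NB ^+ 2 * ((rho%:R ^+ 2)^-1 * S) <= 4 * dotv (x - xj t j) (x - xj t j).
  rewrite -xS -!normv_sqr -exprMn (_ : 4 = 2 ^+ 2) ?natrX; last by rewrite -natrX.
  rewrite -exprMn lerXn2r ?nnegrE ?mulr_ge0 ?normv_ge0 ?(ltW Nb)//.
  exact: le_trans h2.
have rp := rhop.
have h4 : rho%:R ^+ 2 <= 4 * K ^+ 2 * NB.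
  have NBE : NB = (N%:R `^ (b / 2)) ^+ 2.
    rewrite -powR_mulrn ?powR_ge0// -powRrM; congr (_ `^ _); by field.
  rewrite NBE (_ : 4 * K ^+ 2 * _ = (2 * K * N%:R `^ (b / 2)) ^+ 2); last by ring.
  by rewrite lerXn2r// nnegrE ?mulr_ge0 ?powR_ge0 ?(ltW K0) ?(ltW rp).
set X := dotv _ _ in h3 *.
rewrite /rate; set P := rho%:R ^+ 2 in h3 h4 *.
have P0 : 0 < P by rewrite exprn_gt0.
have K20 : 0 < K ^+ 2 by rewrite exprn_gt0.
rewrite ler_pdivrMl ?mulr_gt0 ?exprn_gt0//.
(* The constant is 128 = 2 * 4 * 16, from the rate 1/(2 rho^2), the squared factor 2 of the triangle
   inequality, and the square of rho^2 <= 4 K^2 N^b. *)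
have h5 : P * P <= 16 * (K ^+ 2) ^+ 2 * NB ^+ 2.
  rewrite (_ : 16 * _ * _ = (4 * K ^+ 2 * NB) * (4 * K ^+ 2 * NB)); last by ring.
  by rewrite ler_pM// ltW.
have h6 : S * (P * P) <= 64 * (K ^+ 2) ^+ 2 * X * P.
  have : S * (P * P) <= S * (16 * (K ^+ 2) ^+ 2 * NB ^+ 2) by rewrite ler_wpM2l.
  move=> h; apply: le_trans h _.
  have -> : S * (16 * (K ^+ 2) ^+ 2 * NB ^+ 2) = 16 * (K ^+ 2) ^+ 2 * (NB ^+ 2 * (P^-1 * S)) * P.
    by field; exact: lt0r_neq0.
  rewrite ler_pM2r// (_ : 64 * _ * X = 16 * (K ^+ 2) ^+ 2 * (4 * X)); last by ring.
  by rewrite ler_wpM2l// mulr_ge0// exprn_ge0// ltW.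
have -> : 128 * K ^+ 4 * ((2 * P)^-1 * X) = (64 * (K ^+ 2) ^+ 2 * X * P) / (P * P).
  by field; exact: lt0r_neq0.
by rewrite ler_pdivlMr// mulr_gt0.
Qed.

End packets.
End Dispersive.

Section PacketLower.
Variables (R : realType) (d : nat) (b : R).
Local Notation vec := (Defs.vec R d).
Implicit Types (x y z v xi k : vec).
Hypothesis d0 : (0 < d)%N.
Hypothesis b0 : 0 < b.

Lemma sqrt_scale (a rho : R) : 0 < a -> 0 < rho -> Num.sqrt (pi / (a * rho ^+ 2)) = Num.sqrt (pi / a) / rho.
Proof.
move=> a0 r0; have -> : pi / (a * rho ^+ 2) = (pi / a) * (rho^-1) ^+ 2 by field; rewrite !gt_eqF.
by rewrite sqrtrM ?divr_ge0 ?pi_ge0 ?(ltW a0)// sqrtr_sqr ger0_norm// invr_ge0 ltW.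
Qed.

Lemma uhat_le N n xi : @uhat R d N n xi <= G0 R d * lattice_const (2^-1) ^+ d.
Proof.
rewrite /uhat -mulr_sumr ler_wpM2l ?(ltW (G0_gt0 R d))//.
have c0 : 0 < 2^-1 :> R by rewrite invr_gt0.
apply: le_trans (sum_gauss_ffun c0 n (fun i => xi ord0 i - N%:R)).
apply: ler_sum => a _; rewrite gs_prod le_eqVlt; apply/orP; left; apply/eqP.
by apply: eq_bigr => i _; rewrite kv_coord opprD addrA.
Qed.

Section one_packet.
Variables (N n rho : nat) (t : R) (j : {ffun 'I_d -> 'I_(n * rho)}).
Hypotheses (N0 : (0 < N)%N) (n0 : (0 < n)%N) (nN : (n <= N)%N) (rho0 : (0 < rho)%N).
Hypotheses (t0 : 0 <= t) (t1 : t <= 1).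
Local Notation xi0 := (xij R N j).
Local Notation y0 := (xj b N t j).
Local Notation rt := (rate R rho).
Local Notation uh := (@uhat R d N n).

Definition dev xi : R := t * (phi b xi - phi b xi0 - dotv (gradphi b xi0) (xi - xi0)).

(** The centre y0 = - t grad phi(xi0) is where the linear part of the phase in xi - xi0 vanishes.
    The value of the phase at xi0 depends on x only and is removed by a rotation. *)
Lemma phase_split x xi : dotv xi x + t * phi b xi - (dotv xi0 x + t * phi b xi0) =
  dotv (x - y0) (xi - xi0) + dev xi.
Proof.
rewrite /dev /xj opprK !(dotvDl, dotvDr, dotvNl, dotvNr, dotvZl) (dotvC xi) (dotvC xi0 x).
by ring.
Qed.

Lemma vmeas_dev : vmeas dev.
Proof.
apply: vmeasM; first exact: vmeas_cst.
apply: vmeasD; first by apply: vmeasD; [exact: vmeas_phi|exact: vmeas_cst].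
have := vmeas_dot xi0 (gradphi b xi0) => m.
have -> : (fun xi => - dotv (gradphi b xi0) (xi - xi0)) = (fun xi => (-1) * dotv (xi - xi0) (gradphi b xi0)).
  by apply/funext => xi; rewrite mulN1r dotvC.
by apply: vmeasM => //; exact: vmeas_cst.
Qed.

(* Integrating chi_j against the real part of e^(-i alpha(x)) S(t)u(x) bounds the
   integral of |S(t)u| chi_j from below; doing the x-integral first turns chi_j
   into the Gaussian [gam] of width 1/rho around xi_j. *)
Definition ker x xi : R := cd R d * (uh xi * cos (dotv (x - y0) (xi - xi0) + dev xi)) * chi b N t j x.

Lemma cabs_S_chi_ge x : integralv (ker x) <= cabs (Complex (SR b N n t x) (SI b N n t x)) * chi b N t j x.
Proof.
have gR := gdom_SR b N n x t; have gI := gdom_SI b N n x t.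
pose al := dotv xi0 x + t * phi b xi0.
have -> : integralv (ker x) = (SR b N n t x * cos al + SI b N n t x * sin al) * chi b N t j x.
  transitivity (integralv (fun xi => (cd R d * chi b N t j x * cos al) * (uh xi * cos (dotv xi x + t * phi b xi)) +
     (cd R d * chi b N t j x * sin al) * (uh xi * sin (dotv xi x + t * phi b xi)))).
    apply: integralv_eq => xi; rewrite /ker -phase_split -/al cosB; ring.
  rewrite integralvD; [|exact: gdomZ|exact: gdomZ].
  by rewrite !integralvZ// /SR /SI; ring.
rewrite ler_wpM2r ?gs_ge0//; exact: cabs_ge_rot.
Qed.

Lemma gdom_cabs_S_chi : gdom (fun x => cabs (Complex (SR b N n t x) (SI b N n t x)) * chi b N t j x).
Proof.
have gc : gdom (chi b N t j) by apply: gdom_gs; exact: rate_gt0.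
have := gdomM gc (vmeas_cabs_S b N n t) (B := 2 * cd R d * integralv uh).
under eq_fun do rewrite mulrC; apply=> x.
by rewrite ger0_norm ?sqrtr_ge0// cabs_S_le.
Qed.

Lemma vmeas2_ker : vmeas2 ker.
Proof.
rewrite /ker; apply: (@vmeas2M R d (fun x xi => cd R d * (uh xi * cos (dotv (x - y0) (xi - xi0) + dev xi)))
  (fun x _ => chi b N t j x)); last by apply: (@vmeas2_l R d (chi b N t j)); exact: vmeas_gs.
apply: (@vmeas2M R d (fun _ _ => cd R d)).
  by apply: (@vmeas2_l R d (fun=> cd R d)); exact: vmeas_cst.
apply: (@vmeas2M R d (fun _ xi => uh xi)).
  by apply: vmeas2_r; case: (gdom_uhat R d N n).
apply: (vmeas2_comp (h := cos)); first by apply: continuous_measurable_fun; exact: continuous_cos.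
apply: (@vmeas2D R d (fun x xi => dotv (x - y0) (xi - xi0)) (fun _ xi => dev xi)); last first.
  by apply: vmeas2_r; exact: vmeas_dev.
have -> : (fun x xi => dotv (x - y0) (xi - xi0)) = (fun x xi => dotv x xi + (dotv (x - 0) (- xi0) + dotv (xi - xi0) (- y0))).
  apply/funext => x; apply/funext => xi; move: y0 xi0 => p q; rewrite subr0.
  by rewrite !(dotvDl, dotvDr, dotvNl, dotvNr) (dotvC xi p) (dotvC q p); ring.
apply: (@vmeas2D R d (fun x xi => dotv x xi) (fun x xi => dotv (x - 0) (- xi0) + dotv (xi - xi0) (- y0))).
  exact: vmeas2_dot.
apply: (@vmeas2D R d (fun x _ => dotv (x - 0) (- xi0)) (fun _ xi => dotv (xi - xi0) (- y0))).
  by apply: (@vmeas2_l R d (fun x => dotv (x - 0) (- xi0))); exact: vmeas_dot.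
by apply: (@vmeas2_r R d (fun xi => dotv (xi - xi0) (- y0))); exact: vmeas_dot.
Qed.

Definition gam xi : R := gs (rho%:R ^+ 2 / 2) xi0 xi.

Lemma integral_ker_swap : integralv (fun x => integralv (ker x)) =
  cd R d * Num.sqrt (pi / rt) ^+ d * integralv (fun xi => uh xi * cos (dev xi) * gam xi).
Proof.
have c0 := cd_gt0 R d; have rt0 := rate_gt0 R rho0.
have [mu' [r' [a' [A' [r'0 A'0 uA]]]]] := gdom_uhat R d N n.
have ru := rhop R rho0.
rewrite (@integralv_fubini R d ker rt y0 r' a' (cd R d * A')) ?rt0//; last 2 first.
- exact: vmeas2_ker.
- move=> x xi; rewrite /ker /chi !normrM (ger0_norm (ltW c0)) (ger0_norm (gs_ge0 _ _ _)).
  set A1 := gs rt y0 x; set A2 := gs r' a' xi.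
  have h : `|uh xi| * `|cos (dotv (x - y0) (xi - xi0) + dev xi)| <= A' * A2.
    by apply: le_trans (uA xi); rewrite ler_piMr// cosb.
  rewrite (_ : _ * A' * A1 * A2 = cd R d * (A' * A2) * A1); last by ring.
  by rewrite ler_wpM2r ?gs_ge0// ler_wpM2l// ltW.
rewrite -integralvZ; last first.
  have gu : gdom (fun xi => uh xi * cos (dev xi)) by apply: gdom_uhat_trig; [exact: continuous_cos|exact: cosb|exact: vmeas_dev].
  apply: (gdomM (B := 1) gu (vmeas_gs _ _)) => xi.
  by rewrite ger0_norm ?gs_ge0// gs_le1// divr_ge0// exprn_ge0.
apply: integralv_eq => xi.
rewrite (@integralv_eq _ _ _ (fun x => (cd R d * uh xi) * (cos (dotv (x - y0) (xi - xi0) + dev xi) * gs rt y0 x))); last first.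
  by move=> x; rewrite /ker /chi; ring.
have gx : gdom (fun x => cos (dotv (x - y0) (xi - xi0) + dev xi) * gs rt y0 x).
  have := gdom_cos_gs y0 (xi - xi0) (- dotv y0 (xi - xi0) + dev xi) rt0.
  by under eq_fun do rewrite addrA -dotvBl.
rewrite integralvZ// integralv_gs_cos//.
have -> : expR (- (dotv (xi - xi0) (xi - xi0) / (4 * rt))) = gam xi.
  rewrite /gam /gs /rate; congr (expR (- _)); field; exact: lt0r_neq0.
by ring.
Qed.

End one_packet.

(** After the x-integration, what remains is the transform of u times cos([dev]) against a Gaussian
    of width 1/rho, of mass about rho^(-d), which cancels the factor rho^d in front. As [dev] is
    O(N^b |xi - xi0|^2), replacing the cosine by 1 costs a fraction of order N^b / rho^2 <=
    1/K^2. *)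
Lemma packet_lower : exists2 K : R, 1 <= K & exists2 c : R, 0 < c & forall (N n rho : nat) (t : R)
  (j : {ffun 'I_d -> 'I_(n * rho)}), (0 < N)%N -> (0 < n)%N -> (n <= N)%N -> (0 < rho)%N ->
  0 <= t <= 1 -> K * N%:R `^ (b / 2) <= rho%:R ->
  c <= integralv (fun x => cabs (Complex (SR b N n t x) (SI b N n t x)) * chi b N t j x).
Proof.
have b00 := b0.
have bm : b <= (Num.bound b)%:R by apply: ltW; exact: archi_boundP (ltW b0).
set m := Num.bound b in bm.
have [||C C1 HC] := @powR_1D_le R b 8^-1; [by []|by rewrite invr_gt0|].
have C0 : 0 < C by lra.
have d1 : 1 <= d%:R :> R by rewrite ler1n.
have D0 : 0 < d%:R * 2 :> R by lra.
have G00 := G0_gt0 R d.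
pose L := (b + 2) * m.+1%:R * (d%:R * 2) `^ b * C * 8.
have L0 : 0 < L by rewrite !mulr_gt0 ?powR_gt0//; lra.
pose U := G0 R d * lattice_const (2^-1) ^+ d.
have U0 : 0 < U by apply: mulr_gt0 => //; apply: exprn_gt0; apply: lattice_const_gt0; rewrite invr_gt0.
pose A1 := G0 R d * expR (- d%:R) * Num.sqrt (pi / 2) ^+ d.
have A10 : 0 < A1.
  by apply: mulr_gt0; [rewrite mulr_gt0 ?expR_gt0|rewrite exprn_gt0// sqrtr_gt0 divr_gt0// pi_gt0].
pose A2 := U * L * Num.sqrt (pi / 4^-1) ^+ d.
have A20 : 0 < A2.
  by apply: mulr_gt0; [exact: mulr_gt0|rewrite exprn_gt0// sqrtr_gt0 divr_gt0// ?pi_gt0// invr_gt0].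
(* A1 is the main term and A2 / K^2 the error; this K makes the error at most A1 / 2. *)
pose K := 1 + 2 * A2 / A1.
have K1 : 1 <= K by rewrite lerDl; apply: divr_ge0; [apply: mulr_ge0 => //; exact: ltW A20|exact: ltW A10].
have K2 : A2 / K ^+ 2 <= A1 / 2.
  have KK : 2 * A2 / A1 <= K ^+ 2.
    have -> : 2 * A2 / A1 = K - 1 by rewrite /K addrC addKr.
    nra.
  rewrite ler_pdivrMr ?exprn_gt0//; last by lra.
  rewrite ler_pdivrMr// in KK; lra.
have s20 : 0 < Num.sqrt (pi / 2^-1) :> R by rewrite sqrtr_gt0 divr_gt0// ?pi_gt0// invr_gt0.
exists K => //; exists (cd R d * Num.sqrt (pi / 2^-1) ^+ d * (A1 / 2)).
  by apply: mulr_gt0; [rewrite mulr_gt0 ?cd_gt0 ?exprn_gt0|rewrite divr_gt0].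
move=> N n rho t j N0 n0 nN rho0 /andP[t0 t1] Kr.
have ru := rhop R rho0; have rt0 := rate_gt0 R rho0.
have rho1 : 1 <= rho%:R :> R by rewrite ler1n.
have N1 : 1 <= N%:R :> R by rewrite ler1n.
have Np : 0 < N%:R :> R by rewrite ltr0n.
have Nb := powR_gt0 b Np.
set xi0 := xij R N j.
have gk : gdom (fun x => integralv (ker N t j x)).
  apply: (@gdom_le _ _ _ (rate R rho) (xj b N t j) (cd R d * integralv (@uhat R d N n))) => //.
    exact: vmeas_integralv (vmeas2_ker N t j).
  move=> x; have c0 := cd_gt0 R d.
  have guc : gdom (fun xi => @uhat R d N n xi * cos (dotv (x - xj b N t j) (xi - xij R N j) + dev N t j xi)).
    have m1 : vmeas (fun xi => dotv (x - xj b N t j) (xi - xij R N j) + dev N t j xi).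
      apply: vmeasD; last exact: vmeas_dev.
      by have := vmeas_dot (xij R N j) (x - xj b N t j); congr vmeas; apply/funext => xi; rewrite dotvC.
    by apply: gdom_uhat_trig; [exact: continuous_cos|exact: cosb|].
  rewrite (@integralv_eq _ _ _ (fun xi => (cd R d * chi b N t j x) * (@uhat R d N n xi *
    cos (dotv (x - xj b N t j) (xi - xij R N j) + dev N t j xi)))); last by move=> xi; rewrite /ker; ring.
  rewrite integralvZ// !normrM (ger0_norm (ltW c0)) (ger0_norm (gs_ge0 _ _ _)).
  rewrite mulrAC ler_wpM2r ?gs_ge0// ler_wpM2l ?(ltW c0)//.
  apply: le_trans (normr_integralv guc) _; apply: integralv_le; [exact: gdom_norm|exact: gdom_uhat|move=> xi].
  by rewrite normrM (ger0_norm (uhat_ge0 _ _ _)) ler_piMr ?uhat_ge0 ?cosb.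
apply: le_trans (integralv_le gk (gdom_cabs_S_chi N t j rho0) (fun x => cabs_S_chi_ge N t j x)); last first.
rewrite integral_ker_swap//.
have -> : Num.sqrt (pi / rate R rho) ^+ d = Num.sqrt (pi / 2^-1) ^+ d * rho%:R ^+ d.
  rewrite -exprMn; congr (_ ^+ _).
  rewrite /rate invfM -exprVn sqrt_scale ?invr_gt0//.
  by rewrite [rho%:R^-1^-1]invrK.
rewrite [cd R d * (_ * rho%:R ^+ d)]mulrA -[leRHS]mulrA ler_wpM2l//.
  by apply: mulr_ge0; [exact: ltW (cd_gt0 R d)|rewrite exprn_ge0// ltW].
(* Minorant from a single frequency k of u with |xi0 - k|^2 <= d: e^(-|xi - k|^2/2) >= e^(-d)
   e^(-|xi - xi0|^2), and rho >= 1. *)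
pose lo xi : R := G0 R d * expR (- d%:R) * gs (2 * rho%:R ^+ 2) xi0 xi.
(* Rate 1/4 = 1/2 - 1/8 - 1/8: one share of 1/8 absorbs the power b of the Taylor remainder, the
   other its factor |xi - xi0|^2. *)
pose er xi : R := (U * L / K ^+ 2) * gs (4^-1 * rho%:R ^+ 2) xi0 xi.
have r20 : 0 < rho%:R ^+ 2 :> R by rewrite exprn_gt0.
have glo : gdom lo by apply: gdomZ; apply: gdom_gs; rewrite mulr_gt0.
have ger : gdom er by apply: gdomZ; apply: gdom_gs; rewrite mulr_gt0// invr_gt0.
have Klo : A1 / 2 <= rho%:R ^+ d * integralv (fun xi => lo xi - er xi).
  rewrite integralvB// /lo /er !integralvZ ?integralv_gs ?mulr_gt0 ?invr_gt0//; last 2 first.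
  - by apply: gdom_gs; rewrite mulr_gt0// invr_gt0.
  - by apply: gdom_gs; rewrite mulr_gt0.
  rewrite !sqrt_scale ?invr_gt0// !expr_div_n.
  have -> : rho%:R ^+ d * (G0 R d * expR (- d%:R) * (Num.sqrt (pi / 2) ^+ d / rho%:R ^+ d) -
     U * L / K ^+ 2 * (Num.sqrt (pi / 4^-1) ^+ d / rho%:R ^+ d)) = A1 - A2 / K ^+ 2.
    by rewrite /A1 /A2; field; rewrite ?expf_neq0 ?gt_eqF//; lra.
  lra.
apply: le_trans Klo _; rewrite ler_wpM2l ?exprn_ge0//.
apply: integralv_le.
- have := gdomD glo (gdomZ (-1) ger).
  by under eq_fun do rewrite mulN1r.
- have gu : gdom (fun xi => @uhat R d N n xi * cos (dev N t j xi)).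
    by apply: gdom_uhat_trig; [exact: continuous_cos|exact: cosb|exact: vmeas_dev].
  apply: (gdomM (B := 1) gu (vmeas_gs _ _)) => xi.
  by rewrite ger0_norm ?gs_ge0// gs_le1// divr_ge0.
move=> xi; set V := normv (xi - xi0).
have V0 : 0 <= V by exact: normv_ge0.
have VV : dotv (xi - xi0) (xi - xi0) = V ^+ 2 by rewrite normv_sqr.
have u0 := uhat_ge0 N n xi.
have g0 : 0 <= gam N j xi by exact: gs_ge0.
have h1 : lo xi <= @uhat R d N n xi * gam N j xi.
  have [a] := xij_near R N rho0 j; rewrite -/xi0 => na.
  have hu : G0 R d * gs 2^-1 (kv R N a) xi <= @uhat R d N n xi.
    rewrite /uhat (bigD1 a)//= lerDl; apply: sumr_ge0 => a' _.
    by rewrite mulr_ge0 ?gs_ge0// ltW.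
  apply: le_trans (ler_wpM2r g0 hu); rewrite /lo -!mulrA ler_wpM2l ?(ltW G00)//.
  rewrite /gam /gs -!expRD ler_expR VV.
  have := dotv_sqr_dist xi (kv R N a) xi0.
  have := dotv_sqr_dist xi xi0 (kv R N a); rewrite VV => h2 _.
  have V2 : V ^+ 2 <= rho%:R ^+ 2 * V ^+ 2.
    by rewrite ler_peMl ?sqr_ge0// expr2; nra.
  have V20 : 0 <= V ^+ 2 by exact: sqr_ge0.
  lra.
have h2 : @uhat R d N n xi * (`|dev N t j xi| * gam N j xi) <= er xi.
  have pt := phase_taylor b00 xi bm (lt_le_trans Np (normv_xij_ge R d0 nN rho0 j)).
  rewrite -/xi0 -/V VV in pt.
  have dv : `|dev N t j xi| <= (b + 2) * m.+1%:R * (normv xi0 + V) `^ b * V ^+ 2.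
    rewrite /dev normrM (ger0_norm t0); apply: le_trans pt.
    by rewrite ler_piMl.
  have xv : (normv xi0 + V) `^ b <= (d%:R * 2) `^ b * N%:R `^ b * (C * expR (8^-1 * V ^+ 2)).
    apply: (@le_trans _ _ ((d%:R * 2 * N%:R * (1 + V)) `^ b)).
      apply: ge0_ler_powR; rewrite ?nnegrE ?addr_ge0 ?normv_ge0 ?mulr_ge0 ?addr_ge0//; first lra.
      have := normv_xij_le R nN rho0 j; rewrite -/xi0.
      have : V <= d%:R * 2 * N%:R * V by rewrite ler_peMl//; nra.
      lra.
    rewrite !powRM ?addr_ge0// ?mulr_ge0//.
    by rewrite ler_wpM2l ?mulr_ge0 ?powR_ge0 ?HC.
  have e1 : expR (8^-1 * V ^+ 2) <= expR (8^-1 * (rho%:R ^+ 2 * V ^+ 2)).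
    by rewrite ler_expR ler_wpM2l ?invr_ge0// ler_peMl ?sqr_ge0// expr2; nra.
  have e2 : V ^+ 2 <= 8 / rho%:R ^+ 2 * expR (8^-1 * (rho%:R ^+ 2 * V ^+ 2)).
    have := expR_ge1Dx (8^-1 * (rho%:R ^+ 2 * V ^+ 2)).
    set e := expR _ => he.
    by rewrite mulrAC ler_pdivlMr//; lra.
  have eN : N%:R `^ b / rho%:R ^+ 2 <= 1 / K ^+ 2.
    have NBE : N%:R `^ b = (N%:R `^ (b / 2)) ^+ 2.
      by rewrite -powR_mulrn ?powR_ge0// -powRrM; congr (_ `^ _); field.
    rewrite ler_pdivrMr// mulrC mulrA mulr1 ler_pdivlMr ?exprn_gt0//; last lra.
    rewrite NBE -exprMn lerXn2r ?nnegrE ?mulr_ge0 ?powR_ge0//; last by rewrite mulrC.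
    by lra.
  set E := expR (8^-1 * (rho%:R ^+ 2 * V ^+ 2)) in e1 e2.
  have E0 : 0 < E by exact: expR_gt0.
  have dl : `|dev N t j xi| <= L * (1 / K ^+ 2) * (E * E).
    apply: le_trans dv _.
    apply: (@le_trans _ _ ((b + 2) * m.+1%:R * ((d%:R * 2) `^ b * N%:R `^ b * (C * E)) * (8 / rho%:R ^+ 2 * E))).
      have q1 : 0 <= (b + 2) * m.+1%:R by rewrite mulr_ge0//; lra.
      have q2 : (normv xi0 + V) `^ b <= (d%:R * 2) `^ b * N%:R `^ b * (C * E).
        apply: le_trans xv _; apply: ler_wpM2l; first by rewrite mulr_ge0 ?powR_ge0.
        by apply: ler_wpM2l => //; exact: ltW.
      apply: ler_pM.
      - by rewrite mulr_ge0 ?powR_ge0.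
      - exact: sqr_ge0.
      - by rewrite ler_wpM2l.
      - exact: e2.
    rewrite [leLHS](_ : _ = L * (N%:R `^ b / rho%:R ^+ 2) * (E * E)); last first.
      rewrite /L; move: (m.+1%:R) ((_ * 2) `^ b) (N%:R `^ b) (rho%:R ^+ 2) r20 => M p1 p2 P P0.
      by field; rewrite gt_eqF.
    apply: ler_wpM2r; first by apply: mulr_ge0; exact: ltW.
    by apply: ler_wpM2l => //; exact: ltW.
  have uU := uhat_le N n xi.
  have EEg : E * E * gam N j xi = gs (4^-1 * rho%:R ^+ 2) xi0 xi.
    by rewrite /gam /gs /E -!expRD VV; congr expR; field.
  apply: (@le_trans _ _ (U * (L * (1 / K ^+ 2) * (E * E) * gam N j xi))).
    by rewrite ler_pM// ?mulr_ge0// ler_wpM2r.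
  rewrite -[L * _ * _ * _]mulrA EEg /er le_eqVlt; apply/orP; left; apply/eqP.
  by rewrite div1r; ring.
apply: (@le_trans _ _ (@uhat R d N n xi * (1 - `|dev N t j xi|) * gam N j xi)); last first.
  by rewrite ler_wpM2r// ler_wpM2l// one_sub_cos_le.
lra.
Qed.

End PacketLower.

(** * From packet averages to the dispersive lower bound *)

Section DispersiveLower.
Variables (R : realType) (d : nat) (b : R).
Local Notation vec := (Defs.vec R d).
Implicit Types (x : vec).
Hypothesis d0 : (0 < d)%N.
Hypothesis b0 : 0 < b.
Local Notation absS N n t := (fun x => cabs (Complex (SR b N n t x) (SI b N n t x))).

(** Bounded overlap of the weights replaces disjoint supports: f is at least the sum of the f w_i
    divided by the overlap C0. *)
Lemma intRd_ge_sum (I : finType) (f : vec -> R) (w : I -> vec -> R) (C0 B : R) :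
  0 < C0 -> vmeas f -> (forall x, 0 <= f x <= B) -> (forall i, gdom (w i)) -> (forall i x, 0 <= w i x) ->
  (forall x, \sum_i w i x <= C0) ->
  ((C0^-1 * \sum_i integralv (fun x => f x * w i x))%:E <= intRd (fun x => (f x)%:E))%E.
Proof.
move=> C00 mf fB gw w0 wC.
have g i : gdom (fun x => f x * w i x).
  have := gdomM (B := B) (gw i) mf; under eq_fun do rewrite mulrC; apply=> x.
  by have /andP[f0 fb] := fB x; rewrite ger0_norm.
rewrite -integralv_sumE// -integralvZ; last exact: gdom_sum.
rewrite -intRd_gdom; last by apply: gdomZ; exact: gdom_sum.
apply: intRd_le => x; rewrite lee_fin; have /andP[f0 _] := fB x.
  by rewrite mulr_ge0 ?invr_ge0 ?(ltW C00)// sumr_ge0// => i _; exact: mulr_ge0.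
by rewrite -mulr_sumr ler_pdivrMl// mulrC ler_wpM2r.
Qed.

(** A linear minorant of y^r, through which a lower bound on the average of a function passes to its
    r-th power without Hoelder's inequality. *)
Lemma powR_ge_lin (r lam y : R) : 1 <= r -> 0 < lam -> 0 <= y -> lam `^ r * (y / lam - 1) <= y `^ r.
Proof.
move=> r1 l0 y0; have z0 : 0 <= y / lam by rewrite divr_ge0// ltW.
have -> : y `^ r = lam `^ r * (y / lam) `^ r.
  by rewrite -powRM ?(ltW l0)// mulrC divfK// gt_eqF.
rewrite ler_wpM2l ?powR_ge0//; have [z1|z1] := leP 1 (y / lam).
  have : (y / lam) `^ 1 <= (y / lam) `^ r by apply: ler_powR.
  by rewrite powRr1//; lra.
by have := powR_ge0 (y / lam) r; lra.
Qed.

Lemma integral_chi N n rho t (j : {ffun 'I_d -> 'I_(n * rho)}) : (0 < rho)%N ->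
  integralv (chi b N t j) = (Num.sqrt (pi / 2^-1) * rho%:R) ^+ d.
Proof.
move=> rho0; rewrite integralv_gs ?rate_gt0//; congr (_ ^+ _).
by rewrite /rate invfM -exprVn sqrt_scale ?invr_gt0 ?rhop// [rho%:R^-1^-1]invrK.
Qed.

Section level.
Variables (N n rho : nat) (t c1 : R).
Hypotheses (N0 : (0 < N)%N) (n0 : (0 < n)%N) (nN : (n <= N)%N) (rho0 : (0 < rho)%N) (c10 : 0 < c1).
Hypothesis pk : forall j : {ffun 'I_d -> 'I_(n * rho)},
  c1 <= integralv (fun x => absS N n t x * chi b N t j x).
Let P : R := (Num.sqrt (pi / 2^-1) * rho%:R) ^+ d.
(** Half of the average c1 / P of |S(t)u| that each packet guarantees. *)
Let lam := c1 / (2 * P).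
Let Bd : R := 1 + 2 * cd R d * integralv (@uhat R d N n).

Lemma P_gt0 : 0 < P.
Proof. by rewrite exprn_gt0// mulr_gt0 ?rhop// sqrtr_gt0 divr_gt0// ?pi_gt0// invr_gt0. Qed.

Lemma lam_gt0 : 0 < lam.
Proof. by rewrite divr_gt0// mulr_gt0// P_gt0. Qed.

Let absS_bd x : 0 <= absS N n t x <= Bd.
Proof.
apply/andP; split; first exact: sqrtr_ge0.
by apply: le_trans (cabs_S_le b N n t x) _; rewrite lerDr.
Qed.

Let gchi j : gdom (@chi R d b N n rho t j). Proof. by apply: gdom_gs; exact: rate_gt0. Qed.

Let gdom_chi j (f : vec -> R) B : vmeas f -> (forall x, 0 <= f x <= B) -> gdom (fun x => f x * @chi R d b N n rho t j x).
Proof.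
move=> mf fB; have := gdomM (B := B) (gchi j) mf; under eq_fun do rewrite mulrC; apply=> x.
by have /andP[f0 fb] := fB x; rewrite ger0_norm.
Qed.

(** Integrated against a packet, the linear minorant gives lam^r (c1 / lam - P) = lam^r P, because
    c1 = 2 P lam. There are (n rho)^d packets, with overlap at most C0. *)
Lemma level_powR r C0 : 1 <= r -> 0 < C0 -> (forall x, \sum_j @chi R d b N n rho t j x <= C0) ->
  ((((n * rho) ^ d)%:R * P / C0 * lam `^ r)%:E <= intRd (fun x => (absS N n t x `^ r)%:E))%E.
Proof.
move=> r1 C00 wC; have r0 : 0 <= r by lra.
have P0 := P_gt0; have l0 := lam_gt0.
have mS := @vmeas_cabs_S R d b N n t.
have mSr : vmeas (fun x : vec => absS N n t x `^ r) by exact: (vmeas_comp (@measurable_powR R r) mS).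
have Srb x : 0 <= absS N n t x `^ r <= Bd `^ r.
  have /andP[s0 sb] := absS_bd x; rewrite powR_ge0/=; apply: ge0_ler_powR; rewrite ?nnegrE//.
  exact: le_trans sb.
apply: le_trans (intRd_ge_sum C00 mSr Srb gchi (fun j x => gs_ge0 _ _ _) wC).
rewrite lee_fin [leLHS](_ : _ = C0^-1 * (((n * rho) ^ d)%:R * (P * lam `^ r))); last by ring.
rewrite ler_wpM2l ?invr_ge0 ?(ltW C00)//.
have -> : ((n * rho) ^ d)%:R * (P * lam `^ r) = \sum_(j : {ffun 'I_d -> 'I_(n * rho)}) P * lam `^ r.
  by rewrite sumr_const card_ffun !card_ord mulr_natl.
apply: ler_sum => j _.
apply: (@le_trans _ _ (integralv (fun x => lam `^ r / lam * (absS N n t x * chi b N t j x) - lam `^ r * chi b N t j x))).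
  rewrite integralvB; [|by apply: gdomZ; exact: gdom_chi absS_bd|exact: gdomZ].
  rewrite !integralvZ//; last exact: gdom_chi absS_bd.
  rewrite integral_chi// -/P.
  have h : lam `^ r / lam * c1 <= lam `^ r / lam * integralv (fun x => absS N n t x * chi b N t j x).
    by rewrite ler_wpM2l// divr_ge0 ?powR_ge0// ltW.
  have e : lam `^ r / lam * c1 = 2 * P * lam `^ r.
    rewrite {2}/lam; field; rewrite !gt_eqF//.
  lra.
apply: integralv_le.
- have := gdomD (gdomZ (lam `^ r / lam) (gdom_chi j mS absS_bd)) (gdomZ (- lam `^ r) (gchi j)).
  by under eq_fun do rewrite mulNr.
- exact: gdom_chi Srb.
move=> x; have /andP[s0 _] := absS_bd x; have := powR_ge_lin r1 l0 s0 => h.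
have := ler_wpM2r (gs_ge0 (rate R rho) (xj b N t j) x) h; rewrite -/(chi b N t j x).
lra.
Qed.

(** One packet suffices: |S(t)u| is at most lam off the level set and at most Bd on it, so c1 <= lam
    P + Bd times the packet mass of the level set, where lam P = c1 / 2. *)
Lemma level_oo : ((c1 / (2 * Bd))%:E <= intRd (fun x => if (lam <= absS N n t x)%R then 1%:E else 0%:E))%E.
Proof.
have P0 := P_gt0; have l0 := lam_gt0.
have mS := @vmeas_cabs_S R d b N n t.
have p0 : (0 < n * rho)%N by rewrite muln_gt0 n0.
pose j : {ffun 'I_d -> 'I_(n * rho)} := [ffun=> Ordinal p0].
have c0 := cd_gt0 R d.
have u0 : 0 <= integralv (@uhat R d N n) by apply: integralv_ge0 => xi; exact: uhat_ge0.
have Bd0 : 0 < Bd by rewrite ltr_wpDr// !mulr_ge0// ltW.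
pose I x : R := if lam <= absS N n t x then 1 else 0.
have mI : vmeas I.
  apply: (@vmeas_comp _ _ (fun y => if lam <= y then 1 else 0) _ _ mS).
  rewrite (_ : (fun y => _) = \1_(`[lam, +oo[%classic)); first exact: measurable_indic.
  by apply/funext => y; rewrite indicE mem_setE in_itv/= andbT; case: ifP.
have Ib x : 0 <= I x <= 1 by rewrite /I; case: ifP; rewrite lexx ler01.
have gI := gdom_chi j mI Ib.
apply: (@le_trans _ _ (intRd (fun x => (I x * chi b N t j x)%:E))); last first.
  apply: intRd_le => x; have /andP[i0 _] := Ib x.
    by rewrite lee_fin mulr_ge0// gs_ge0.
  rewrite [leRHS](_ : _ = (I x)%:E); last by rewrite /I; case: ifP.
  by rewrite lee_fin ler_piMr// gs_le1// ltW// rate_gt0.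
rewrite intRd_gdom// lee_fin ler_pdivrMr ?mulr_gt0//.
have gS := gdom_chi j mS absS_bd.
have h : integralv (fun x => absS N n t x * chi b N t j x) <=
    integralv (fun x => lam * chi b N t j x + Bd * (I x * chi b N t j x)).
  apply: integralv_le => //; first by apply: gdomD; exact: gdomZ.
  move=> x; have /andP[s0 sb] := absS_bd x; have c := gs_ge0 (rate R rho) (xj b N t j) x.
  rewrite mulrA -mulrDl ler_wpM2r// /I; case: ifPn => [_|]; first by rewrite mulr1 (le_trans sb)// lerDr ltW.
  by rewrite -ltNge mulr0 addr0 => /ltW.
rewrite integralvD in h; [|exact: gdomZ|exact: gdomZ].
rewrite !integralvZ// integral_chi// -/P in h.
have e : lam * P = c1 / 2 by rewrite /lam; field; rewrite gt_eqF.
have := pk j; lra.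
Qed.

End level.

Lemma dispersive_lower (p : \bar R) : (1 <= p)%E -> exists2 c : R, 0 < c & forall N n, (0 < N)%N ->
  (0 < n)%N -> (n <= N)%N ->
  ((c * ((n ^ d)%:R `^ einv p * N%:R `^ (d%:R * b * (einv p - 2^-1))))%:E <=
    LpIRd p (fun t => Sbeta (b + 2) t (@testu R d N n)))%E.
Proof.
move=> p1; have [K K1 [c1 c10 H]] := packet_lower d0 b0.
have K0 : 0 < K by lra.
have /andP[e0 e1] := einv_bound p1.
set C0 := lattice_const ((128 * K ^+ 4)^-1) ^+ d : R.
have C00 : 0 < C0.
  by rewrite exprn_gt0//; apply: lattice_const_gt0; rewrite invr_gt0 mulr_gt0// exprn_gt0.
pose s2 : R := Num.sqrt (pi / 2^-1).
have s20 : 0 < s2 by rewrite sqrtr_gt0 divr_gt0// ?pi_gt0// invr_gt0.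
pose W := 2^-1 * (s2 ^+ d / C0).
have W0 : 0 < W by rewrite mulr_gt0 ?invr_gt0// divr_gt0// exprn_gt0.
exists (c1 / (2 * s2 ^+ d * (2 * K) ^+ d) * W `^ einv p).
  by rewrite mulr_gt0 ?powR_gt0// divr_gt0// !mulr_gt0// exprn_gt0// mulr_gt0.
move=> N n N0 n0 nN.
have N1 : 1 <= N%:R :> R by rewrite ler1n.
have Np : 0 < N%:R :> R by rewrite ltr0n.
set X := N%:R `^ (b / 2) : R.
have X1 : 1 <= X by rewrite -[leLHS](powRr0 N%:R); apply: ler_powR => //; have := b0; lra.
have KX : 0 <= K * X by rewrite mulr_ge0//; lra.
(* An integer between K X and 2 K X, as K X >= 1: the lower bound makes the Taylor error small, the
   upper one bounds the overlap. *)
pose rho := (Num.truncn (K * X)).+1.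
have /andP[rl ru] := truncn_itv KX.
have Kr : K * X <= rho%:R by exact: ltW.
have rK : rho%:R <= 2 * K * X.
  have : 1 <= K * X by nra.
  by rewrite -[rho%:R]natr1; lra.
have rp : 0 < rho%:R :> R by rewrite ltr0n.
set P : R := (s2 * rho%:R) ^+ d.
have P0 : 0 < P by rewrite exprn_gt0// mulr_gt0.
pose lam := c1 / (2 * P).
have pk (t : R) j : 0 <= t <= 1 -> c1 <= integralv (fun x => absS N n t x * @chi R d b N n rho t j x).
  by move=> tt; apply: H.
have tt (t : R) : 2^-1 <= t <= 1 -> 0 <= t <= 1 by move=> /andP[h1 h2]; apply/andP; split; lra.
have l0 : 0 < lam by exact: lam_gt0.
have h : ((lam * ((1 - 2^-1) * (((n * rho) ^ d)%:R * P / C0)) `^ einv p)%:E <=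
    LpIRd p (fun t => Sbeta (b + 2) t (@testu R d N n)))%E.
  apply: LpIRd_lower => //; [lra| |exact: ltW| |].
  - by rewrite mulr_ge0 ?invr_ge0 ?(ltW C00)// mulr_ge0// ltW.
  - move=> r pr t th; rewrite pr lee_fin in p1.
    under [in leRHS]eq_fun do rewrite Sbeta_testu.
    apply: level_powR => //; first by move=> j; apply: pk; exact: tt.
    by move=> x; apply: overlap => //; have /andP[] := th.
  - move=> _; exists (c1 / (2 * (1 + 2 * cd R d * integralv (@uhat R d N n)))).
      rewrite divr_gt0// mulr_gt0// ltr_wpDr// !mulr_ge0 ?(ltW (cd_gt0 _ _))//.
      by apply: integralv_ge0 => xi; exact: uhat_ge0.
    move=> t th; under [in leRHS]eq_fun do rewrite Sbeta_testu.
    by apply: level_oo => // j; apply: pk; exact: tt.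
apply: le_trans h; rewrite lee_fin.
have -> : (1 - 2^-1) * (((n * rho) ^ d)%:R * P / C0) = W * ((n ^ d)%:R * (rho%:R ^+ 2) ^+ d).
  rewrite expnMn natrM [(rho ^ d)%:R]natrX /W /P expr2 !exprMn.
  by field; rewrite gt_eqF.
move: W W0 => V V0.
have Q0 : 0 <= (rho%:R ^+ 2) ^+ d :> R by rewrite exprn_ge0// sqr_ge0.
rewrite (powRM _ (ltW V0) (mulr_ge0 (ler0n _ _) Q0)) (powRM _ (ler0n _ _) Q0).
have Xb : X ^+ 2 = N%:R `^ b.
  by rewrite -powR_mulrn ?powR_ge0// -powRrM; congr (_ `^ _); field.
have X0 : 0 < X by lra.
(* The level decays like rho^(-d) and uses the upper bound on rho; the measure grows like rho^(2d)
   and uses the lower bound. With rho of size N^(b/2), their product has exponent d b (1/p -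
   1/2). *)
have l1 : c1 / (2 * s2 ^+ d * (2 * K) ^+ d) * X ^- d <= lam.
  have q : 0 < s2 ^+ d * ((2 * K) ^+ d * X ^+ d) by rewrite !mulr_gt0 ?exprn_gt0// mulr_gt0.
  rewrite [leLHS](_ : _ = c1 / (2 * (s2 ^+ d * ((2 * K) ^+ d * X ^+ d)))); last first.
    by field; rewrite ?expf_neq0 ?mulf_neq0 ?gt_eqF.
  rewrite /lam ler_pM2l// lef_pV2; [rewrite ler_pM2l//|by rewrite posrE mulr_gt0..].
  rewrite /P exprMn ler_pM2l ?exprn_gt0// -exprMn.
  by rewrite lerXn2r// nnegrE; [exact: ltW|apply: mulr_ge0; lra].
have l2 : ((X ^+ 2) ^+ d) `^ einv p <= ((rho%:R ^+ 2) ^+ d) `^ einv p.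
  have Xr : X ^+ 2 <= rho%:R ^+ 2.
    by apply: lerXn2r; rewrite ?nnegrE ?(ltW X0) ?(ltW rp)//; apply: le_trans Kr; rewrite ler_peMl// ltW.
  apply: ge0_ler_powR; rewrite ?nnegrE//; first by rewrite exprn_ge0// sqr_ge0.
  by apply: lerXn2r; rewrite ?nnegrE ?sqr_ge0.
have e : N%:R `^ (d%:R * b * (einv p - 2^-1)) = X ^- d * ((X ^+ 2) ^+ d) `^ einv p.
  rewrite Xb -!powR_mulrn ?powR_ge0// /X -!powRrM -powRN -powRD.
    by congr (_ `^ _); field.
  by rewrite (gt_eqF Np) implybT.
have q : 0 <= V `^ einv p * (n ^ d)%:R `^ einv p by rewrite mulr_ge0 ?powR_ge0.
rewrite e.
have lX : 0 <= c1 / (2 * s2 ^+ d * (2 * K) ^+ d) * X ^- d.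
  apply: ltW; rewrite divr_gt0 ?exprn_gt0//; apply: divr_gt0 => //.
  by rewrite mulr_gt0 ?exprn_gt0 ?mulr_gt0// exprn_gt0.
have hh := ler_wpM2l q (ler_pM lX (powR_ge0 _ _) l1 l2).
apply: le_trans (le_trans _ hh) _; rewrite le_eqVlt; apply/orP; left; apply/eqP; ring.
Qed.

End DispersiveLower.

(** * Comparison of growth rates in N *)

Lemma powR_growth (R : realType) (c C A B : R) : 0 < c ->
  (forall N, (0 < N)%N -> c * N%:R `^ A <= C * N%:R `^ B) -> A <= B.
Proof.
move=> c0 H; rewrite leNgt; apply/negP => BA.
have dl : 0 < A - B by rewrite subr_gt0.
pose Y := Num.max 1 (C / c); have Y1 : 1 <= Y by rewrite le_max lexx.
have Y0 : 0 < Y by lra.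
pose N := (Num.bound (Y `^ (A - B)^-1)).
have hN : Y `^ (A - B)^-1 < N%:R by apply: archi_boundP; exact: powR_ge0.
have Np : 0 < N%:R :> R by apply: le_lt_trans hN; exact: powR_ge0.
have N0 : (0 < N)%N by rewrite -(ltr0n R).
have : Y < N%:R `^ (A - B).
  have : (Y `^ (A - B)^-1) `^ (A - B) < N%:R `^ (A - B).
    by apply: gt0_ltr_powR => //; rewrite nnegrE ?powR_ge0// ltW.
  by rewrite -powRrM mulVf ?gt_eqF// powRr1// ltW.
rewrite ltNge => /negP; apply.
apply: (@le_trans _ _ (C / c)); last by rewrite le_max lexx orbT.
rewrite ler_pdivlMr// mulrC -(ler_pM2r (powR_gt0 B Np)) -mulrA -powRD ?subrK ?H//.
by rewrite (gt_eqF Np) implybT.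
Qed.

Section Testing.
Variables (R : realType) (d : nat) (beta s : R) (p q : \bar R).
Variable eta : 'rV[int]_d -> Defs.vec R d -> R[i].
Hypothesis d0 : (0 < d)%N.
Hypotheses (p1 : (1 <= p)%E) (q1 : (1 <= q)%E) (eta_bapu : bapu eta).

Lemma modnorm_ge0 f : (0 <= modnorm eta s p q f)%E.
Proof.
rewrite /modnorm; case: (q) q1 => [r _| _|//]; first exact: poweR_ge0.
apply: ereal_sup_ge; exists ((powR (jbr (Defs.intv R (0 : 'rV[int]_d))) s)%:E * LpRd p (box eta 0 f))%E; first by exists 0.
by rewrite mule_ge0 ?lee_fin ?powR_ge0 ?LpRd_ge0.
Qed.

Lemma testing (C0 : R) :
  (forall u : Defs.vec R d -> R[i], schwartz u ->
     (LpIRd p (fun t => Sbeta beta t u) <= C0%:E * modnorm eta s p q u)%E) ->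
  exists C : R, forall N n, (0 < N)%N -> (n <= N)%N ->
  (LpIRd p (fun t => Sbeta beta t (@testu R d N n)) <= (C * (N%:R `^ s * (n ^ d)%:R `^ einv q))%:E)%E.
Proof.
move=> H; have [K K0 HK] := modnorm_bound d0 eta_bapu s p1 q1.
(* C0 may be negative; it is replaced by a positive constant before the upper bound on the norm is
   inserted. *)
exists ((`|C0| + 1) * K) => N n N0 nN.
apply: le_trans (H _ (schwartz_testu _ _ _ _)) _.
apply: (@le_trans _ _ ((`|C0| + 1)%:E * modnorm eta s p q (@testu R d N n))%E).
  by apply: lee_wpmul2r; [exact: modnorm_ge0|rewrite lee_fin; have := ler_norm C0; lra].
rewrite -mulrA EFinM; apply: lee_wpmul2l; first by rewrite lee_fin addr_ge0.
by rewrite mulrA; exact: HK.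
Qed.

End Testing.

(** The space-time estimate is assumed on Schwartz functions only, for which the Fourier integrals
    are defined pointwise; this weakens the hypothesis. The test functions belong to this class. *)
Theorem theorem1p5 (R : realType) (d : nat) (beta s : R) (p q : \bar R)
    (eta : 'rV[int]_d -> 'rV[R]_d -> R[i]) :
  (0 < d)%N -> 2 < beta -> (1%:E <= p)%E -> (1%:E <= q)%E -> bapu eta ->
  (exists C0 : R, forall u : 'rV[R]_d -> R[i], schwartz u ->
     (LpIRd p (fun t => Sbeta beta t u) <= C0%:E * modnorm eta s p q u)%E) ->
  Num.max (d%:R * (1 - einv p - einv q) - beta * einv p)
          (d%:R * (beta - 2) * (einv p - 2^-1) + d%:R * (einv p - einv q)) <= s /\
  ((p <= 2%:E)%E -> (q <= p)%E -> d%:R * (beta - 2) * (einv p - 2^-1) <= s).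
Proof.
move=> d0 beta2 p1 q1 be [C0 HC0].
have b0 : 0 < beta - 2 by rewrite subr_gt0.
have [C HC] := testing d0 p1 q1 be HC0.
have [cf cf0 Hf] := focusing_lower d0 b0 p1.
have [cd cd0 Hd] := dispersive_lower d0 b0 p1.
rewrite !subrK in Hf Hd.
have pw (N : nat) (e : R) : (0 < N)%N -> (N ^ d)%:R `^ e = N%:R `^ (d%:R * e) :> R.
  by move=> N0; rewrite powRrM powR_mulrn// natrX.
have pD (N : nat) (a e : R) : (0 < N)%N -> N%:R `^ a * N%:R `^ e = N%:R `^ (a + e) :> R.
  by move=> N0; rewrite powRD// pnatr_eq0 -lt0n N0 implybT.
split; last first.
  move=> _ _; apply: (powR_growth cd0 (C := C)) => N N0.
  have := le_trans (Hd N 1 N0 isT N0) (HC N 1 N0 N0).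
  by rewrite lee_fin exp1n !powR1 mul1r mulr1.
rewrite ge_max; apply/andP; split.
  have : d%:R - (d%:R + beta) * einv p <= s + d%:R * einv q; last by lra.
  apply: (powR_growth cf0 (C := C)) => N N0.
  have := le_trans (Hf N N0) (HC N N N0 (leqnn N)).
  by rewrite lee_fin pw// pD// -addrA subrK.
have : d%:R * einv p + d%:R * (beta - 2) * (einv p - 2^-1) <= s + d%:R * einv q; last by lra.
apply: (powR_growth cd0 (C := C)) => N N0.
have := le_trans (Hd N N N0 N0 (leqnn N)) (HC N N N0 (leqnn N)).
by rewrite lee_fin !pw// !pD.
Qed.
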